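(* Let $k\ge2$ and $t\in[(k-1)r,kr)$. The renormalized $k$-hop count $\widetilde\sigma^{(\lambda)}_k(t)$ satisfies the Wasserstein and Kolmogorov bounds $$d_W\big(\widetilde\sigma^{(\lambda)}_k(t),\mathcal N\big)\le\frac{C(k,r)}{\sqrt\lambda}\qquad\text{and}\qquad d_K\big(\widetilde\sigma^{(\lambda)}_k(t),\mathcal N\big)\le\frac{C(k,r)}{\sqrt\lambda}$$ for some constant $C(k,r)>0$ as $\lambda$ tends to infinity, i.e. for all $\lambda>\lambda_0$ for some $\lambda_0>0$.
   Context: Fix $r>0$. Nodes form a Poisson point process on $[0,kr]$ with constant intensity $\lambda>0$ (distribution $\mathbb P_\lambda$). Additional nodes are placed at $0$ and at $t\in[0,kr]$; two nodes are connected if and only if their distance is at most $r$. $\sigma_k(t)$ is the number of $k$-hops from $0$ to $t$, i.e. the number of $(k-1)$-tuples of Poisson nodes $0<x_1<\cdots<x_{k-1}<t$ with $x_{i+1}-x_i\le r$ for $i=0,\ldots,k-1$, where $x_0:=0$, $x_k:=t$. $\sigma^{(\lambda)}_k(t)$ denotes a random variable whose distribution is that of $\sigma_k(t)$ under $\mathbb P_\lambda$, and $$\widetilde\sigma^{(\lambda)}_k(t):=\frac{\sigma^{(\lambda)}_k(t)-\mathbb E_\lambda[\sigma_k(t)]}{\sqrt{\mathrm{Var}_\lambda[\sigma_k(t)]}}.$$ $\mathcal N$ is a standard normal random variable. The distances are $d_W(X,Y):=\sup_{h\in\mathrm{Lip}(1)}|\mathbb E[h(X)]-\mathbb E[h(Y)]|$,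 with $\mathrm{Lip}(1)$ the real-valued Lipschitz functions with Lipschitz constant at most $1$, and $d_K(X,Y):=\sup_{x\in\mathbb R}|\mathbb P(X\le x)-\mathbb P(Y\le x)|$. The parameters $k$, $r$ and $t$ are fixed before the constants $C(k,r)$ and $\lambda_0$ are chosen. *)

(* Defs.v *)
From HB Require Import structures.
From mathcomp Require Import all_boot all_order all_algebra finmap.
From mathcomp Require Import all_classical all_reals all_analysis.

Set Implicit Arguments.
Unset Strict Implicit.
Unset Printing Implicit Defensive.

Import Order.TTheory GRing.Theory Num.Theory.
Import numFieldNormedType.Exports.

Local Open Scope classical_set_scope.
Local Open Scope ring_scope.

(* Mutual independence of a finite family; subfamilies are covered by taking
   some of the sets A i to be the whole space. *)
Definition mutually_independent (R : realType) (d d' : measure_display)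
    (T : measurableType d) (U : measurableType d') (P : probability T R)
    (m : nat) (Y : 'I_m -> T -> U) : Prop :=
  forall A : 'I_m -> set U, (forall i, measurable (A i)) ->
    P (\bigcap_i (Y i @^-1` A i)) = (\prod_(i < m) P (Y i @^-1` A i))%E.

Definition npoints (R : realType) (T : Type) (X : T -> {fset R}) (B : set R)
    (w : T) : nat :=
  #|` [fset x in X w | x \in B]%fset|.

(* X is a Poisson point process on D with constant intensity lam.  As the
   intensity measure has no atoms the process is simple, so a realization is
   encoded as a finite set of points; D is meant to have finite measure.
   The last argument 0 of poisson_prob is a dummy: the library definition does
   not use it. *)
Definition poisson_process (R : realType) (d : measure_display)
    (T : measurableType d) (P : probability T R) (D : set R) (lam : R)
    (X : T -> {fset R}) : Prop :=
  [/\ forall w x, x \in X w -> D x,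
      forall B, measurable B -> B `<=` D ->
        measurable_fun [set: T] (npoints X B),
      forall B, measurable B -> B `<=` D -> forall A : set nat,
        P (npoints X B @^-1` A) =
        poisson_prob (lam * fine (lebesgue_measure B)) 0%N A
    & forall (m : nat) (B : 'I_m -> set R),
        (forall i, measurable (B i)) -> (forall i, B i `<=` D) ->
        trivIset [set: 'I_m] B ->
        mutually_independent P (fun i => npoints X (B i))].

(* Number of k-hops from 0 to t through the nodes V: (k-1)-tuples of nodes
   with 0 < x_1 < ... < x_(k-1) < t and all k successive gaps at most r. *)
Definition hop_count (R : realType) (k : nat) (r t : R) (V : {fset R}) : nat :=
  #|[pred x : k.-1.-tuple V |
     path (fun a b : R => (a < b) && (b - a <= r)) 0
          (rcons [seq val v | v <- x] t)]|.

Definition renormalized (R : realType) (d : measure_display)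
    (T : measurableType d) (P : probability T R) (Y : T -> R) : T -> R :=
  fun w => (Y w - fine 'E_P[Y]) / Num.sqrt (fine 'V_P[Y]).

Definition wasserstein_dist (R : realType) (d d' : measure_display)
    (T : measurableType d) (U : measurableType d')
    (P : probability T R) (Q : probability U R)
    (X : T -> R) (Y : U -> R) : \bar R :=
  ereal_sup [set `| 'E_P[h \o X] - 'E_Q[h \o Y] |%E |
             h in [set h : R -> R | 1.-lipschitz h]].

Definition kolmogorov_dist (R : realType) (d d' : measure_display)
    (T : measurableType d) (U : measurableType d')
    (P : probability T R) (Q : probability U R)
    (X : T -> R) (Y : U -> R) : \bar R :=
  ereal_sup [set `| P [set w | (X w <= x)%R] - Q [set w | (Y w <= x)%R] |%E |
             x in [set: R]].

Definition standard_normal (R : realType) (d : measure_display)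
    (T : measurableType d) (P : probability T R) (Z : {RV P >-> R}) : Prop :=
  forall A : set R, measurable A -> distribution P Z A = normal_prob 0 1 A.

(* Main.v *)
(* Cut [0, kr] into n+1 cells.  For n large (depending on the configuration) the
   hop count is a polynomial g, of degree at most one in each variable, in the
   independent Poisson cell counts Z_j of means p_j, so it suffices to bound the
   Stein discrepancy of the normalization F of g(Z) uniformly in n and then let n
   tend to infinity by dominated convergence.
     Write g = mu + L + Rem with L = sum_j a_j (Z_j - p_j) the first chaos
   component.  With f the solution of Stein's equation f' = w f + h - m, the Mecke
   formula computes E[L f(F)] through the increments of f along the add-one costs
   D_j g.  For h nondecreasing the function H(w) = h(w) - m - w f(w) is
   nondecreasing too, and as D_j g >= 0 the Taylor error of an increment of size D is
   at most D times that of H; a second use of Mecke turns the sum of these errors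
   into E[H(F) sum_j a_j D_j g (Z_j - p_j)].  As |H(w)| <= C (1 + |w|), only second
   moments are left, and they are controlled by the Poincare inequality.
     The test functions allowed are the continuous nondecreasing h with
   h(y) - h(x) <= 1 + (y - x) for x <= y.  This class contains (h + id) / 2 for
   every 1-Lipschitz h, whence the Wasserstein bound, and arbitrarily steep
   ramps, whence the Kolmogorov bound. *)
Require Import Defs.
From HB Require Import structures.
From mathcomp Require Import all_boot all_order all_algebra finmap.
From mathcomp Require Import all_classical all_reals all_analysis.
From mathcomp Require Import measurable_realfun ring lra.

Set Implicit Arguments.
Unset Strict Implicit.
Unset Printing Implicit Defensive.

Import Order.TTheory GRing.Theory Num.Theory.
Import numFieldNormedType.Exports.

Local Open Scope classical_set_scope.
Local Open Scope ring_scope.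

(** The process is known only through its counts. On cells the Mecke formula is a reindexing of sums
    over count vectors, and the expectation becomes a functional [Ex] on functions of polynomial
    growth. No estimate may depend on the number of cells: only the total mean, at most [k r lam],
    and second moments of first and second differences enter. With [m = k - 1] and
    [x = lam ^+ m.-1], add-one costs are of order [x], second differences of order [x / lam], and
    the variance is at least of order [lam * x ^+ 2]; every error term is then at most of order
    [1 / sqrt lam]. The obstacle is a steep test function: [f'] varies by order one over arbitrarily
    short distances, so a Taylor bound through a second derivative of [f] degenerates. Monotonicity
    gives an error term that ignores the slope, so ramps may be steepened after the bound is proved.
    The variance bound rests on a positive proportion of admissible tuples: nodes near the
    arithmetic progression of step [t / k], which is below [r] because [t < k r]. *)

(** * Limits of integrals and calculus on the real line *)

Lemma Rintegral_dominated_cvg (d : measure_display) (T : measurableType d)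
    (R : realType) (mu : {measure set T -> \bar R}) (f_ : (T -> R)^nat)
    (f g : T -> R) :
  (forall n, measurable_fun [set: T] (f_ n)) ->
  (forall x, f_ n x @[n --> \oo] --> f x) ->
  mu.-integrable [set: T] (EFin \o g) ->
  (forall n x, `|f_ n x| <= g x) ->
  \int[mu]_x f_ n x @[n --> \oo] --> \int[mu]_x f x.
Proof.
move=> mf ff ig fg.
have mf' n : measurable_fun [set: T] (EFin \o f_ n : T -> \bar R) by exact/measurable_EFinP.
have ff' x : [set: T] x -> (EFin \o f_ n) x @[n --> \oo] --> (EFin \o f) x.
  by move=> _; apply: cvg_EFin; [exact: nearW|exact: ff].
have fg' n x : [set: T] x -> (`|(EFin \o f_ n) x| <= (EFin \o g) x)%E.
  by move=> _ /=; rewrite lee_fin.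
have fin x : [set: T] x -> (EFin \o g) x \is a fin_num by [].
apply: fine_cvg; rewrite fineK.
  exact: (dominated_cvg measurableT mf' ff' fin ig fg').
apply: integrable_fin_num => //.
have mf0 : measurable_fun [set: T] (EFin \o f).
  exact: emeasurable_fun_cvg mf' ff'.
by have [] := dominated_convergence measurableT mf' mf0 (aeW _ ff') ig
  (aeW _ (fun x n => fg' n x)).
Qed.

Lemma measurable_patch_itv (R : realType) (u : R -> R) (i : interval R) :
  measurable_fun [set: R] u -> measurable_fun [set: R] (u \_ [set` i]).
Proof.
by move=> mu; apply/(measurable_restrictT _ _).1 => //; exact: measurable_funTS.
Qed.

Lemma cvg_Rintegral_itv_pinfty (R : realType) (u : R -> R) :
  lebesgue_measure.-integrable [set: R] (EFin \o u) ->
  \int[lebesgue_measure]_(x in `]-oo, w]) u x @[w --> +oo] -->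
  \int[lebesgue_measure]_x u x.
Proof.
move=> iu; have mu : measurable_fun [set: R] u.
  by apply/measurable_EFinP; exact: measurable_int iu.
apply/cvg_pinftyP => v vy.
under eq_fun do rewrite Rintegral_mkcond.
pose u_ n := u \_ `]-oo, v n].
apply: (@Rintegral_dominated_cvg _ _ _ lebesgue_measure u_ _ (fun x => `|u x|)).
- move=> n; exact: (measurable_patch_itv _ mu).
- move=> x; apply: cvg_near_cst.
  move/cvgryPge : vy => /(_ x); apply: filterS => n xn.
  by rewrite /u_ patchE ifT// inE /= in_itv/=.
- exact: integrable_abse iu.
- by move=> n x; rewrite /u_ patchE; case: ifPn => _ //; rewrite normr0.
Qed.

Lemma cvg_Rintegral_itv_ninfty (R : realType) (u : R -> R) :
  lebesgue_measure.-integrable [set: R] (EFin \o u) ->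
  \int[lebesgue_measure]_(x in `]-oo, w]) u x @[w --> -oo] --> (0 : R).
Proof.
move=> iu; have mu : measurable_fun [set: R] u.
  by apply/measurable_EFinP; exact: measurable_int iu.
apply/cvgNy_compNP; apply/cvg_pinftyP => v vy /=.
under eq_fun do rewrite Rintegral_mkcond.
have -> : (0 : R) = \int[lebesgue_measure]_(x in [set: R]) (cst 0 x).
  by rewrite Rintegral_cst// mul0r.
pose u_ n := u \_ `]-oo, - v n].
apply: (@Rintegral_dominated_cvg _ _ _ lebesgue_measure u_ _ (fun x => `|u x|)).
- move=> n; exact: (measurable_patch_itv _ mu).
- move=> x; apply: cvg_near_cst.
  move/cvgryPgt : vy => /(_ (- x)); apply: filterS => n xn.
  rewrite /u_ patchE ifF//; apply/negbTE; rewrite notin_setE /= in_itv/=.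
  by apply/negP; rewrite -ltNge ltrNl.
- exact: integrable_abse iu.
- by move=> n x; rewrite /u_ patchE; case: ifPn => _ //; rewrite normr0.
Qed.

Lemma is_derive_Rintegral_itvNy (R : realType) (u : R -> R) :
  lebesgue_measure.-integrable [set: R] (EFin \o u) -> continuous u ->
  forall w : R,
  is_derive w 1 (fun w => \int[lebesgue_measure]_(x in `]-oo, w]) u x) (u w).
Proof.
move=> iu cu w.
have w1 : w < w + 1 by rewrite ltrDl.
have iw : lebesgue_measure.-integrable `]-oo, w + 1] (EFin \o u).
  exact: (integrableS measurableT _ _ iu).
have [|dG eG] := continuous_FTC1 w1 iw _ (cu w); first exact: ltNyr.
by split; [exact: dG|rewrite -derive1E].
Qed.

(** A way to prove tail inequalities by differentiating a comparison function instead of handling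
    integrals: a negative value at [w] would persist beyond [w] and contradict the limit. *)
Lemma antitone_cvg0_ge0 (R : realType) (K K' : R -> R) (w : R) :
  (forall x : R, is_derive x 1 K (K' x)) -> (forall x, w <= x -> K' x <= 0) ->
  K x @[x --> +oo] --> (0 : R) -> 0 <= K w.
Proof.
move=> dK K'le K0.
have mono x : w <= x -> K x <= K w.
  rewrite le_eqVlt => /predU1P[->//|wx].
  have cK : {within `[w, x], continuous K}.
    apply: continuous_subspaceT => y; apply: differentiable_continuous.
    by apply/derivable1_diffP; have [] := dK y.
  have [c cwx e] := MVT wx (fun y _ => dK y) cK.
  rewrite -subr_le0 e mulr_le0_ge0// ?K'le// ?subr_ge0 ?(ltW wx)//.
  by move: cwx; rewrite in_itv/= => /andP[/ltW].
rewrite leNgt; apply/negP => Kw0.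
have [M [_ KM]] := cvgr_gt _ K0 _ Kw0.
pose x := Num.max w (M + 1).
have : K w < K x by apply: KM; rewrite lt_max ltrDl ltr01 orbT.
by rewrite ltNge mono// le_max lexx.
Qed.

Section real_derivatives.
Variables (R : realType) (x : R).
Implicit Types (f g : R -> R) (a b c : R).

Lemma is_derive1_ext f a b : is_derive x 1 f a -> a = b -> is_derive x 1 f b.
Proof. by move=> df <-. Qed.

Lemma is_derive1D f g a b : is_derive x 1 f a -> is_derive x 1 g b ->
  is_derive x 1 (fun y => f y + g y) (a + b).
Proof. exact: is_deriveD. Qed.

Lemma is_derive1B f g a b : is_derive x 1 f a -> is_derive x 1 g b ->
  is_derive x 1 (fun y => f y - g y) (a - b).
Proof. exact: is_deriveB. Qed.

Lemma is_derive1N f a : is_derive x 1 f a -> is_derive x 1 (fun y => - f y) (- a).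
Proof. exact: is_deriveN. Qed.

Lemma is_derive1M f g a b : is_derive x 1 f a -> is_derive x 1 g b ->
  is_derive x 1 (fun y => f y * g y) (f x * b + g x * a).
Proof. exact: is_deriveM. Qed.

Lemma is_derive1Z f a c : is_derive x 1 f a ->
  is_derive x 1 (fun y => c * f y) (c * a).
Proof. exact: is_deriveZ. Qed.

Lemma is_derive1V f a : f x != 0 -> is_derive x 1 f a ->
  is_derive x 1 (fun y => (f y)^-1) (- a / f x ^+ 2).
Proof.
move=> fx0 df; apply: is_derive1_ext (is_deriveV fx0 df) _.
by rewrite /GRing.scale/= mulNr mulrC mulNr.
Qed.

End real_derivatives.

Lemma is_derive1_opp_arg (R : realType) (f : R -> R) (x a : R) :
  is_derive (- x) 1 f a -> is_derive x 1 (fun y => f (- y)) (- a).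
Proof.
move=> df; have di : is_derive x 1 (fun y : R => - y) (-1 : R).
  exact: is_derive1N (is_derive_id x 1).
by apply: is_derive1_ext (is_derive1_comp df di) _; rewrite mulrN1.
Qed.

Section cvg_to_0.
Variables (R : realType) (F : set_system R).
Context {FF : Filter F}.
Implicit Types f g : R -> R.

Lemma cvgB0 f g : f x @[x --> F] --> (0 : R) -> g x @[x --> F] --> (0 : R) ->
  f x - g x @[x --> F] --> (0 : R).
Proof. by move=> f0 g0; have h := cvgB f0 g0; rewrite subr0 in h; exact: h. Qed.

Lemma cvgD0 f g : f x @[x --> F] --> (0 : R) -> g x @[x --> F] --> (0 : R) ->
  f x + g x @[x --> F] --> (0 : R).
Proof. by move=> f0 g0; have h := cvgD f0 g0; rewrite addr0 in h; exact: h. Qed.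

Lemma cvgN0 f : f x @[x --> F] --> (0 : R) -> - f x @[x --> F] --> (0 : R).
Proof. by move=> f0; have h := cvgN f0; rewrite oppr0 in h; exact: h. Qed.

Lemma cvgZ0 c f : f x @[x --> F] --> (0 : R) -> c * f x @[x --> F] --> (0 : R).
Proof. by move=> f0; have h := @cvgMl_tmp _ _ _ _ _ c _ f0; rewrite mulr0 in h; exact: h. Qed.

End cvg_to_0.

(** * Stein's equation *)

Section gaussian_density.
Variable R : realType.
Local Notation phi := (@normal_pdf R 0 1).

Lemma normal_pdf01E (x : R) : phi x = normal_peak 1 * expR (- (x ^+ 2 / 2)).
Proof.
by rewrite normal_pdfE ?oner_neq0// /normal_fun subr0 expr1n mulNr.
Qed.

Lemma normal_pdf01_gt0 (x : R) : 0 < phi x.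
Proof. by rewrite normal_pdf01E mulr_gt0 ?expR_gt0// normal_peak_gt0 ?oner_neq0. Qed.

Lemma normal_pdf01N (x : R) : phi (- x) = phi x.
Proof. by rewrite !normal_pdf01E sqrrN. Qed.

Lemma is_derive_normal_pdf01 (x : R) : is_derive x 1 phi (- x * phi x).
Proof.
have -> : phi = fun x : R => normal_peak 1 * expR (- (x ^+ 2 / 2)).
  by apply/funext => y; exact: normal_pdf01E.
have d1 : is_derive x 1 (fun y : R => - (2^-1 * (y * y))) (- x).
  by apply: is_derive1_ext; rewrite /GRing.scale/=; lra.
have -> : (fun x : R => normal_peak 1 * expR (- (x ^+ 2 / 2))) =
          (fun x : R => normal_peak 1 * (expR \o (fun y => - (2^-1 * (y * y)))) x).
  by apply/funext => y /=; congr (_ * expR _); field.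
apply: is_derive1_ext (is_derive1Z _ (is_derive1_comp (is_derive_expR _) d1)) _.
have -> : x ^+ 2 / 2 = 2^-1 * (x * x) :> R by field.
by rewrite /=; ring.
Qed.

Lemma cvg_normal_pdf01 : phi x @[x --> +oo] --> (0 : R).
Proof.
have e1 : normal_peak 1 * expR 2^-1 * expR (- x) @[x --> +oo] --> (0 : R).
  exact: cvgZ0 (@cvgr_expR R).
apply: squeeze_cvgr e1; last exact: cvg_cst.
near=> x; rewrite normal_pdf_ge0 normal_pdf01E /= -mulrA -expRD.
rewrite ler_wpM2l ?normal_peak_ge0// ler_expR.
by have := sqr_ge0 (x - 1); rewrite !expr2; lra.
Unshelve. all: by end_near. Qed.

(** Taken as one minus the distribution function, so that its derivative comes from the fundamental
    theorem of calculus on []-oo, w]]. *)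
Definition normal_tail (w : R) : R :=
  1 - \int[lebesgue_measure]_(x in `]-oo, w]) phi x.
Local Notation Psi := normal_tail.

Lemma is_derive_normal_tail (w : R) : is_derive w 1 Psi (- phi w).
Proof.
have cphi : continuous phi by apply: continuous_normal_pdf; rewrite oner_neq0.
have dI := is_derive_Rintegral_itvNy (integrable_normal_pdf 0 1) cphi w.
have dc : is_derive w 1 (fun _ : R => 1 : R) 0 by exact: is_derive_cst.
by apply: is_derive1_ext (is_derive1B dc dI) _; rewrite sub0r.
Qed.

Lemma cvg_normal_tail : Psi x @[x --> +oo] --> (0 : R).
Proof.
have c1 := cvg_Rintegral_itv_pinfty (@integrable_normal_pdf R 0 1).
have e1 : \int[lebesgue_measure]_x phi x = 1.
  by rewrite /Rintegral integral_normal_pdf.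
rewrite e1 in c1; rewrite -(subrr (1 : R)); apply: cvgB; last exact: c1.
exact: cvg_cst.
Qed.

Lemma normal_tail_ge0 (w : R) : 0 <= Psi w.
Proof.
apply: (antitone_cvg0_ge0 is_derive_normal_tail _ cvg_normal_tail) => x _.
by rewrite oppr_le0 normal_pdf_ge0.
Qed.

(** With [w] frozen, [phi x - w * Psi x] has derivative [(w - x) * phi x], which is nonpositive
    beyond [w]. *)
Lemma Mills_upper (w : R) : w * Psi w <= phi w.
Proof.
rewrite -subr_ge0.
apply: (@antitone_cvg0_ge0 _ (fun x => phi x - w * Psi x)
          (fun x => - x * phi x - w * - phi x)) => [x|x wx|].
- apply: is_derive1B; first exact: is_derive_normal_pdf01.
  by apply: is_derive1Z; exact: is_derive_normal_tail.
- by have := normal_pdf_ge0 0 1 x; nra.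
- apply: cvgB0; first exact: cvg_normal_pdf01.
  exact: cvgZ0 cvg_normal_tail.
Qed.

(** The comparison function [Psi x - x / (1 + x * x) * phi x] vanishes at infinity and has the
    negative derivative [- (2 / (1 + x * x) ^+ 2 * phi x)]. *)
Lemma Mills_lower (w : R) : w * phi w <= (1 + w ^+ 2) * Psi w.
Proof.
have s0 (x : R) : 0 < 1 + x * x by have := sqr_ge0 x; rewrite expr2; lra.
suff : 0 <= Psi w - w / (1 + w * w) * phi w.
  rewrite subr_ge0 mulrAC ler_pdivrMr ?s0// => /le_trans; apply.
  by rewrite expr2 mulrC.
apply: (@antitone_cvg0_ge0 _ (fun x => Psi x - x / (1 + x * x) * phi x)
  (fun x => - (2 / (1 + x * x) ^+ 2 * phi x))) => [x|x _|].
- have /lt0r_neq0 s0x := s0 x.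
  have dq : is_derive x 1 (fun y : R => 1 + y * y) (x + x).
    by apply: is_derive1_ext; rewrite /GRing.scale/=; lra.
  have dr := is_derive1M (is_derive_id x 1)
    (@is_derive1V _ _ (fun y : R => 1 + y * y) _ s0x dq).
  apply: is_derive1_ext (is_derive1B (is_derive_normal_tail x)
    (is_derive1M dr (is_derive_normal_pdf01 x))) _.
  by field.
- by rewrite oppr_le0 mulr_ge0 ?normal_pdf_ge0// divr_ge0// exprn_ge0// ltW ?s0.
- apply: cvgB0; first exact: cvg_normal_tail.
  apply: squeeze_cvgr cvg_normal_pdf01; last first.
    exact: cvgN0 cvg_normal_pdf01.
  near=> x; have p0 := normal_pdf_ge0 0 1 x.
  have : `|x / (1 + x * x)| <= 1.
    rewrite normrM normfV (gtr0_norm (s0 x)) ler_pdivrMr ?s0// mul1r.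
    have := sqr_ge0 (`|x| - 1).
    by have := real_normK (num_real x); rewrite !expr2; nra.
  by rewrite ler_norml => /andP[? ?]; apply/andP; split; nra.
Unshelve. all: by end_near. Qed.

(** The Mills ratio [Psi / phi] has derivative [x * (Psi x / phi x) - 1], nonpositive by
    [Mills_upper]; so its value at 0 bounds it on the positive half-line. *)
Lemma normal_tail_ratio (w : R) : 0 <= w -> Psi w * phi 0 <= Psi 0 * phi w.
Proof.
move=> w0.
have dq (x : R) : is_derive x 1 (fun y => Psi y / phi y) (x * (Psi x / phi x) - 1).
  have /lt0r_neq0 px := normal_pdf01_gt0 x.
  apply: is_derive1_ext (is_derive1M (is_derive_normal_tail x)
    (is_derive1V px (is_derive_normal_pdf01 x))) _.
  by field.
rewrite -ler_pdivlMr ?normal_pdf01_gt0// mulrAC -ler_pdivrMr ?normal_pdf01_gt0//.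
move: w0; rewrite le_eqVlt => /predU1P[<-//|w0].
have cq : {within `[0, w], continuous (fun y => Psi y / phi y)}.
  apply: continuous_subspaceT => y; apply: differentiable_continuous.
  by apply/derivable1_diffP; have [] := dq y.
have [c _ e] := MVT w0 (fun y _ => dq y) cq.
rewrite -subr_le0 e mulr_le0_ge0// ?subr0 ?(ltW w0)// subr_le0 mulrA.
by rewrite ler_pdivrMr ?normal_pdf01_gt0// mul1r Mills_upper.
Qed.

Lemma normal_tail0_gt0 : 0 < Psi 0.
Proof.
have := Mills_lower 1; rewrite mul1r expr1n => p1.
have := normal_tail_ratio (@ler01 R).
have := normal_pdf01_gt0 1; have := normal_pdf01_gt0 0.
move=> q0 q1 h; rewrite lt0r normal_tail_ge0 andbT; apply/eqP => z.
by move: h; rewrite z mul0r => h; nra.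
Qed.

End gaussian_density.

Section stein_solution.
Variable R : realType.
Local Notation phi := (@normal_pdf R 0 1).
Local Notation Psi := (@normal_tail R).

(* [G] is the primitive of [(h - m) phi] vanishing at both ends, so that
   [G / phi] is the bounded solution of Stein's equation for [h]. *)
Definition stein_primitive (h : R -> R) (m : R) (G : R -> R) : Prop :=
  [/\ {homo h : x y / x <= y},
      forall x y, x <= y -> h y - h x <= 1 + (y - x),
      forall x : R, is_derive x 1 G ((h x - m) * phi x),
      G x @[x --> +oo] --> (0 : R)
    & G x @[x --> -oo] --> (0 : R)].

(** The class of test functions is stable under this reflection, so every estimate on the right tail
    yields one on the left tail and the final bounds need only [w >= 0]. *)
Lemma stein_primitive_mirror h m G : stein_primitive h m G ->
  stein_primitive (fun x => - h (- x)) (- m) (fun x => G (- x)).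
Proof.
case=> mh hl dG Gy GNy; split.
- by move=> x y xy; rewrite lerN2 mh// lerN2.
- move=> x y xy; have := hl (- y) (- x); rewrite lerN2 => /(_ xy); lra.
- move=> x; apply: is_derive1_ext (is_derive1_opp_arg (dG (- x))) _.
  by rewrite normal_pdf01N; ring.
- exact: (cvgNy_compNP _ _).1 GNy.
- exact: (cvgy_compNP _ _).1 Gy.
Qed.

(** As [G] vanishes at infinity, [- G w] is the integral of [(h - m) phi] over [[w, +oo)], where [h]
    is at least [h w]. *)
Lemma stein_primitive_lower h m G w : stein_primitive h m G ->
  (h w - m) * Psi w <= - G w.
Proof.
case=> mh hl dG Gy GNy; rewrite -subr_ge0.
apply: (@antitone_cvg0_ge0 _ (fun x => - G x - (h w - m) * Psi x)
  (fun x => - ((h x - m) * phi x) - (h w - m) * - phi x)) => [x|x wx|].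
- exact: is_derive1B (is_derive1N (dG x))
    (is_derive1Z (h w - m) (is_derive_normal_tail x)).
- by have := normal_pdf_ge0 0 1 x; have := mh _ _ wx; nra.
- apply: cvgB0; first exact: cvgN0.
  by apply: cvgZ0; exact: cvg_normal_tail.
Qed.

(** The same tail integral, with [h x <= h w + 1 + (x - w)] beyond [w]; the integral of [x * phi x]
    from [w] on equals [phi w]. *)
Lemma stein_primitive_upper h m G w : stein_primitive h m G ->
  - G w <= (h w - m + 1 - w) * Psi w + phi w.
Proof.
case=> mh hl dG Gy GNy; rewrite -subr_ge0 opprK.
apply: (@antitone_cvg0_ge0 _ (fun x => (h w - m + 1 - w) * Psi x + phi x + G x)
  (fun x => (h w - m + 1 - w) * - phi x + - x * phi x + (h x - m) * phi x))
  => [x|x wx|].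
- exact: is_derive1D (is_derive1D (is_derive1Z (h w - m + 1 - w) (is_derive_normal_tail x))
    (is_derive_normal_pdf01 x)) (dG x).
- by have := normal_pdf_ge0 0 1 x; have := hl _ _ wx; nra.
- apply: cvgD0 => //; apply: cvgD0; last exact: cvg_normal_pdf01.
  by apply: cvgZ0; exact: cvg_normal_tail.
Qed.

(** If [h w >= m], the integrand keeps its sign to the right of [w]; otherwise it does so to the
    left, which the mirrored bound covers. *)
Lemma stein_primitive_le0 h m G w : stein_primitive h m G -> G w <= 0.
Proof.
move=> sp; have p0 := normal_tail_ge0 w; have p1 := normal_tail_ge0 (- w).
have := stein_primitive_lower w sp.
have := stein_primitive_lower (- w) (stein_primitive_mirror sp).
rewrite opprK => l1 l2.
have [dm|dm] := lerP 0 (h w - m); [|move/ltW in dm]; nra.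
Qed.

(** At [w = 0] the lower bound for one tail and the upper bound for the other concern the same
    number [- G 0]; comparing them gives [2 * Psi 0 * |h 0 - m| <= Psi 0 + phi 0]. *)
Definition stein_cst0 : R := (Psi 0 + phi 0) / (2 * Psi 0).

Lemma stein_primitive_mean h m G : stein_primitive h m G ->
  `|h 0 - m| <= stein_cst0.
Proof.
move=> sp; have p0 := normal_tail0_gt0 R.
have l1 := stein_primitive_lower 0 sp.
have l2 := stein_primitive_lower 0 (stein_primitive_mirror sp).
have u1 := stein_primitive_upper 0 sp.
have u2 := stein_primitive_upper 0 (stein_primitive_mirror sp).
rewrite oppr0 in l2 u2.
rewrite /stein_cst0 ler_pdivlMr ?mulr_gt0//.
by case: (ger0P (h 0 - m)) => dm; lra.
Qed.

Definition stein_cst : R := (stein_cst0 + 2) * (Psi 0 / phi 0 + 1) + 1.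

Lemma stein_cst0_ge0 : 0 <= stein_cst0.
Proof.
have p0 := normal_tail0_gt0 R; have q0 := normal_pdf01_gt0 (0 : R).
by apply: divr_ge0; lra.
Qed.

(** Division by [phi w] turns all the tail estimates into polynomial inequalities between [w], [f],
    [d = h w - m] and the Mills ratio [M]. *)
Lemma stein_pos_bounds h m G w (f := G w / phi w) : stein_primitive h m G ->
  0 <= w ->
  [/\ `|f| <= stein_cst, `|w * f + h w - m| <= stein_cst,
      f + w * (w * f + h w - m) <= 0 & `|h w - m| <= stein_cst * (1 + `|w|)].
Proof.
move=> sp w0; pose M := Psi w / phi w; pose M0 := Psi 0 / phi 0.
pose c := stein_cst0; pose d := h w - m.
have p0 := normal_tail0_gt0 R; have q0 := normal_pdf01_gt0 (0 : R).
have q1 := normal_pdf01_gt0 w.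
have EG : G w = f * phi w by rewrite /f divfK// gt_eqF.
have EP : Psi w = M * phi w by rewrite /M divfK// gt_eqF.
have M_ge0 : 0 <= M by rewrite divr_ge0 ?normal_tail_ge0// ltW.
have M0_ge0 : 0 <= M0 by rewrite divr_ge0// ltW.
have MM0 : M <= M0.
  rewrite /M /M0 ler_pdivrMr// mulrAC ler_pdivlMr//.
  exact: normal_tail_ratio.
have wM : w * M <= 1.
  by have := Mills_upper w; rewrite EP mulrA -{2}(mul1r (phi w)) ler_pM2r.
have Mw : w <= (1 + w * w) * M.
  by have := Mills_lower w; rewrite EP mulrA ler_pM2r// expr2.
have lo : d * M <= - f.
  have := stein_primitive_lower w sp.
  by rewrite EP EG mulrA -mulNr ler_pM2r.
have up : - f <= (d + 1 - w) * M + 1.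
  have := stein_primitive_upper w sp.
  by rewrite EP EG mulrA -mulNr -{3}(mul1r (phi w)) -mulrDl ler_pM2r.
have f0 : f <= 0.
  by have := stein_primitive_le0 w sp; rewrite EG pmulr_lle0.
have c0 : 0 <= c := stein_cst0_ge0.
have := stein_primitive_mean sp; rewrite ler_norml -/c => /andP[dl du].
have [mh hl _ _ _] := sp.
have {}dl : - c <= d by apply: le_trans dl _; rewrite /d lerD2r mh.
have {}du : d <= c + 1 + w.
  by have := hl _ _ w0; rewrite subr0 /d; lra.
have cE : stein_cst = (c + 2) * (M0 + 1) + 1 by [].
have cM : 0 <= c * M0 by rewrite mulr_ge0.
have cM' : 0 <= c * M by rewrite mulr_ge0.
(* [d] may grow like [w], and [w * f + d] is bounded through [d * (1 - w * M)]. By [Mw],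
   [(1 - w * M) * (1 + w * w) <= 1], a decay that absorbs this growth. *)
have q : (1 + w) * (1 - w * M) <= 2.
  have : (1 + w) * ((1 - w * M) * (1 + w * w)) <= (1 + w) * 1.
    rewrite ler_wpM2l// ?addr_ge0//; nra.
  have : 0 <= 1 - w * M by rewrite subr_ge0.
  have ? : 0 <= w * w by rewrite mulr_ge0.
  nra.
have fle : - f <= stein_cst by rewrite cE; nra.
have h1 : `|w * f + h w - m| <= c + 2 + c * M0.
  rewrite -addrA -/d ler_norml; apply/andP; split.
    have : w * - f <= w * ((d + 1 - w) * M + 1) by rewrite ler_wpM2l.
    nra.
  have : w * (d * M) <= w * - f by rewrite ler_wpM2l.
  have : 0 <= 1 - w * M by rewrite subr_ge0.
  nra.
split.
- by rewrite ler0_norm.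
- by apply: le_trans h1 _; rewrite cE; nra.
(* The quantity is [(1 + w * w) * f + w * d], the derivative of [w * f w]. For [d >= 0] combine
   [f <= - d * M] with the lower Mills bound; for [d <= 0] both terms are nonpositive. *)
- have w2 : 0 <= 1 + w * w by nra.
  have [d0|d0] := lerP 0 d; last by move/ltW : d0; rewrite /d; nra.
  suff : w * d <= - f * (1 + w * w) by rewrite /d; lra.
  have h2 : d * w <= d * ((1 + w * w) * M) by rewrite ler_wpM2l.
  have := ler_wpM2r w2 lo; lra.
- rewrite (ger0_norm w0) -/d ler_norml cE; apply/andP; split; nra.
Qed.

Lemma stein_bounds h m G w (f := G w / phi w) : stein_primitive h m G ->
  [/\ `|f| <= stein_cst, `|w * f + h w - m| <= stein_cst,
      f + w * (w * f + h w - m) <= 0 & `|h w - m| <= stein_cst * (1 + `|w|)].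
Proof.
move=> sp; have [w0|w0] := lerP 0 w; first exact: stein_pos_bounds.
have [|] := stein_pos_bounds (stein_primitive_mirror sp) (w := - w).
  by rewrite oppr_ge0 ltW.
rewrite opprK normal_pdf01N -/f normrN => b1 b2 b3 b4; split => //.
- apply: le_trans b2; rewrite -normrN le_eqVlt; apply/orP; left.
  by apply/eqP; congr `|_|; ring.
- by move: b3; congr (_ <= _); ring.
- apply: le_trans b4; rewrite -normrN le_eqVlt; apply/orP; left.
  by apply/eqP; congr `|_|; ring.
Qed.

End stein_solution.

Lemma stein_class_growth (R : realType) (h : R -> R) : {homo h : x y / x <= y} ->
  (forall x y, x <= y -> h y - h x <= 1 + (y - x)) ->
  forall x, `|h x| <= (`|h 0| + 1) * (1 + `|x|).
Proof.
move=> mh hl x.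
have a0 := normr_ge0 (h 0); have a1 := ler_norm (h 0).
have a2 : - `|h 0| <= h 0 by rewrite lerNl -normrN ler_norm.
case: (ger0P x) => x0; rewrite ler_norml; apply/andP; split.
- by have := mh _ _ x0; nra.
- by have := hl _ _ x0; nra.
- by have := hl _ _ (ltW x0); nra.
- by have := mh _ _ (ltW x0); nra.
Qed.

Lemma stein_cst_gt0 (R : realType) : 0 < stein_cst R.
Proof.
have := stein_cst0_ge0 R; have p0 := normal_tail0_gt0 R.
have q0 := normal_pdf01_gt0 (0 : R).
have : 0 <= normal_tail 0 / normal_pdf 0 1 0 :> R by rewrite divr_ge0// ltW.
by rewrite /stein_cst; nra.
Qed.

Section stein_equation.
Variable R : realType.
Local Notation phi := (@normal_pdf R 0 1).
Local Notation leb := (@lebesgue_measure R).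

(** Gives integrability against [phi] under linear growth without computing a moment:
    [1 + |x| <= 3 * expR (3 / 8 * x ^+ 2)], and this exponential is the quotient of those in the
    densities of deviation 2 and 1. *)
Lemma norm_normal_pdf01_le (x : R) :
  (1 + `|x|) * phi x <= 3 * normal_peak 1 / normal_peak 2 * normal_pdf 0 2 x.
Proof.
have n2 : (2 : R) != 0 by [].
have p1 := normal_peak_gt0 (oner_neq0 R).
have /lt0r_neq0 p2 := normal_peak_gt0 n2.
rewrite normal_pdf01E normal_pdfE// /normal_fun subr0.
have -> : - x ^+ 2 / (2 ^+ 2 *+ 2) = - (x ^+ 2 / 2) + (3 / 8) * x ^+ 2 :> R.
  by field.
rewrite expRD [leRHS](_ : _ = normal_peak 1 * (3 * expR (3 / 8 * x ^+ 2)) *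
    expR (- (x ^+ 2 / 2))); last by field.
rewrite [leLHS]mulrA ler_wpM2r ?expR_ge0// mulrC ler_wpM2l ?(ltW p1)//.
have := expR_ge1Dx (3 / 8 * x ^+ 2).
by have := sqr_ge0 (`|x| - 1); have := real_normK (num_real x); nra.
Qed.

Lemma integrable_normal_growth (h : R -> R) (c : R) : continuous h ->
  (forall x, `|h x| <= c * (1 + `|x|)) ->
  leb.-integrable [set: R] (fun x => (h x * phi x)%:E).
Proof.
move=> ch hc; have cphi : continuous phi.
  by apply: continuous_normal_pdf; rewrite oner_neq0.
have c0 : 0 <= c by have := hc 0; rewrite normr0 addr0 mulr1; apply: le_trans.
apply: (@le_integrable _ _ _ leb _ measurableT _
    (fun x => (c * (3 * normal_peak 1 / normal_peak 2) * normal_pdf 0 2 x)%:E)).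
- apply/measurable_EFinP; apply: continuous_measurable_fun => x.
  by apply: cvgM; [exact: ch|exact: cphi].
- move=> x _ /=; rewrite lee_fin normrM (ger0_norm (normal_pdf_ge0 _ _ _)).
  rewrite [leRHS]ger0_norm; last first.
    have p2 : 0 <= normal_peak (2 : R) by exact: normal_peak_ge0.
    have p1 : 0 <= normal_peak (1 : R) by exact: normal_peak_ge0.
    by rewrite mulr_ge0 ?normal_pdf_ge0// mulr_ge0// divr_ge0// mulr_ge0.
  apply: (@le_trans _ _ (c * ((1 + `|x|) * phi x))).
    by rewrite mulrA ler_wpM2r ?normal_pdf_ge0.
  by rewrite -mulrA ler_wpM2l// norm_normal_pdf01_le.
- under eq_fun do rewrite EFinM.
  by apply: integrableZl => //; exact: integrable_normal_pdf.
Qed.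

Definition normal_mean (h : R -> R) : R := \int[leb]_x (h x * phi x).

Lemma stein_primitive_exists (h : R -> R) : continuous h ->
  {homo h : x y / x <= y} ->
  (forall x y, x <= y -> h y - h x <= 1 + (y - x)) ->
  exists G, stein_primitive h (normal_mean h) G.
Proof.
move=> ch mh hl; pose m := normal_mean h.
have ih := integrable_normal_growth ch (stein_class_growth mh hl).
have ip : leb.-integrable [set: R] (fun x => (m * phi x)%:E).
  under eq_fun do rewrite EFinM.
  by apply: integrableZl => //; exact: integrable_normal_pdf.
pose u x := (h x - m) * phi x.
have uE : (EFin \o u) = ((fun x => (h x * phi x)%:E) \- (fun x => (m * phi x)%:E))%E.
  by apply/funext => x /=; rewrite -EFinB -mulrBl.
have iu : leb.-integrable [set: R] (EFin \o u).
  by rewrite uE; exact: integrableB.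
have cu : continuous u.
  move=> x; apply: cvgM; first by apply: cvgB; [exact: ch|exact: cvg_cst].
  by apply: continuous_normal_pdf; rewrite oner_neq0.
have u0 : \int[leb]_x u x = 0.
  rewrite /u; under eq_Rintegral do rewrite mulrBl.
  rewrite RintegralB// RintegralZl//; last exact: integrable_normal_pdf.
  by rewrite [X in _ - _ * X]/Rintegral integral_normal_pdf mulr1 subrr.
exists (fun w => \int[leb]_(x in `]-oo, w]) u x); split => //.
- exact: is_derive_Rintegral_itvNy.
- by have := cvg_Rintegral_itv_pinfty iu; rewrite u0.
- exact: cvg_Rintegral_itv_ninfty.
Qed.

Lemma stein_solution (h : R -> R) (m := normal_mean h) : continuous h ->
  {homo h : x y / x <= y} ->
  (forall x y, x <= y -> h y - h x <= 1 + (y - x)) ->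
  exists f : R -> R, let H w := h w - m - w * f w in
  [/\ forall w, `|f w| <= stein_cst R,
      forall w, `|w * f w + h w - m| <= stein_cst R,
      forall w D, 0 <= D -> `|f (w + D) - f w - D * (w * f w + h w - m)|
        <= D * (H (w + D) - H w)
    & forall w, `|H w| <= 2 * stein_cst R * (1 + `|w|)].
Proof.
move=> ch mh hl; have [G sp] := stein_primitive_exists ch mh hl.
rewrite -/m in sp; have [_ _ dG _ _] := sp.
pose f w := G w / phi w; exists f => H.
have df (w : R) : is_derive w 1 f (w * f w + h w - m).
  have /lt0r_neq0 pw := normal_pdf01_gt0 w.
  apply: is_derive1_ext (is_derive1M (dG w)
    (is_derive1V pw (is_derive_normal_pdf01 w))) _.
  by rewrite /f; field.
have dwf (w : R) : is_derive w 1 (fun x => x * f x) (w * (w * f w + h w - m) + f w).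
  apply: is_derive1_ext (is_derive1M (is_derive_id w 1) (df w)) _.
  by rewrite mulr1.
have cont (g g' : R -> R) : (forall x : R, is_derive x 1 g (g' x)) -> continuous g.
  move=> dg x; apply: differentiable_continuous.
  by apply/derivable1_diffP; have [] := dg x.
have anti x y : x <= y -> y * f y <= x * f x.
  rewrite le_eqVlt => /predU1P[->//|xy].
  have [c _ e] := MVT xy (fun y _ => dwf y)
    (continuous_subspaceT (cont _ _ dwf)).
  rewrite -subr_le0 e mulr_le0_ge0 ?subr_ge0 ?(ltW xy)//.
  by have [_ _] := stein_bounds c sp; rewrite addrC.
split.
- by move=> w; have [] := stein_bounds w sp.
- by move=> w; have [] := stein_bounds w sp.
- move=> w D; rewrite le_eqVlt => /predU1P[<-|D0].
    by rewrite addr0 subrr !mul0r subrr normr0.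
  have wD : w < w + D by rewrite ltrDl.
  (* [f'] is the sum of the nonincreasing [w * f w] and the nondecreasing [h - m], while [H] is the
     second minus the first; so on [[w, w + D]] the variation of [f'] is at most that of [H]. *)
  have [c + e] := MVT wD (fun y _ => df y) (continuous_subspaceT (cont _ _ df)).
  rewrite in_itv/= => /andP[/ltW wc /ltW cD].
  have := mh _ _ wc; have := mh _ _ cD; have := anti _ _ wc; have := anti _ _ cD.
  rewrite e (_ : w + D - w = D); last by ring.
  move=> a1 a2 a3 a4; rewrite /H ler_norml; apply/andP; split; nra.
- move=> w; have [b1 _ _ b4] := stein_bounds w sp.
  apply: le_trans (ler_normB _ _) _; rewrite normrM.
  have := normr_ge0 w; have := normr_ge0 (f w).
  by rewrite -/(f w) in b1; nra.
Qed.

End stein_equation.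

(** * Multiaffine functions *)

Section coordinates.
Variables (R : realType) (J : finType).
Implicit Types (z : J -> R) (i j : J) (x y : R) (g : (J -> R) -> R).

Definition upd z j x : J -> R := fun i => if i == j then x else z i.

Lemma upd_id z j : upd z j (z j) = z.
Proof. by apply/funext => i; rewrite /upd; case: eqP => // ->. Qed.

Lemma upd_eq z j x : upd z j x j = x.
Proof. by rewrite /upd eqxx. Qed.

Lemma upd_neq z i j x : i != j -> upd z j x i = z i.
Proof. by rewrite /upd => /negbTE->. Qed.

Lemma upd_upd z j x y : upd (upd z j x) j y = upd z j y.
Proof. by apply/funext => i; rewrite /upd; case: eqP. Qed.

Lemma updC z i j x y : i != j -> upd (upd z i x) j y = upd (upd z j y) i x.
Proof.
move=> ij; apply/funext => l; rewrite /upd; case: eqP => // ->.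
by rewrite eq_sym (negbTE ij).
Qed.

(** Evaluated at 0 and 1, so that it does not depend on [z j]; for a multiaffine function it is the
    slope in the variable [j], hence the add-one cost at every point. *)
Definition difference j g : (J -> R) -> R := fun z => g (upd z j 1) - g (upd z j 0).

Definition multiaffine g : Prop :=
  forall z j x, g (upd z j x) = g (upd z j 0) + x * difference j g z.

Lemma difference_upd j g z x : difference j g (upd z j x) = difference j g z.
Proof. by rewrite /difference !upd_upd. Qed.

Lemma difference_difference j g z : difference j (difference j g) z = 0.
Proof. by rewrite {1}/difference !difference_upd subrr. Qed.

Lemma differenceC i j g z :
  difference i (difference j g) z = difference j (difference i g) z.
Proof.
have [->//|ij] := eqVneq i j.
by rewrite /difference !(updC _ _ _ ij); ring.
Qed.

Lemma difference_updC i j g z x : i != j ->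
  difference i (fun z => g (upd z j x)) z = difference i g (upd z j x).
Proof. by move=> ij; rewrite /difference !(updC _ _ _ ij). Qed.

Lemma multiaffineE g z j x : multiaffine g ->
  g z = g (upd z j x) + (z j - x) * difference j g z.
Proof.
move=> mg; rewrite -{1}(upd_id z j) (mg _ _ (z j)) (mg _ _ x); ring.
Qed.

Lemma multiaffine_difference i g : multiaffine g -> multiaffine (difference i g).
Proof.
move=> mg z j x; have [<-|ij] := eqVneq i j.
  by rewrite difference_difference mulr0 addr0 !difference_upd.
rewrite /difference !(updC _ _ _ (_ : j != i)) 1?eq_sym//.
rewrite (mg _ j x) (mg (upd z i 0) j x) /difference.
by rewrite !(updC _ _ _ ij); ring.
Qed.

Lemma multiaffine_upd i y g : multiaffine g -> multiaffine (fun z => g (upd z i y)).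
Proof.
move=> mg z j x; have [<-|ij] := eqVneq i j.
  by rewrite /difference !upd_upd subrr mulr0 addr0.
have ji : j != i by rewrite eq_sym.
by rewrite difference_updC// !(updC _ _ _ ji) mg.
Qed.

Lemma multiaffineD g g' : multiaffine g -> multiaffine g' ->
  multiaffine (fun z => g z + g' z).
Proof. by move=> mg mg' z j x; rewrite mg mg' /difference; ring. Qed.

Lemma multiaffineZ c g : multiaffine g -> multiaffine (fun z => c * g z).
Proof. by move=> mg z j x; rewrite mg /difference; ring. Qed.

Lemma multiaffine_cst c : multiaffine (fun=> c).
Proof. by move=> z j x; rewrite /difference; ring. Qed.

Lemma multiaffine_coord i : multiaffine (fun z => z i).
Proof.
move=> z j x; rewrite /difference /upd; case: eqP => _; ring.
Qed.

Lemma multiaffine_sum (I : finType) (P : pred I) (G : I -> (J -> R) -> R) :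
  (forall i : I, P i -> multiaffine (G i)) ->
  multiaffine (fun z => \sum_(i : I | P i) G i z).
Proof.
move=> mG z j x; rewrite /difference -sumrB mulr_sumr -big_split/=.
by apply: eq_bigr => i Pi; rewrite mG.
Qed.

Lemma difference_sum (I : finType) (P : pred I) (G : I -> (J -> R) -> R) j z :
  difference j (fun z => \sum_(i : I | P i) G i z) z = \sum_(i : I | P i) difference j (G i) z.
Proof. by rewrite /difference -sumrB. Qed.

Definition shift z j : J -> R := upd z j (z j + 1).

Lemma shift_eq z j : shift z j j = z j + 1.
Proof. exact: upd_eq. Qed.

Lemma shift_neq z i j : i != j -> shift z j i = z i.
Proof. exact: upd_neq. Qed.

Lemma upd_shift z j x : upd (shift z j) j x = upd z j x.
Proof. exact: upd_upd. Qed.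

Lemma difference_shift j g z : difference j g (shift z j) = difference j g z.
Proof. exact: difference_upd. Qed.

Lemma multiaffine_shift g z j : multiaffine g ->
  g (shift z j) = g z + difference j g z.
Proof.
by move=> mg; rewrite (multiaffineE z j (z j + 1) mg) /shift; ring.
Qed.

(** A class closed under the algebraic operations and shifts used below, on which all expectations
    exist; membership, settled by the tactic [pg], stands for integrability. Measurability is
    automatic, as the variables take countably many values. *)
Definition poly_growth g : Prop :=
  exists C (q : nat), forall z, `|g z| <= C * (1 + \sum_j `|z j|) ^+ q.

Lemma poly_growthW C (q : nat) g : (forall z, `|g z| <= C * (1 + \sum_j `|z j|) ^+ q) ->
  exists C' q', 0 <= C' /\ forall q'', (q' <= q'')%N ->
    forall z, `|g z| <= C' * (1 + \sum_j `|z j|) ^+ q''.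
Proof.
move=> gC; exists `|C|, q; split => // q'' qq'' z; apply: le_trans (gC z) _.
have s0 : 0 <= \sum_j `|z j| by apply: sumr_ge0.
apply: (@le_trans _ _ (`|C| * (1 + \sum_j `|z j|) ^+ q)).
  by rewrite ler_wpM2r ?ler_norm// exprn_ge0// addr_ge0.
by rewrite ler_wpM2l// ler_weXn2l// lerDl.
Qed.

Lemma poly_growth_le g g' : (forall z, `|g z| <= `|g' z|) ->
  poly_growth g' -> poly_growth g.
Proof.
by move=> gg' [C [q gC]]; exists C, q => z; exact: le_trans (gg' z) (gC z).
Qed.

Lemma poly_growthD g g' : poly_growth g -> poly_growth g' ->
  poly_growth (fun z => g z + g' z).
Proof.
move=> [C [q gC]] [C' [q' gC']].
have [D [s [D0 gD]]] := poly_growthW gC; have [D' [s' [D'0 gD']]] := poly_growthW gC'.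
exists (D + D'), (maxn s s') => z; apply: le_trans (ler_normD _ _) _.
by rewrite mulrDl lerD ?gD ?gD' ?leq_maxl ?leq_maxr.
Qed.

Lemma poly_growthM g g' : poly_growth g -> poly_growth g' ->
  poly_growth (fun z => g z * g' z).
Proof.
move=> [C [q gC]] [C' [q' gC']]; exists (C * C'), (q + q')%N => z.
by rewrite normrM exprD mulrACA ler_pM.
Qed.

Lemma poly_growth_cst c : poly_growth (fun=> c).
Proof. by exists `|c|, 0%N => z; rewrite expr0 mulr1. Qed.

Lemma poly_growth_coord j : poly_growth (fun z => z j).
Proof.
exists 1, 1%N => z; rewrite mul1r expr1 (bigD1 j)//=.
rewrite addrA [1 + _]addrC -addrA lerDl addr_ge0// sumr_ge0//.
Qed.

Lemma poly_growthN g : poly_growth g -> poly_growth (fun z => - g z).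
Proof. by apply: poly_growth_le => z; rewrite normrN. Qed.

Lemma poly_growthB g g' : poly_growth g -> poly_growth g' ->
  poly_growth (fun z => g z - g' z).
Proof. by move=> pg pg'; apply: poly_growthD => //; exact: poly_growthN. Qed.

Lemma poly_growth_norm g : poly_growth g -> poly_growth (fun z => `|g z|).
Proof. by apply: poly_growth_le => z; rewrite normr_id. Qed.

Lemma poly_growth_sum (I : finType) (P : pred I) (G : I -> (J -> R) -> R) :
  (forall i : I, P i -> poly_growth (G i)) -> poly_growth (fun z => \sum_(i : I | P i) G i z).
Proof.
move=> pG; have -> : (fun z => \sum_(i : I | P i) G i z) =
    (fun z => \sum_(i <- enum P) G i z).
  by apply/funext => z; rewrite big_enum_cond/= ; apply: eq_bigl => i; rewrite andbT.
have {}pG (i : I) : i \in enum P -> poly_growth (G i).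
  by rewrite mem_enum => /pG.
elim: (enum P) pG => [_|i s IH pG].
  by under eq_fun do rewrite big_nil; exact: poly_growth_cst.
under eq_fun do rewrite big_cons.
apply: poly_growthD; first by apply: pG; rewrite mem_head.
by apply: IH => l ls; apply: pG; rewrite in_cons ls orbT.
Qed.

Lemma poly_growth_prod (I : finType) (P : pred I) (G : I -> (J -> R) -> R) :
  (forall i : I, P i -> poly_growth (G i)) -> poly_growth (fun z => \prod_(i : I | P i) G i z).
Proof.
move=> pG; have -> : (fun z => \prod_(i : I | P i) G i z) =
    (fun z => \prod_(i <- enum P) G i z).
  by apply/funext => z; rewrite big_enum_cond/= ; apply: eq_bigl => i; rewrite andbT.
have {}pG (i : I) : i \in enum P -> poly_growth (G i).
  by rewrite mem_enum => /pG.
elim: (enum P) pG => [_|i s IH pG].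
  by under eq_fun do rewrite big_nil; exact: poly_growth_cst.
under eq_fun do rewrite big_cons.
apply: poly_growthM; first by apply: pG; rewrite mem_head.
by apply: IH => l ls; apply: pG; rewrite in_cons ls orbT.
Qed.

Lemma poly_growthX g n : poly_growth g -> poly_growth (fun z => g z ^+ n).
Proof.
move=> pg; elim: n => [|n IH].
  by under eq_fun do rewrite expr0; exact: poly_growth_cst.
by under eq_fun do rewrite exprS; exact: poly_growthM.
Qed.

Lemma poly_growth_comp (f : R -> R) g c : (forall x, `|f x| <= c * (1 + `|x|)) ->
  poly_growth g -> poly_growth (fun z => f (g z)).
Proof.
move=> fc pg; apply: (@poly_growth_le _ (fun z => c * (1 + `|g z|))).
  by move=> z; apply: le_trans (fc _) _; exact: ler_norm.
apply: poly_growthM; first exact: poly_growth_cst.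
apply: poly_growthD; first exact: poly_growth_cst.
exact: poly_growth_norm.
Qed.

Lemma poly_growth_updf g j (w : (J -> R) -> R) (c : R) :
  (forall z, `|w z| <= c + \sum_j `|z j|) ->
  poly_growth g -> poly_growth (fun z => g (upd z j (w z))).
Proof.
move=> wc [C [q gC]]; have [D [s [D0 gD]]] := poly_growthW gC.
exists (D * (2 + `|c|) ^+ s), s => z; apply: le_trans (gD _ (leqnn s) _) _.
rewrite -mulrA -exprMn ler_wpM2l//.
have s0 : 0 <= \sum_j `|z j| by apply: sumr_ge0.
rewrite lerXn2r ?nnegrE ?mulr_ge0 ?addr_ge0 ?sumr_ge0//.
have : \sum_i `|upd z j (w z) i| <= `|w z| + \sum_j `|z j|.
  rewrite [leLHS](bigD1 j)//= upd_eq lerD2l.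
  rewrite [leRHS](bigD1 j)//= (eq_bigr (fun i => `|z i|)) ?lerDr//.
  by move=> i ij; rewrite upd_neq.
have := wc z; have := ler_norm c; have := normr_ge0 c; nra.
Qed.

Lemma poly_growth_upd g j x : poly_growth g -> poly_growth (fun z => g (upd z j x)).
Proof.
apply: (@poly_growth_updf _ _ (fun=> x) `|x|) => z.
by rewrite lerDl sumr_ge0.
Qed.

Lemma poly_growth_shift g j : poly_growth g -> poly_growth (fun z => g (shift z j)).
Proof.
apply: (@poly_growth_updf _ _ (fun z => z j + 1) 1) => z.
rewrite addrC (le_trans (ler_normD _ _))// normr1 lerD2l.
by rewrite (bigD1 j)//= lerDl sumr_ge0.
Qed.

Lemma poly_growth_difference g j : poly_growth g -> poly_growth (difference j g).
Proof. by move=> pg; apply: poly_growthB; exact: poly_growth_upd. Qed.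

End coordinates.

Ltac pg := repeat first
  [ assumption | apply: poly_growth_cst | apply: poly_growth_coord
  | apply: poly_growth_difference | apply: poly_growth_upd
  | apply: poly_growth_shift | apply: poly_growthX
  | apply: poly_growthB | apply: poly_growthD | apply: poly_growthN
  | apply: poly_growthM | apply: poly_growth_norm
  | (apply: poly_growth_sum => ? _) ].

(** * Poisson expectations *)

Section poisson_expectation.
Variables (R : realType) (J : finType) (p : J -> R).
Variable Ex : ((J -> R) -> R) -> R.
Implicit Types (z : J -> R) (i j : J) (g phi psi : (J -> R) -> R).

(* [Ex] is the expectation over independent Poisson variables of means [p];
   the last clause is the (discrete) Mecke formula. *)
Definition poisson_expectation : Prop :=
  [/\ forall phi psi, poly_growth phi -> poly_growth psi ->
        Ex (fun z => phi z + psi z) = Ex phi + Ex psi,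
      forall c phi, poly_growth phi -> Ex (fun z => c * phi z) = c * Ex phi,
      forall phi psi, poly_growth phi -> poly_growth psi ->
        (forall n : J -> nat,
           phi (fun j => (n j)%:R) <= psi (fun j => (n j)%:R)) -> Ex phi <= Ex psi,
      Ex (fun=> 1) = 1
    & forall j phi, poly_growth phi ->
        Ex (fun z => z j * phi z) = p j * Ex (fun z => phi (shift z j))].

Hypothesis hEx : poisson_expectation.
Hypothesis p_ge0 : forall j, 0 <= p j.

Lemma ExD phi psi : poly_growth phi -> poly_growth psi ->
  Ex (fun z => phi z + psi z) = Ex phi + Ex psi.
Proof. by have [+ _ _ _ _] := hEx; apply. Qed.

Lemma ExZ c phi : poly_growth phi -> Ex (fun z => c * phi z) = c * Ex phi.
Proof. by have [_ + _ _ _] := hEx; apply. Qed.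

Lemma Ex_le phi psi : poly_growth phi -> poly_growth psi ->
  (forall n : J -> nat, phi (fun j => (n j)%:R) <= psi (fun j => (n j)%:R)) ->
  Ex phi <= Ex psi.
Proof. by have [_ _ + _ _] := hEx; apply. Qed.

Lemma Ex_cst c : Ex (fun=> c) = c.
Proof.
have [_ _ _ e1 _] := hEx.
by have := ExZ c (poly_growth_cst J 1); rewrite e1 mulr1.
Qed.

Lemma Ex_ext phi psi : (forall z, phi z = psi z) -> Ex phi = Ex psi.
Proof. by move=> e; congr Ex; apply/funext. Qed.

Lemma ExB phi psi : poly_growth phi -> poly_growth psi ->
  Ex (fun z => phi z - psi z) = Ex phi - Ex psi.
Proof.
move=> pphi ppsi; rewrite -[- Ex psi]mulN1r -ExZ// -ExD//; last by pg.
by apply: Ex_ext => z; rewrite mulN1r.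
Qed.

Lemma Ex_sum (I : finType) (P : pred I) (G : I -> (J -> R) -> R) :
  (forall i : I, P i -> poly_growth (G i)) ->
  Ex (fun z => \sum_(i : I | P i) G i z) = \sum_(i : I | P i) Ex (G i).
Proof.
move=> pG.
have -> : Ex (fun z => \sum_(i : I | P i) G i z) =
          Ex (fun z => \sum_(i <- enum P) G i z).
  by apply: Ex_ext => z; rewrite big_enum_cond/=; apply: eq_bigl => i; rewrite andbT.
have -> : \sum_(i : I | P i) Ex (G i) = \sum_(i <- enum P) Ex (G i).
  by rewrite big_enum_cond/=; apply: eq_bigl => i; rewrite andbT.
have {}pG (i : I) : i \in enum P -> poly_growth (G i) by rewrite mem_enum => /pG.
have : poly_growth (fun z => \sum_(i <- enum P) G i z) /\
   Ex (fun z => \sum_(i <- enum P) G i z) = \sum_(i <- enum P) Ex (G i); last by case.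
elim: (enum P) pG => [_|i s IH pG].
  under eq_fun do rewrite big_nil; split; first exact: poly_growth_cst.
  by rewrite big_nil Ex_cst.
under eq_fun do rewrite big_cons.
have pi := pG i (mem_head _ _).
have [|ps es] := IH; first by move=> l ls; apply: pG; rewrite in_cons ls orbT.
split; first by pg.
by rewrite big_cons ExD// es.
Qed.

Lemma Ex_ge0 phi : poly_growth phi ->
  (forall n : J -> nat, 0 <= phi (fun j => (n j)%:R)) -> 0 <= Ex phi.
Proof. by move=> pphi phi0; rewrite -(Ex_cst 0) Ex_le//; pg. Qed.

Lemma Ex_mecke j phi : poly_growth phi ->
  Ex (fun z => z j * phi z) = p j * Ex (fun z => phi (shift z j)).
Proof. by have [_ _ _ _ +] := hEx; apply. Qed.

Lemma Ex_mecke_centered j phi : poly_growth phi ->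
  Ex (fun z => (z j - p j) * phi z) = p j * Ex (fun z => phi (shift z j) - phi z).
Proof.
move=> pphi; rewrite ExB//; last by pg.
rewrite mulrBr -Ex_mecke// -ExZ// -ExB; [|by pg|by pg].
by apply: Ex_ext => z; ring.
Qed.

Lemma Ex_mecke_indep j phi psi : poly_growth phi -> poly_growth psi ->
  (forall z, psi (shift z j) = psi z) ->
  Ex (fun z => (z j - p j) * (psi z * phi z)) =
  p j * Ex (fun z => psi z * (phi (shift z j) - phi z)).
Proof.
move=> pphi ppsi e; rewrite Ex_mecke_centered; last by pg.
by congr (_ * _); apply: Ex_ext => z; rewrite e; ring.
Qed.

Lemma Ex_sqr_centered j psi : poly_growth psi ->
  (forall z, psi (shift z j) = psi z) ->
  Ex (fun z => ((z j - p j) * psi z) ^+ 2) = p j * Ex (fun z => psi z ^+ 2).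
Proof.
move=> ppsi e.
transitivity (Ex (fun z => (z j - p j) * (psi z * ((z j - p j) * psi z)))).
  by apply: Ex_ext => z; ring.
rewrite Ex_mecke_indep//; last by pg.
by congr (_ * _); apply: Ex_ext => z; rewrite e shift_eq; ring.
Qed.

(** In [g z = g (upd z j (p j)) + (z j - p j) * difference j g z] the two terms are orthogonal,
    since neither [g (upd z j (p j))] nor [difference j g z] depends on [z j]; the variance of a
    Poisson variable is its mean [p j]. *)
Lemma Ex_sqr_split j g : poly_growth g -> multiaffine g ->
  Ex (fun z => g z ^+ 2) = Ex (fun z => g (upd z j (p j)) ^+ 2) +
    p j * Ex (fun z => difference j g z ^+ 2).
Proof.
move=> pg mg.
transitivity (Ex (fun z => g (upd z j (p j)) ^+ 2 +
   ((z j - p j) * (difference j g z * (2 * g (upd z j (p j)))) +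
   ((z j - p j) * difference j g z) ^+ 2))).
  by apply: Ex_ext => z; rewrite {1}(multiaffineE z j (p j) mg); ring.
have pd := poly_growth_difference j pg.
have pu := poly_growth_upd j (p j) pg.
rewrite ExD; [|by pg|by pg]; rewrite ExD; [|by pg|by pg]; congr (_ + _).
rewrite Ex_sqr_centered//; last by move=> z; rewrite difference_shift.
rewrite Ex_mecke_indep//; [|by pg|by move=> z; rewrite difference_shift].
rewrite (_ : Ex _ = 0) ?mulr0 ?add0r//.
by rewrite -(Ex_cst 0); apply: Ex_ext => z; rewrite upd_shift; ring.
Qed.

Lemma Ex_sqr_upd_le j g : poly_growth g -> multiaffine g ->
  Ex (fun z => g (upd z j (p j)) ^+ 2) <= Ex (fun z => g z ^+ 2).
Proof.
move=> pg mg; rewrite (Ex_sqr_split j pg mg) lerDl mulr_ge0// Ex_ge0//.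
  by have pd := poly_growth_difference j pg; pg.
by move=> n; exact: sqr_ge0.
Qed.

Lemma Ex_upd j g : poly_growth g -> multiaffine g ->
  Ex (fun z => g (upd z j (p j))) = Ex g.
Proof.
move=> pg mg; have pd := poly_growth_difference j pg.
have pu := poly_growth_upd j (p j) pg.
transitivity (Ex (fun z => g (upd z j (p j)) + (z j - p j) * difference j g z)).
  rewrite ExD; [|by pg|by pg]; rewrite Ex_mecke_centered//.
  rewrite (_ : Ex (fun z => _ - _) = 0) ?mulr0 ?addr0//.
  rewrite -(Ex_cst 0); apply: Ex_ext => z; rewrite difference_shift; ring.
by apply: Ex_ext => z; rewrite -multiaffineE.
Qed.

Definition upds (s : seq J) z : J -> R := foldr (fun j z' => upd z' j (p j)) z s.

Lemma upds_enum z : upds (enum J) z = p.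
Proof.
have H s i : i \in s -> upds s z i = p i.
  elim: s => //= j s IH; rewrite in_cons; have [->|ij] := eqVneq i j.
    by rewrite upd_eq.
  by move=> /= /IH; rewrite upd_neq.
by apply/funext => i; rewrite H// mem_enum.
Qed.

(** Replacing one coordinate by its mean preserves the expectation of a multiaffine function; after
    all replacements only the constant [g p] is left. *)
Lemma Ex_multiaffine g : poly_growth g -> multiaffine g -> Ex g = g p.
Proof.
move=> pg mg; rewrite -(Ex_cst (g p)).
transitivity (Ex (fun z => g (upds (enum J) z))); last first.
  by apply: Ex_ext => z; rewrite upds_enum.
elim: (enum J) g pg mg => //= j s IH g pg mg.
rewrite -(Ex_upd j pg mg) (IH (fun z => g (upd z j (p j))))//.
  exact: poly_growth_upd.
exact: multiaffine_upd.
Qed.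

(* Efron-Stein: conditioning on one more coordinate at a time. *)
Lemma poincare g : poly_growth g -> multiaffine g ->
  Ex (fun z => (g z - g p) ^+ 2) <= \sum_j p j * Ex (fun z => difference j g z ^+ 2).
Proof.
have H s : uniq s -> forall g, poly_growth g -> multiaffine g ->
    Ex (fun z => g z ^+ 2) <= Ex (fun z => g (upds s z) ^+ 2) +
      \sum_(j <- s) p j * Ex (fun z => difference j g z ^+ 2).
  elim: s => [_ g0 pg0 mg0|j s IH /= /andP[js us] g0 pg0 mg0].
    by rewrite big_nil addr0.
  rewrite (Ex_sqr_split j pg0 mg0) big_cons [X in _ <= _ + X]addrC addrA lerD2r.
  have pu := poly_growth_upd j (p j) pg0.
  have mu := multiaffine_upd j (p j) mg0.
  apply: le_trans (IH us _ pu mu) _; rewrite lerD2l.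
  rewrite [leLHS]big_seq [leRHS]big_seq; apply: ler_sum => i is_.
  have ij : i != j by apply: contraNneq js => <-.
  rewrite ler_wpM2l//.
  (* Averaging out the coordinate [j] does not increase the second moment of [difference i g], so
     the bound for the reduced function is at most the one for [g0]. *)
  have := Ex_sqr_upd_le j (poly_growth_difference i pg0) (multiaffine_difference i mg0).
  apply: le_trans; rewrite le_eqVlt; apply/orP; left; apply/eqP.
  by apply: Ex_ext => z; rewrite difference_updC.
move=> pg mg.
have pg' : poly_growth (fun z => g z - g p) by pg.
have mg' : multiaffine (fun z => g z - g p).
  by apply: multiaffineD => //; exact: multiaffine_cst.
apply: le_trans (H _ (enum_uniq J) _ pg' mg') _.
rewrite (_ : Ex _ = 0) ?add0r; last first.
  by rewrite -(Ex_cst 0); apply: Ex_ext => z; rewrite upds_enum subrr expr2 mulr0.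
rewrite big_enum/= le_eqVlt; apply/orP; left; apply/eqP.
by apply: eq_bigr => j _; congr (_ * _); apply: Ex_ext => z; rewrite /difference; ring.
Qed.

(** Integrates [|x| <= x ^+ 2 / (2 * B) + B / 2]: the target [B] serves as the weight in Young's
    inequality, so no square root of a moment appears. *)
Lemma Ex_norm_le phi B : poly_growth phi -> 0 < B ->
  Ex (fun z => phi z ^+ 2) <= B ^+ 2 -> Ex (fun z => `|phi z|) <= B.
Proof.
move=> pphi B0 h.
have c0 : 0 < (2 * B)^-1 by rewrite invr_gt0 mulr_gt0.
have : Ex (fun z => `|phi z|) <= Ex (fun z => (2 * B)^-1 * phi z ^+ 2 + B / 2).
  apply: Ex_le; [by pg|by pg|move=> n].
  rewrite -(ler_pM2l (_ : 0 < 2 * B)) ?mulr_gt0// mulrDr mulVKf ?gt_eqF ?mulr_gt0//.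
  have -> : 2 * B * (B / 2) = B * B by field.
  have := real_normK (num_real (phi (fun j => (n j)%:R))).
  by have := sqr_ge0 (`|phi (fun j => (n j)%:R)| - B); rewrite !expr2; nra.
move=> /le_trans; apply; rewrite ExD; [|by pg|by pg]; rewrite ExZ ?Ex_cst; last by pg.
have BE : B = (2 * B)^-1 * B ^+ 2 + B / 2 :> R by field; rewrite gt_eqF.
by rewrite [leRHS]BE lerD ?ler_pM2l.
Qed.

Lemma Ex_bounded_mul phi psi c B : poly_growth phi -> poly_growth psi -> 0 < B ->
  (forall z, `|phi z| <= c) -> Ex (fun z => psi z ^+ 2) <= B ^+ 2 ->
  `|Ex (fun z => phi z * psi z)| <= c * B.
Proof.
move=> pphi ppsi B0 phic h.
have c0 : 0 <= c by apply: le_trans (phic (fun=> 0)).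
(* [s] stands for a sign: monotonicity of [Ex] bounds the expectation and its opposite, hence its
   absolute value. *)
have key (s : R) : `|s| = 1 -> s * Ex (fun z => phi z * psi z) <= c * B.
  move=> s1; rewrite -ExZ; last by pg.
  apply: (@le_trans _ _ (c * Ex (fun z => `|psi z|))); last first.
    by rewrite ler_wpM2l// Ex_norm_le.
  rewrite -ExZ; last by pg.
  apply: Ex_le; [by pg|by pg|move=> n].
  by rewrite (le_trans (ler_norm _))// !normrM s1 mul1r ler_wpM2r.
rewrite ler_norml lerNl -mulN1r key ?normrN1//=.
by rewrite -[leLHS]mul1r key ?normr1.
Qed.

Lemma Ex_cauchy_schwarz phi psi A B : poly_growth phi -> poly_growth psi ->
  0 < A -> 0 < B -> Ex (fun z => phi z ^+ 2) <= A ^+ 2 ->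
  Ex (fun z => psi z ^+ 2) <= B ^+ 2 -> Ex (fun z => phi z * psi z) <= A * B.
Proof.
move=> pphi ppsi A0 B0 hA hB.
have : Ex (fun z => phi z * psi z) <=
    Ex (fun z => B / (2 * A) * phi z ^+ 2 + A / (2 * B) * psi z ^+ 2).
  apply: Ex_le; [by pg|by pg|move=> n].
  set x := phi _; set y := psi _.
  have : 0 <= (B * x - A * y) ^+ 2 / (2 * A * B).
    by rewrite divr_ge0 ?sqr_ge0// !mulr_ge0// ltW.
  rewrite (_ : _ / _ = B / (2 * A) * x ^+ 2 + A / (2 * B) * y ^+ 2 - x * y) ?subr_ge0//.
  by field; rewrite !gt_eqF.
move=> /le_trans; apply; rewrite ExD; [|by pg|by pg]; rewrite !ExZ; [|by pg|by pg].
have -> : A * B = B / (2 * A) * A ^+ 2 + A / (2 * B) * B ^+ 2.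
  by field; rewrite !gt_eqF.
by rewrite lerD// ler_wpM2l// divr_ge0 ?mulr_ge0// ltW.
Qed.

End poisson_expectation.

(** * Stein's method for monotone multiaffine functions of Poisson variables *)

Section poisson_stein.
Variables (R : realType) (J : finType) (p : J -> R).
Variable Ex : ((J -> R) -> R) -> R.
Hypothesis hEx : poisson_expectation p Ex.
Hypothesis p_ge0 : forall j, 0 <= p j.
Variable g : (J -> R) -> R.
Hypothesis pg_g : poly_growth g.
Hypothesis ma_g : multiaffine g.
Hypothesis D_ge0 : forall j (n : J -> nat), 0 <= difference j g (fun i => (n i)%:R).

Implicit Types (z : J -> R) (i j : J).

Let mu := g p.
Let D j := difference j g.
Let DD i j := difference i (difference j g).
Let a j := D j p.
(* The first two chaos components of [g]: [g = mu + L + Rem]. *)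
Let L z := \sum_j a j * (z j - p j).
Let Rem z := g z - mu - L z.
Let V := Ex (fun z => (g z - mu) ^+ 2).

Let pgD j : poly_growth (D j). Proof. exact: poly_growth_difference. Qed.
Let pgDD i j : poly_growth (DD i j). Proof. exact: poly_growth_difference (pgD j). Qed.
Let pgL : poly_growth L. Proof. rewrite /L; pg. Qed.
Let pgRem : poly_growth Rem. Proof. rewrite /Rem; pg. Qed.
Let maD j : multiaffine (D j). Proof. exact: multiaffine_difference. Qed.

Let aE j : Ex (D j) = a j. Proof. exact: (Ex_multiaffine hEx (pgD j) (maD j)). Qed.

Let a_ge0 j : 0 <= a j.
Proof. by rewrite -aE (Ex_ge0 hEx)//; exact: D_ge0. Qed.

Let maL : multiaffine L.
Proof.
apply: multiaffine_sum => j _; apply: multiaffineZ; apply: multiaffineD.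
  exact: multiaffine_coord.
exact: multiaffine_cst.
Qed.

Let maRem : multiaffine Rem.
Proof.
apply: multiaffineD.
  by apply: multiaffineD => //; exact: multiaffine_cst.
have -> : (fun z => - L z) = (fun z => -1 * L z).
  by apply/funext => z; rewrite mulN1r.
exact: multiaffineZ.
Qed.

Let DL j z : difference j L z = a j.
Proof.
rewrite /L difference_sum (bigD1 j)//= big1 => [|i ij].
  by rewrite /difference !upd_eq; ring.
by rewrite /difference !upd_neq//; ring.
Qed.

Let DRem j z : difference j Rem z = D j z - a j.
Proof. by rewrite -(DL j z) /Rem /D /difference; ring. Qed.

Let Rem_p : Rem p = 0.
Proof. by rewrite /Rem /L big1 => [|j _]; rewrite /mu !subrr ?mulr0 ?subr0. Qed.

Let Ex_L_mul phi : poly_growth phi ->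
  Ex (fun z => L z * phi z) =
  \sum_j a j * p j * Ex (fun z => phi (shift z j) - phi z).
Proof.
move=> pphi.
transitivity (Ex (fun z => \sum_j a j * ((z j - p j) * phi z))).
  by apply: Ex_ext => z; rewrite mulr_suml; apply: eq_bigr => j _; ring.
rewrite (Ex_sum hEx) => [|j _]; last by pg.
apply: eq_bigr => j _; rewrite (ExZ hEx) ?(Ex_mecke_centered hEx) ?mulrA//; pg.
Qed.

(** [L] and [Rem] are orthogonal: integration by parts reduces [Ex (L * Rem)] to the means of
    [difference j Rem = D j - a j], which vanish. *)
Lemma variance_split :
  V = \sum_j p j * a j ^+ 2 + Ex (fun z => Rem z ^+ 2).
Proof.
have e1 : Ex (fun z => L z * (g z - mu)) = \sum_j p j * a j ^+ 2.
  rewrite Ex_L_mul; last by pg.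
  apply: eq_bigr => j _; rewrite (_ : Ex _ = a j); first by ring.
  by rewrite -aE; apply: Ex_ext => z; rewrite multiaffine_shift// /D; ring.
have e2 : Ex (fun z => L z * Rem z) = 0.
  rewrite Ex_L_mul//; apply: big1 => j _.
  rewrite (_ : Ex _ = 0) ?mulr0//.
  transitivity (Ex (fun z => D j z - a j)).
    by apply: Ex_ext => z; rewrite multiaffine_shift// DRem; ring.
  by rewrite (ExB hEx) ?(Ex_cst hEx) ?aE ?subrr//; pg.
rewrite -e1 -[X in _ + X]add0r -e2 -!(ExD hEx); [|by pg..].
by apply: Ex_ext => z; rewrite /Rem; ring.
Qed.

Variables (b1 b2 : R).
Hypothesis hb1 : forall j, Ex (fun z => difference j g z ^+ 2) <= b1.
Hypothesis hb2 : forall i j, Ex (fun z => difference i (difference j g) z ^+ 2) <= b2.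
Let Lam := \sum_j p j.

Let Lam_ge0 : 0 <= Lam. Proof. exact: sumr_ge0. Qed.

Let sum_p_le (G : J -> R) b : (forall j, G j <= b) -> \sum_j p j * G j <= Lam * b.
Proof. by move=> Gb; rewrite mulr_suml; apply: ler_sum => j _; rewrite ler_wpM2l. Qed.

Let a_sqr_le j : a j ^+ 2 <= b1.
Proof.
apply: le_trans (hb1 j); rewrite -aE -subr_ge0.
have : 0 <= Ex (fun z => (D j z - a j) ^+ 2).
  by apply: (Ex_ge0 hEx) => [|n]; [pg|exact: sqr_ge0].
rewrite (_ : Ex _ = Ex (fun z => D j z ^+ 2 + ((- 2 * a j) * D j z + a j ^+ 2))); last first.
  by apply: Ex_ext => z; ring.
rewrite (ExD hEx); [|by pg|by pg]; rewrite (ExD hEx); [|by pg|by pg].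
rewrite (ExZ hEx)// aE (Ex_cst hEx).
by congr (_ <= _); ring.
Qed.

Let a_mul_le i j : a i * a j <= b1.
Proof.
have := a_sqr_le i; have := a_sqr_le j; have := sqr_ge0 (a i - a j).
by rewrite !expr2; nra.
Qed.

(** [difference j Rem] is [D j - a j], itself centred, so the Poincare inequality applies twice and
    leaves second differences; each application costs a factor [Lam]. *)
Let Ex_Rem_sqr : Ex (fun z => Rem z ^+ 2) <= Lam ^+ 2 * b2.
Proof.
have := poincare hEx p_ge0 pgRem maRem.
rewrite Rem_p (_ : Ex (fun z => (Rem z - 0) ^+ 2) = Ex (fun z => Rem z ^+ 2)); last first.
  by apply: Ex_ext => z; rewrite subr0.
move=> /le_trans; apply; rewrite expr2 -mulrA; apply: sum_p_le => j.
rewrite (_ : Ex _ = Ex (fun z => (D j z - D j p) ^+ 2)); last first.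
  by apply: Ex_ext => z; rewrite DRem.
apply: le_trans (poincare hEx p_ge0 (pgD j) (maD j)) _.
by apply: sum_p_le => i; exact: hb2.
Qed.

Let Ex_cross phi psi b : poly_growth phi -> poly_growth psi ->
  Ex (fun z => phi z ^+ 2) <= b -> Ex (fun z => psi z ^+ 2) <= b ->
  Ex (fun z => phi z * psi z) <= b.
Proof.
move=> pphi ppsi h1 h2.
have : Ex (fun z => phi z * psi z) <= Ex (fun z => 2^-1 * phi z ^+ 2 + 2^-1 * psi z ^+ 2).
  apply: (Ex_le hEx); [by pg|by pg|move=> n].
  by have := sqr_ge0 (phi (fun j => (n j)%:R) - psi (fun j => (n j)%:R)); rewrite !expr2; lra.
rewrite (ExD hEx); [|by pg|by pg]; rewrite !(ExZ hEx); [|by pg|by pg]; lra.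
Qed.

(** Fluctuation of [\sum_j a j * p j * D j], the quantity that Stein's method compares with the
    variance; its mean is [V] minus the second moment of [Rem]. *)
Let Y z := \sum_j a j * p j * (D j z - a j).

Let pgY : poly_growth Y. Proof. rewrite /Y; pg. Qed.

(** One factor [Lam] comes from the Poincare inequality, the two others from expanding the square of
    [\sum_j a j * p j * DD i j]. *)
Let Ex_Y_sqr : Ex (fun z => Y z ^+ 2) <= Lam ^+ 3 * b1 * b2.
Proof.
have maY : multiaffine Y.
  apply: multiaffine_sum => j _; apply: multiaffineZ; apply: multiaffineD => //.
  exact: multiaffine_cst.
have Yp : Y p = 0 by rewrite /Y big1// => j _; rewrite subrr mulr0.
have := poincare hEx p_ge0 pgY maY.
rewrite Yp (_ : Ex (fun z => (Y z - 0) ^+ 2) = Ex (fun z => Y z ^+ 2)); last first.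
  by apply: Ex_ext => z; rewrite subr0.
move=> /le_trans; apply.
rewrite (_ : Lam ^+ 3 * b1 * b2 = Lam * (Lam * (Lam * (b1 * b2)))); last by ring.
apply: sum_p_le => i.
rewrite (_ : Ex _ = Ex (fun z => \sum_j \sum_l a j * p j * (a l * p l) *
    (DD i j z * DD i l z))); last first.
  apply: Ex_ext => z; rewrite /Y difference_sum expr2 mulr_suml.
  apply: eq_bigr => j _; rewrite mulr_sumr; apply: eq_bigr => l _.
  by rewrite /DD /D /difference; ring.
rewrite (Ex_sum hEx) => [|j _]; last by pg.
rewrite mulr_suml; apply: ler_sum => j _.
rewrite (Ex_sum hEx) => [|l _]; last by pg.
rewrite mulr_suml mulr_sumr; apply: ler_sum => l _.
rewrite (ExZ hEx); last by pg.
have h := Ex_cross (pgDD i j) (pgDD i l) (hb2 i j) (hb2 i l).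
have b20 : 0 <= b2.
  by apply: le_trans (hb2 i j); apply: (Ex_ge0 hEx) => [|n]; [pg|exact: sqr_ge0].
apply: (@le_trans _ _ (a j * p j * (a l * p l) * b2)).
  by rewrite ler_wpM2l// !mulr_ge0.
rewrite (_ : a j * p j * (a l * p l) * b2 = (a j * a l) * (p j * (p l * b2))); last by ring.
rewrite (_ : p j * (p l * (b1 * b2)) = b1 * (p j * (p l * b2))); last by ring.
by rewrite ler_wpM2r// !mulr_ge0.
Qed.

(** The divergence of the field [a j * D j]: read backwards, the Mecke formula turns sums of
    [a j * p j * Ex (D j * increment)], for the increments of a function of [z], into the
    expectation of that function times [W]. *)
Let W z := \sum_j a j * (D j z * (z j - p j)).

Let pgW : poly_growth W. Proof. rewrite /W; pg. Qed.

(** Off the diagonal, the Mecke formula in [i] and then in [j] leaves [p i * p j] times the second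
    moment of [DD i j], as in the isometry for Skorohod integrals; on the diagonal only the variance
    [p i] enters. *)
Let Ex_W_term i j : Ex (fun z => (D i z * (z i - p i)) * (D j z * (z j - p j))) <=
  (if i == j then p i * b1 else 0) + p i * (p j * b2).
Proof.
have b20 : 0 <= b2.
  by apply: le_trans (hb2 i j); apply: (Ex_ge0 hEx) => [|n]; [pg|exact: sqr_ge0].
have [<-|ij] := eqVneq i j.
  rewrite (_ : Ex _ = Ex (fun z => ((z i - p i) * D i z) ^+ 2)); last first.
    by apply: Ex_ext => z; ring.
  rewrite (Ex_sqr_centered hEx) => [||z]; [|by pg|by rewrite /D difference_shift].
  by rewrite ler_wpDr ?mulr_ge0// ler_wpM2l//; exact: hb1.
rewrite add0r.
rewrite (_ : Ex _ = Ex (fun z => (z i - p i) * (D i z * (D j z * (z j - p j))))); last first.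
  by apply: Ex_ext => z; ring.
rewrite (Ex_mecke_indep hEx); [|by pg|by pg|by move=> z; rewrite /D difference_shift].
rewrite ler_wpM2l//.
have ji : j != i by rewrite eq_sym.
rewrite (_ : Ex _ = Ex (fun z => (z j - p j) * (DD i j z * D i z))); last first.
  apply: Ex_ext => z; rewrite shift_neq// [D j (shift z i)](multiaffine_shift _ _ (maD j)).
  by rewrite /DD /D; ring.
rewrite (Ex_mecke_indep hEx); [|by pg|by pg|]; last first.
  by move=> z; rewrite /DD !(differenceC i j) difference_shift.
rewrite ler_wpM2l// (_ : Ex _ = Ex (fun z => DD i j z ^+ 2)); first exact: hb2.
apply: Ex_ext => z; rewrite [D i (shift z j)](multiaffine_shift _ _ (maD i)).
by rewrite /D -differenceC -/(D j) /DD /D; ring.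
Qed.

Let Ex_W_sqr : Ex (fun z => W z ^+ 2) <= Lam * b1 ^+ 2 + Lam ^+ 2 * b1 * b2.
Proof.
rewrite (_ : Ex _ = Ex (fun z => \sum_i \sum_j a i * a j *
    ((D i z * (z i - p i)) * (D j z * (z j - p j))))); last first.
  apply: Ex_ext => z; rewrite expr2 mulr_suml.
  apply: eq_bigr => i _; rewrite mulr_sumr; apply: eq_bigr => j _; ring.
rewrite (Ex_sum hEx) => [|i _]; last by pg.
rewrite (_ : Lam * b1 ^+ 2 + Lam ^+ 2 * b1 * b2 =
   \sum_i (b1 * (p i * b1) + \sum_j b1 * (p i * (p j * b2)))); last first.
  rewrite big_split/=; congr (_ + _).
    by rewrite mulr_suml; apply: eq_bigr => i _; ring.
  rewrite expr2 -!mulrA mulr_suml; apply: eq_bigr => i _.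
  by rewrite mulr_suml mulr_sumr; apply: eq_bigr => j _; ring.
apply: ler_sum => i _; rewrite (Ex_sum hEx) => [|j _]; last by pg.
have -> : b1 * (p i * b1) = \sum_j b1 * (if i == j then p i * b1 else 0).
  by rewrite (bigD1 i)//= eqxx big1 ?addr0// => j; rewrite eq_sym => /negbTE->; rewrite mulr0.
rewrite -big_split/=; apply: ler_sum => j _; rewrite (ExZ hEx); last by pg.
have b10 : 0 <= b1 by apply: le_trans (a_sqr_le i); exact: sqr_ge0.
have b20 : 0 <= b2.
  by apply: le_trans (hb2 i j); apply: (Ex_ge0 hEx) => [|n]; [pg|exact: sqr_ge0].
apply: (@le_trans _ _ (a i * a j * ((if i == j then p i * b1 else 0) + p i * (p j * b2)))).
  by rewrite ler_wpM2l// mulr_ge0.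
rewrite -mulrDr ler_wpM2r// addr_ge0 ?mulr_ge0//.
by case: ifP => // _; rewrite mulr_ge0.
Qed.

Hypothesis V_gt0 : 0 < V.
Let S := Num.sqrt V.
Let F z := (g z - mu) / S.

Let S_gt0 : 0 < S. Proof. by rewrite sqrtr_gt0. Qed.
Let S2 : S * S = V. Proof. by rewrite -expr2 sqr_sqrtr// ltW. Qed.
Let pgF : poly_growth F. Proof. rewrite /F; pg. Qed.

Variables (h f : R -> R) (m c : R).
Let H w := h w - m - w * f w.
Hypothesis c_gt0 : 0 < c.
Hypothesis hf : forall w, `|f w| <= c.
Hypothesis hf1 : forall w, `|w * f w + h w - m| <= c.
Hypothesis hD : forall w E, 0 <= E ->
  `|f (w + E) - f w - E * (w * f w + h w - m)| <= E * (H (w + E) - H w).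
Hypothesis hH : forall w, `|H w| <= 2 * c * (1 + `|w|).

Let le_growth (x : R) : c <= c * (1 + `|x|).
Proof. by rewrite ler_peMr ?(ltW c_gt0)// lerDl. Qed.

Let pgf : poly_growth (fun z => f (F z)).
Proof. by apply: (@poly_growth_comp _ _ _ _ c) => // x; exact: le_trans (hf x) _. Qed.

Let f1 w := w * f w + h w - m.

Let pgf1 : poly_growth (fun z => f1 (F z)).
Proof. by apply: (@poly_growth_comp _ _ _ _ c) => // x; exact: le_trans (hf1 x) _. Qed.

Let pgH : poly_growth (fun z => H (F z)).
Proof. exact: poly_growth_comp hH pgF. Qed.

Let F_shift z j : F (shift z j) = F z + D j z / S.
Proof. by rewrite /F multiaffine_shift// -/(D j z); ring. Qed.

Let err j z := f (F (shift z j)) - f (F z) - D j z / S * f1 (F z).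

Let pgerr j : poly_growth (err j).
Proof.
have pf := poly_growth_shift j pgf; have pF := pgD j.
rewrite /err; pg.
Qed.

(** Stein's equation gives [h - m = f1 - F * f] at [F], and [S * F = L + Rem]. Integrating the [L]
    part by parts produces increments of [f], split into a linear part and [err]; [variance_split]
    then leaves [Ex (Rem ^+ 2) - Y] as the coefficient of [f1]. *)
Let Ex_h_decomp : Ex (fun z => h (F z)) - m =
  V^-1 * Ex (fun z => f1 (F z) * (Ex (fun z => Rem z ^+ 2) - Y z))
  - S^-1 * \sum_j a j * p j * Ex (err j)
  - S^-1 * Ex (fun z => f (F z) * Rem z).
Proof.
have VE := variance_split.
have S0 : S != 0 by rewrite gt_eqF.
have V0 : V != 0 by rewrite gt_eqF.
have e1 : Ex (fun z => h (F z)) - m = Ex (fun z => f1 (F z)) -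
    S^-1 * (Ex (fun z => L z * f (F z)) + Ex (fun z => f (F z) * Rem z)).
  rewrite -(ExD hEx); [|by pg..]; rewrite -(ExZ hEx); last by pg.
  rewrite -(ExB hEx); [|by pg..].
  rewrite -[in LHS](Ex_cst hEx m) -(ExB hEx); last 2 first.
  - rewrite (_ : (fun z => h (F z)) = (fun z => f1 (F z) - F z * f (F z) + m)).
      by pg.
    by apply/funext => z; rewrite /f1; ring.
  - by pg.
  apply: Ex_ext => z; rewrite /f1.
  have -> : L z = S * F z - Rem z by rewrite /Rem /F; field.
  by field.
have e2 : Ex (fun z => L z * f (F z)) =
   S^-1 * Ex (fun z => f1 (F z) * (\sum_j a j * p j * D j z)) +
   \sum_j a j * p j * Ex (err j).
  rewrite Ex_L_mul//.
  rewrite (_ : Ex (fun z => f1 (F z) * _) =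
     \sum_j a j * p j * Ex (fun z => f1 (F z) * D j z)); last first.
    rewrite (_ : Ex _ = Ex (fun z => \sum_j a j * p j * (f1 (F z) * D j z))); last first.
      by apply: Ex_ext => z; rewrite mulr_sumr; apply: eq_bigr => j _; ring.
    rewrite (Ex_sum hEx) => [|j _]; last by have ? := pgD j; pg.
    by apply: eq_bigr => j _; rewrite (ExZ hEx)//; have ? := pgD j; pg.
  rewrite mulr_sumr -big_split/=; apply: eq_bigr => j _.
  rewrite mulrCA -mulrDr; congr (_ * _); have pj := pgD j; have pe := pgerr j.
  rewrite -(ExZ hEx); last by pg.
  rewrite -(ExD hEx); [|by pg..].
  by apply: Ex_ext => z; rewrite /err; field.
have e3 : Ex (fun z => f1 (F z) * (Ex (fun z => Rem z ^+ 2) - Y z)) =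
   V * Ex (fun z => f1 (F z)) - Ex (fun z => f1 (F z) * (\sum_j a j * p j * D j z)).
  rewrite -(ExZ hEx); last by pg.
  have ? j := pgD j.
  rewrite -(ExB hEx); [|by pg..].
  apply: Ex_ext => z; rewrite VE /Y.
  rewrite (_ : \sum_j a j * p j * (D j z - a j) =
     \sum_j a j * p j * D j z - \sum_j p j * a j ^+ 2); first by ring.
  by rewrite -sumrB; apply: eq_bigr => j _; ring.
by rewrite e1 e2 e3 -S2; field.
Qed.

Let Ex_err : `|\sum_j a j * p j * Ex (err j)| <= S^-1 * Ex (fun z => H (F z) * W z).
Proof.
have pgHs j := poly_growth_shift j pgH.
have -> : Ex (fun z => H (F z) * W z) =
   \sum_j a j * p j * Ex (fun z => D j z * (H (F (shift z j)) - H (F z))).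
  rewrite (_ : Ex _ = Ex (fun z => \sum_j a j * ((z j - p j) * (D j z * H (F z))))); last first.
    by apply: Ex_ext => z; rewrite mulr_sumr; apply: eq_bigr => j _; ring.
  have pD j := pgD j.
  rewrite (Ex_sum hEx) => [|j _]; last by pg.
  apply: eq_bigr => j _; rewrite (ExZ hEx); last by pg.
  rewrite (Ex_mecke_indep hEx) ?mulrA//.
  by move=> z; rewrite /D difference_shift.
rewrite mulr_sumr; apply: le_trans (ler_norm_sum _ _ _) _; apply: ler_sum => j _.
have pj := pgD j; have pe := pgerr j; have pHj := pgHs j.
rewrite normrM (ger0_norm (mulr_ge0 (a_ge0 j) (p_ge0 j))) mulrCA.
rewrite ler_wpM2l ?mulr_ge0// -(ExZ hEx); last by pg.
have key (s : R) : `|s| = 1 -> s * Ex (err j) <=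
    Ex (fun z => S^-1 * (D j z * (H (F (shift z j)) - H (F z)))).
  move=> s1; rewrite -(ExZ hEx)//; apply: (Ex_le hEx); [by pg|by pg|move=> n].
  apply: le_trans (ler_norm _) _; rewrite normrM s1 mul1r /err F_shift.
  by rewrite mulrA [S^-1 * _]mulrC hD// divr_ge0 ?D_ge0// ltW.
rewrite ler_norml lerNl -mulN1r key ?normrN1//=.
by rewrite -[leLHS]mul1r key ?normr1.
Qed.

Lemma multiaffine_stein_bound (B1 B2 B3 : R) : 0 < B1 -> 0 < B2 -> 0 < B3 ->
  Lam ^+ 2 * b2 <= B1 ^+ 2 -> Lam ^+ 3 * b1 * b2 <= B2 ^+ 2 ->
  Lam * b1 ^+ 2 + Lam ^+ 2 * b1 * b2 <= B3 ^+ 2 ->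
  `|Ex (fun z => h (F z)) - m| <=
  c * (B1 / S + (B1 ^+ 2 + B2) / V + 4 * B3 / V).
Proof.
move=> B10 B20 B30 hB1 hB2 hB3.
have VI : 0 <= V^-1 by rewrite invr_ge0 ltW.
have SI : 0 <= S^-1 by rewrite invr_ge0 ltW.
have r0 : 0 <= Ex (fun z => Rem z ^+ 2).
  by apply: (Ex_ge0 hEx) => [|n]; [pg|exact: sqr_ge0].
have t3 : `|Ex (fun z => f (F z) * Rem z)| <= c * B1.
  by apply: (Ex_bounded_mul hEx) => //; exact: le_trans Ex_Rem_sqr hB1.
have t1 : `|Ex (fun z => f1 (F z) * (Ex (fun z => Rem z ^+ 2) - Y z))| <=
    c * (B1 ^+ 2 + B2).
  rewrite (_ : Ex _ = Ex (fun z => Rem z ^+ 2) * Ex (fun z => f1 (F z)) -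
     Ex (fun z => f1 (F z) * Y z)); last first.
    rewrite -(ExZ hEx)// -(ExB hEx); [|by pg..].
    by apply: Ex_ext => z; ring.
  apply: le_trans (ler_normB _ _) _; rewrite mulrDr lerD//.
    rewrite normrM ger0_norm// mulrC ler_pM// ?(le_trans Ex_Rem_sqr hB1)//.
    have := @Ex_bounded_mul _ _ _ _ hEx (fun z => f1 (F z)) (fun=> 1) c 1 pgf1
      (poly_growth_cst J 1) ltr01 (fun z => hf1 (F z)).
    rewrite (Ex_cst hEx) !expr1n mulr1 => /(_ (lexx _)).
    by rewrite (_ : Ex _ = Ex (fun z => f1 (F z)))//; apply: Ex_ext => z; rewrite mulr1.
  apply: (Ex_bounded_mul hEx) => //; first by move=> z; exact: hf1.
  exact: le_trans Ex_Y_sqr hB2.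
have t2 : Ex (fun z => H (F z) * W z) <= 4 * c * B3.
  have F2 : Ex (fun z => F z ^+ 2) = 1.
    rewrite (_ : Ex _ = Ex (fun z => V^-1 * (g z - mu) ^+ 2)).
      by rewrite (ExZ hEx) -/V ?mulVf ?gt_eqF//; pg.
    by apply: Ex_ext => z; rewrite /F expr_div_n -S2; field; rewrite gt_eqF.
  apply: (Ex_cauchy_schwarz hEx) => //; first by rewrite mulr_gt0.
    (* By [hH], [H ^+ 2] is at most [8 * c ^+ 2 * (1 + F ^+ 2)]. Since [F] has second moment 1, its
       mean is at most [(4 * c) ^+ 2], whence the factor 4 in the bound. *)
    have : Ex (fun z => H (F z) ^+ 2) <= Ex (fun z => 8 * c ^+ 2 + 8 * c ^+ 2 * F z ^+ 2).
      apply: (Ex_le hEx); [by pg|by pg|move=> n].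
      set x := F _; have := hH x; have := real_normK (num_real (H x)).
      have := real_normK (num_real x) => <- <- hx.
      have x0 := normr_ge0 x.
      have : `|H x| ^+ 2 <= (2 * c * (1 + `|x|)) ^+ 2.
        by rewrite lerXn2r// nnegrE (le_trans _ hx).
      have := sqr_ge0 (c * (`|x| - 1)); rewrite !expr2; nra.
    rewrite (ExD hEx); [|by pg..]; rewrite (Ex_cst hEx) (ExZ hEx) ?F2; last by pg.
    by rewrite !expr2; lra.
  exact: le_trans Ex_W_sqr hB3.
rewrite Ex_h_decomp.
apply: le_trans (ler_normB _ _) _; apply: le_trans (lerD (ler_normB _ _) (lexx _)) _.
rewrite !normrM (ger0_norm VI) (ger0_norm SI).
have t2' : S^-1 * `|\sum_j a j * p j * Ex (err j)| <= V^-1 * (4 * c * B3).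
  have -> : V^-1 = S^-1 * S^-1 by rewrite -S2 invfM.
  rewrite -[leRHS]mulrA ler_wpM2l//; apply: le_trans Ex_err _.
  by rewrite ler_wpM2l.
have := ler_wpM2l VI t1; have := ler_wpM2l SI t3; move: t2'.
set u1 := S^-1 * `|_|; set u2 := S^-1 * `|_|; set u3 := V^-1 * `|_|.
lra.
Qed.

End poisson_stein.

(** * Vectors of independent Poisson variables *)

Section countable_valued.
Context (d : measure_display) (T : measurableType d) (R : realType).
Variables (mu : {measure set T -> \bar R}) (I : countType) (Y : T -> I).
Hypothesis mY : forall i, measurable (Y @^-1` [set i]).

Lemma measurable_countable_preimage (B : set I) : measurable (Y @^-1` B).
Proof.
rewrite (_ : Y @^-1` B =
    \bigcup_(k : nat) [set w | choice.pickle (Y w) = k /\ B (Y w)]).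
  apply: bigcupT_measurable => k.
  have [[i0 [i0k Bi0]]|noi] := pselect (exists i0, choice.pickle i0 = k /\ B i0).
    rewrite (_ : [set w | _] = Y @^-1` [set i0]); first exact: mY.
    apply/seteqP; split => w /=; last by move=> ->.
    by rewrite -i0k => -[/(pcan_inj choice.pickleK)].
  rewrite (_ : [set w | _] = set0)//.
  by apply/seteqP; split => w //= -[e Bw]; apply: noi; exists (Y w).
apply/seteqP; split => w /=; first by move=> Bw; exists (choice.pickle (Y w)).
by move=> [k _ []].
Qed.

Lemma measurable_fun_countable (d' : measure_display) (U : measurableType d')
  (H : I -> U) : measurable_fun [set: T] (fun w => H (Y w)).
Proof.
by move=> _ B _; rewrite setTI; exact: (measurable_countable_preimage (H @^-1` B)).
Qed.

Lemma integral_countable (H : I -> \bar R) : (forall i, 0 <= H i)%E ->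
  (\int[mu]_w H (Y w) = \esum_(i in [set: I]) (H i * mu (Y @^-1` [set i])))%E.
Proof.
move=> H0; pose F (k : nat) := [set w | choice.pickle (Y w) = k].
have mF k : measurable (F k).
  exact: (measurable_countable_preimage [set i | choice.pickle i = k]).
have FT : \bigcup_k F k = [set: T].
  by apply/seteqP; split => w //= _; exists (choice.pickle (Y w)).
have tF : trivIset [set: nat] F.
  apply/trivIsetP => i j _ _ ij; apply/seteqP; split => w //= -[e1 e2].
  by move: ij; rewrite -e1 -e2 eqxx.
(* [choice.unpickle k] may return an element whose code is not [k]; the test on [choice.pickle i]
   discards it, so that each value is counted once. *)
pose G k := (if choice.unpickle k is Some i then if choice.pickle i == k
  then H i * mu (Y @^-1` [set i]) else 0 else 0)%E.
have G0 k : (0 <= G k)%E.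
  rewrite /G; case: choice.unpickle => [i|//]; case: ifP => // _.
  by rewrite mule_ge0.
transitivity (\sum_(0 <= k <oo) G k)%E.
  rewrite -FT ge0_integral_bigcup//; last first.
    by apply: measurable_funTS; exact: measurable_fun_countable.
  apply: eq_eseriesr => k _; rewrite /G.
  case E : (choice.unpickle k) => [i|]; last first.
    rewrite (_ : F k = set0) ?integral_set0//.
    by apply/seteqP; split => w //= e; rewrite -e choice.pickleK in E.
  case: eqP => [ik|ik]; last first.
    rewrite (_ : F k = set0) ?integral_set0//.
    apply/seteqP; split => w //= e; rewrite -e choice.pickleK in E.
    by case: E ik => <- /(_ e).
  have FkE : F k = Y @^-1` [set i].
    apply/seteqP; split => w /=; last by move=> e; rewrite /F/= e.
    by rewrite /F/= -ik => /(pcan_inj choice.pickleK).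
  rewrite FkE (eq_integral (cst (H i))) ?integral_cst//.
  by move=> w; rewrite inE /= => ->.
rewrite nneseries_esumT//.
transitivity (\esum_(k in [set choice.pickle i | i in [set: I]]) G k)%E.
  rewrite [RHS]esum_mkcond; apply: eq_esum => k _; case: ifPn => //.
  rewrite notin_setE /= => nk; rewrite /G; case: choice.unpickle => [i|//].
  by case: eqP => // ik; case: nk; exists i.
rewrite esum_image; last by move=> i j _ _; exact: (pcan_inj choice.pickleK).
by apply: eq_esum => i _; rewrite /G choice.pickleK eqxx.
Qed.

End countable_valued.

Section poisson_vector.
Context (d : measure_display) (T : measurableType d) (R : realType).
Variables (P : probability T R) (J : finType) (p : J -> R) (Z : J -> T -> nat).
Hypothesis p_gt0 : forall j, 0 < p j.
Hypothesis mZ : forall j n, measurable (Z j @^-1` [set n]).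
Hypothesis PZ : forall n : J -> nat,
  P (\bigcap_(j in [set: J]) Z j @^-1` [set n j]) = (\prod_j poisson_pmf (p j) (n j))%:E.

Let Zf w : {ffun J -> nat} := [ffun j => Z j w].

Let ZfE (n : {ffun J -> nat}) :
  Zf @^-1` [set n] = \bigcap_(j in [set: J]) Z j @^-1` [set n j].
Proof.
apply/seteqP; split => w /=; first by move=> <- j _; rewrite ffunE.
by move=> h; apply/ffunP => j; rewrite ffunE; exact: h.
Qed.

Let mZf n : measurable (Zf @^-1` [set n]).
Proof.
rewrite ZfE; apply: fin_bigcap_measurable => //.
Qed.

Let PZf (n : {ffun J -> nat}) :
  P (Zf @^-1` [set n]) = (\prod_j poisson_pmf (p j) (n j))%:E.
Proof. by rewrite ZfE; exact: PZ. Qed.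

Let incr (j : J) (n : {ffun J -> nat}) : {ffun J -> nat} :=
  [ffun i => (n i + (i == j))%N].

Lemma poisson_pmfS (r : R) n : 0 < r -> n.+1%:R * poisson_pmf r n.+1 = r * poisson_pmf r n.
Proof.
move=> r0; rewrite /poisson_pmf r0 factS natrM exprS.
have n0 : (n.+1%:R : R) != 0 by rewrite pnatr_eq0.
have f0 : (n`!%:R : R) != 0 by rewrite pnatr_eq0 -lt0n fact_gt0.
by move: n0 f0; move: (n.+1%:R : R) (n`!%:R : R) => a b a0 b0; field; rewrite a0 b0.
Qed.

(** In the sum over count vectors the terms with [n j = 0] vanish, and [incr j] maps all vectors
    bijectively onto the others; [poisson_pmfS] then trades the factor [n j] for the mean [p j]. *)
Lemma ge0_mecke (j : J) (G : {ffun J -> nat} -> R) : (forall n, 0 <= G n) ->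
  (\int[P]_w ((Z j w)%:R * G (Zf w))%:E =
   (p j)%:E * \int[P]_w (G (incr j (Zf w)))%:E)%E.
Proof.
move=> G0.
rewrite -ge0_integralZl//; last 3 first.
- exact: (measurable_fun_countable mZf (fun n => (G (incr j n))%:E)).
- by move=> w _; rewrite lee_fin.
- by rewrite lee_fin ltW.
pose H1 (n : {ffun J -> nat}) := ((n j)%:R * G n)%:E.
pose H2 (n : {ffun J -> nat}) := ((p j)%:E * (G (incr j n))%:E)%E.
have H10 n : (0 <= H1 n)%E by rewrite lee_fin mulr_ge0.
have H20 n : (0 <= H2 n)%E by rewrite /H2 -EFinM lee_fin mulr_ge0// ltW.
transitivity (\int[P]_w H1 (Zf w))%E.
  by apply: eq_integral => w _; rewrite /H1 ffunE.
transitivity (\int[P]_w H2 (Zf w))%E; last by [].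
rewrite (integral_countable P mZf H10) (integral_countable P mZf H20).
transitivity (\esum_(n in [set n : {ffun J -> nat} | (0 < n j)%N])
    (H1 n * P (Zf @^-1` [set n])))%E.
  rewrite [RHS]esum_mkcond; apply: eq_esum => n _; case: ifPn => //.
  by rewrite notin_setE /= => /negP; rewrite -eqn0Ngt /H1 => /eqP->; rewrite mul0r mul0e.
rewrite (@reindex_esum _ _ _ [set: {ffun J -> nat}] _ (incr j)); last first.
  split.
  - by move=> n _ /=; rewrite ffunE eqxx addn1.
  - move=> n n' _ _ /ffunP e; apply/ffunP => i; have := e i.
    by rewrite !ffunE => /addIn.
  - move=> n /= nj; exists [ffun i => (n i - (i == j))%N] => //.
    apply/ffunP => i; rewrite !ffunE; case: eqP => [->|_]; first by rewrite subnK.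
    by rewrite subn0 addn0.
apply: eq_esum => n _; rewrite /H1 /H2 PZf.
apply: etrans (congr1 (mule _) (esym (PZf n))); rewrite -!EFinM; congr EFin.
rewrite (bigD1 j)//= [in RHS](bigD1 j)//= ffunE eqxx addn1.
rewrite (eq_bigr (fun i => poisson_pmf (p i) (n i))) => [|i /negbTE ij]; last first.
  by rewrite ffunE ij addn0.
have := poisson_pmfS (n j) (p_gt0 j); set a := poisson_pmf _ _; set b := poisson_pmf _ _.
set c := \prod_(_ | _) _ => e.
rewrite (_ : _ * (a * c) = ((n j).+1%:R * a) * (G (incr j n) * c)); last by ring.
by rewrite e; ring.
Qed.

End poisson_vector.

Section poisson_integral.
Context (d : measure_display) (T : measurableType d) (R : realType).
Variables (P : probability T R) (J : finType) (p : J -> R) (Z : J -> T -> nat).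
Hypothesis p_gt0 : forall j, 0 < p j.
Hypothesis mZ : forall j n, measurable (Z j @^-1` [set n]).
Hypothesis PZ : forall n : J -> nat,
  P (\bigcap_(j in [set: J]) Z j @^-1` [set n j]) = (\prod_j poisson_pmf (p j) (n j))%:E.

Let zv w : J -> R := fun j => (Z j w)%:R.

Let zvE w : zv w = (fun j => ([ffun j => Z j w] j)%:R).
Proof. by apply/funext => j; rewrite ffunE. Qed.

Let measurable_zv (phi : (J -> R) -> R) : measurable_fun [set: T] (fun w => phi (zv w)).
Proof.
have mZf (n : {ffun J -> nat}) : measurable ((fun w => [ffun j => Z j w]) @^-1` [set n]).
  rewrite (_ : _ @^-1` _ = \bigcap_(j in [set: J]) Z j @^-1` [set n j]).
    by apply: fin_bigcap_measurable.
  apply/seteqP; split => w /=; first by move=> <- j _; rewrite ffunE.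
  by move=> h; apply/ffunP => j; rewrite ffunE; exact: h.
rewrite (_ : (fun w => _) = (fun w => phi (fun j => ([ffun j => Z j w] j)%:R))).
  exact: (measurable_fun_countable mZf (fun n : {ffun J -> nat} => phi (fun j => (n j)%:R))).
by apply/funext => w; rewrite zvE.
Qed.

Let ge0_mecke_zv (j : J) (phi : (J -> R) -> R) :
  (forall n : J -> nat, 0 <= phi (fun j => (n j)%:R)) ->
  (\int[P]_w (zv w j * phi (zv w))%:E =
   (p j)%:E * \int[P]_w (phi (shift (zv w) j))%:E)%E.
Proof.
move=> phi0.
have := ge0_mecke p_gt0 mZ PZ j (G := fun n : {ffun J -> nat} => phi (fun j => (n j)%:R)).
move=> /(_ (fun n => phi0 n)) h.
transitivity (\int[P]_w ((Z j w)%:R *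
   (fun n : {ffun J -> nat} => phi (fun j => (n j)%:R)) [ffun j => Z j w])%:E)%E.
  by apply: eq_integral => w _; rewrite /= -zvE.
rewrite h; congr (_ * _)%E; apply: eq_integral => w _; congr (phi _)%:E.
apply/funext => i; rewrite !ffunE natrD /shift /upd /zv.
by case: eqP => [->//|]; rewrite addr0.
Qed.

Let N w : R := 1 + \sum_j zv w j.

Let N_ge1 w : 1 <= N w. Proof. by rewrite lerDl sumr_ge0. Qed.

Let N_ge0 w : 0 <= N w. Proof. exact: le_trans ler01 (N_ge1 w). Qed.

Let measurable_N q : measurable_fun [set: T] (fun w => (N w ^+ q)%:E).
Proof.
apply/measurable_EFinP.
exact: (measurable_zv (fun z => (1 + \sum_j z j) ^+ q)).
Qed.

(** Induction on [q]: in [N ^+ q.+1 = N ^+ q + \sum_j z j * N ^+ q] the Mecke formula removes the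
    factor [z j]. It runs in the extended reals because finiteness is the point at issue. *)
Let moment_fin q : (\int[P]_w (N w ^+ q)%:E < +oo)%E.
Proof.
elim: q => [|q IH].
  under eq_integral do rewrite expr0.
  rewrite integral_cst// mul1e.
  by rewrite -ge0_fin_numE// fin_num_measure.
rewrite (_ : (\int[P]_w _)%E = (\int[P]_w ((N w ^+ q)%:E +
   \sum_j (zv w j * N w ^+ q)%:E))%E); last first.
  apply: eq_integral => w _; rewrite sumEFin -EFinD; congr (_%:E).
  by rewrite -mulr_suml exprS {1}/N mulrDl mul1r.
rewrite ge0_integralD//=; last 3 first.
- by move=> w _; rewrite lee_fin exprn_ge0.
- by move=> w _; apply: sume_ge0 => j _; rewrite lee_fin mulr_ge0// exprn_ge0.
- under eq_fun do rewrite sumEFin.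
  apply/measurable_EFinP.
  exact: (measurable_zv (fun z => \sum_j z j * (1 + \sum_j z j) ^+ q)).
rewrite lte_add_pinfty// ge0_integral_sum//; last 2 first.
- move=> j; apply/measurable_EFinP.
  exact: (measurable_zv (fun z => z j * (1 + \sum_j z j) ^+ q)).
- by move=> j w _; rewrite lee_fin mulr_ge0// exprn_ge0.
apply: lte_sum_pinfty => j _.
rewrite (ge0_mecke_zv j (phi := fun z => (1 + \sum_j z j) ^+ q)); last first.
  by move=> n; rewrite exprn_ge0// addr_ge0// sumr_ge0.
apply: lte_mul_pinfty => //; first by rewrite lee_fin ltW.
apply: (@le_lt_trans _ _ (\int[P]_w ((2 ^+ q)%:E * (N w ^+ q)%:E))%E); last first.
  rewrite ge0_integralZl//; last first.
    by move=> w _; rewrite lee_fin exprn_ge0.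
  by apply: lte_mul_pinfty => //; rewrite lee_fin exprn_ge0.
apply: ge0_le_integral => //.
- move=> w _; rewrite lee_fin exprn_ge0// addr_ge0// sumr_ge0// => i _.
  by rewrite /shift /upd; case: eqP => // _; rewrite addr_ge0.
- apply/measurable_EFinP.
  exact: (measurable_zv (fun z => (1 + \sum_i shift z j i) ^+ q)).
- apply/measurable_EFinP.
  exact: (measurable_zv (fun z => 2 ^+ q * (1 + \sum_i z i) ^+ q)).
- move=> w _; rewrite -EFinM lee_fin -exprMn lerXn2r ?nnegrE ?mulr_ge0//.
    rewrite addr_ge0// sumr_ge0// => i _.
    by rewrite /shift /upd; case: eqP => // _; rewrite addr_ge0.
  rewrite (bigD1 j)//= shift_eq (eq_bigr (zv w)) => [|i ij]; last by rewrite shift_neq.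
  have := N_ge1 w; rewrite {2}/N [in 1 + \sum_j _](bigD1 j)//= /N (bigD1 j)//=; lra.
Qed.

Lemma integrable_poly_growth (phi : (J -> R) -> R) : poly_growth phi ->
  P.-integrable [set: T] (fun w => (phi (fun j => (Z j w)%:R))%:E).
Proof.
move=> [C [q phiC]].
have iN : P.-integrable [set: T] (fun w => (C * N w ^+ q)%:E).
  under eq_fun do rewrite EFinM.
  apply: integrableZl => //; apply/integrableP; split; first exact: measurable_N.
  apply: le_lt_trans (moment_fin q); rewrite le_eqVlt; apply/orP; left; apply/eqP.
  by apply: eq_integral => w _; rewrite gee0_abs// lee_fin exprn_ge0.
apply: le_integrable iN => //.
- by apply/measurable_EFinP; exact: measurable_zv.
- move=> w _; rewrite lee_fin -/(zv w) (le_trans (phiC _))//.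
  rewrite (eq_bigr (zv w)) => [|j _]; last by rewrite ger0_norm.
  exact: ler_norm.
Qed.

Lemma poisson_expectation_Rintegral :
  poisson_expectation p (fun phi => \int[P]_w phi (fun j => (Z j w)%:R)).
Proof.
split.
- by move=> phi psi pphi ppsi; rewrite RintegralD//; exact: integrable_poly_growth.
- by move=> c phi pphi; rewrite RintegralZl//; exact: integrable_poly_growth.
- move=> phi psi pphi ppsi h; apply: le_Rintegral => //; first exact: integrable_poly_growth.
  exact: integrable_poly_growth.
- by rewrite Rintegral_cst// mul1r; exact: (congr1 fine (probability_setT P)).
- have pos j phi : poly_growth phi -> (forall n : J -> nat, 0 <= phi (fun j => (n j)%:R)) ->
      \int[P]_w ((Z j w)%:R * phi (fun j => (Z j w)%:R)) =
      p j * \int[P]_w phi (shift (fun j => (Z j w)%:R) j).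
    move=> pphi phi0; rewrite {1}/Rintegral ge0_mecke_zv// fineM//.
    by apply: integrable_fin_num => //; apply: (@integrable_poly_growth (fun z => phi (shift z j))); pg.
  (* A signed [phi] is written as [|phi| - (|phi| - phi)], a difference of nonnegative functions of
     polynomial growth. *)
  move=> j phi pphi.
  have pn := poly_growth_norm pphi.
  have pd : poly_growth (fun z => `|phi z| - phi z) by pg.
  have pj : poly_growth (fun z : J -> R => z j) by pg.
  have e1 := pos j _ pn (fun n => normr_ge0 _).
  have e2 := pos j _ pd (fun n => _ : 0 <= _).
  have {}e2 := e2 (fun n => etrans (subr_ge0 _ _) (ler_norm _)).
  have e3 : (fun w => (Z j w)%:R * phi (fun j => (Z j w)%:R)) =
     (fun w => (Z j w)%:R * `|phi (fun j => (Z j w)%:R)| -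
               (Z j w)%:R * (`|phi (fun j => (Z j w)%:R)| - phi (fun j => (Z j w)%:R))).
    by apply/funext => w; ring.
  rewrite e3 RintegralB//; last 2 first.
  - by apply: (@integrable_poly_growth (fun z => z j * `|phi z|)); pg.
  - by apply: (@integrable_poly_growth (fun z => z j * (`|phi z| - phi z))); pg.
  rewrite e1 e2 -mulrBr -RintegralB//; last 2 first.
  - by apply: (@integrable_poly_growth (fun z => `|phi (shift z j)|)); pg.
  - by apply: (@integrable_poly_growth (fun z => `|phi (shift z j)| - phi (shift z j))); pg.
  by congr (_ * Rintegral _ _ _); apply/funext => w; ring.
Qed.

End poisson_integral.

(** * Moments of the total count in terms of the intensity *)

Section moments.
Variables (R : realType) (J : finType) (p : J -> R).
Variable Ex : ((J -> R) -> R) -> R.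
Hypothesis hEx : poisson_expectation p Ex.
Hypothesis p_ge0 : forall j, 0 <= p j.

(** One more power costs at most the factor [(1 + t * 2 ^+ q') * lam]: the Mecke formula contributes
    the total mean, and one added point at most doubles [1 + \sum_j z j]. *)
Fixpoint moment_cst (t : R) (q : nat) : R :=
  if q is q'.+1 then (1 + t * 2 ^+ q') * moment_cst t q' else 1.

Lemma moment_cst_gt0 t q : 0 <= t -> 0 < moment_cst t q.
Proof.
move=> t0; elim: q => //= q IH.
by rewrite mulr_gt0// ltr_wpDr// mulr_ge0// exprn_ge0.
Qed.

Lemma Ex_moment_le (t lam : R) q : 0 <= t -> 1 <= lam -> \sum_j p j <= t * lam ->
  Ex (fun z => (1 + \sum_j z j) ^+ q) <= moment_cst t q * lam ^+ q.
Proof.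
move=> t0 lam1 hp.
have lam0 : 0 <= lam by exact: le_trans lam1.
have pN n : poly_growth (fun z : J -> R => (1 + \sum_j z j) ^+ n) by pg.
elim: q => [|q IH].
  under eq_fun do rewrite expr0.
  by rewrite (Ex_cst hEx) expr0 mulr1.
have e : Ex (fun z => (1 + \sum_j z j) ^+ q.+1) = Ex (fun z => (1 + \sum_j z j) ^+ q) +
   \sum_j p j * Ex (fun z => (1 + \sum_i shift z j i) ^+ q).
  transitivity (Ex (fun z => (1 + \sum_j z j) ^+ q + \sum_j (z j * (1 + \sum_j z j) ^+ q))).
    by apply: Ex_ext => z; rewrite -mulr_suml exprS mulrDl mul1r.
  rewrite (ExD hEx); [|by pg|by pg]; congr (_ + _).
  rewrite (Ex_sum hEx) => [|j _]; last by pg.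
  by apply: eq_bigr => j _; rewrite (Ex_mecke hEx).
have s j : Ex (fun z => (1 + \sum_i shift z j i) ^+ q) <=
    2 ^+ q * Ex (fun z => (1 + \sum_j z j) ^+ q).
  rewrite -(ExZ hEx)//; apply: (Ex_le hEx).
  - exact: (poly_growth_shift j (pN q)).
  - by have := pN q; pg.
  - move=> n; rewrite -exprMn lerXn2r ?nnegrE ?mulr_ge0 ?addr_ge0 ?sumr_ge0//.
      by move=> i _; rewrite /shift /upd; case: eqP => // _; rewrite addr_ge0.
    rewrite (bigD1 j)//= shift_eq (eq_bigr (fun i => (n i)%:R)) => [|i ij]; last first.
      by rewrite shift_neq.
    rewrite [X in _ <= 2 * (1 + X)](bigD1 j)//=.
    have : 0 <= \sum_(i | i != j) (n i)%:R :> R by rewrite sumr_ge0.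
    have : 0 <= (n j)%:R :> R by [].
    lra.
rewrite e /=; set M := Ex _ in IH s *.
have M0 : 0 <= M.
  by apply: (Ex_ge0 hEx) => // n; rewrite exprn_ge0// addr_ge0// sumr_ge0.
have q2 : 0 <= 2 ^+ q :> R by rewrite exprn_ge0.
apply: (@le_trans _ _ (M + (t * lam) * (2 ^+ q * M))).
  rewrite lerD2l; apply: (@le_trans _ _ (\sum_j p j * (2 ^+ q * M))).
    by apply: ler_sum => j _; rewrite ler_wpM2l.
  by rewrite -mulr_suml ler_wpM2r// mulr_ge0.
apply: (@le_trans _ _ ((1 + t * 2 ^+ q) * lam * M)).
  have : 0 <= t * (2 ^+ q * M) by rewrite !mulr_ge0.
  nra.
rewrite exprS.
rewrite [leRHS](_ : _ = (1 + t * 2 ^+ q) * lam * (moment_cst t q * lam ^+ q)); last by ring.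
by rewrite ler_wpM2l// mulr_ge0// addr_ge0// mulr_ge0.
Qed.

End moments.

(** * Hop polynomials *)

Section hop_polynomial.
Variables (R : realType) (J : finType) (m : nat).
Variable C : pred {ffun 'I_m -> J}.
Hypothesis C_inj : forall c, C c -> injective c.
Implicit Types (z : J -> R) (c : {ffun 'I_m -> J}) (A : {set 'I_m}).

Definition hop_poly z : R := \sum_(c : {ffun 'I_m -> J} | C c) \prod_i z (c i).

Definition monomial A c z : R := \prod_(i in A) z (c i).

Lemma hop_polyE : hop_poly = fun z => \sum_(c : {ffun 'I_m -> J} | C c) monomial [set: 'I_m] c z.
Proof.
apply/funext => z; apply: eq_bigr => c _; apply: eq_bigl => i; by rewrite inE.
Qed.

Lemma poly_growth_monomial A c : poly_growth (monomial A c).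
Proof.
by apply: poly_growth_prod => i _; exact: poly_growth_coord.
Qed.

Lemma monomial_upd A c j z x : injective c ->
  monomial A c (upd z j x) = monomial A c (upd z j 0) +
    x * \sum_(i in A | c i == j) monomial (A :\ i) c z.
Proof.
move=> c_inj.
have [[i0 i0A ci0]|noi] := pselect (exists2 i, i \in A & c i = j).
  have E y : monomial A c (upd z j y) = y * monomial (A :\ i0) c z.
    rewrite /monomial (big_setD1 i0)//= ci0 upd_eq; congr (_ * _).
    apply: eq_bigr => i; rewrite !inE => /andP[ii0 iA].
    by rewrite upd_neq// -ci0; apply: contra_neq ii0 => /c_inj.
  rewrite !E mul0r add0r (big_pred1 i0)// => i /=.
  rewrite -ci0 (inj_eq c_inj) andbC; case: eqP => //= ->; exact/esym.
have E y : monomial A c (upd z j y) = monomial A c z.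
  apply: eq_bigr => i iA; rewrite upd_neq//; apply/eqP => cij; apply: noi.
  by exists i.
rewrite !E big_pred0 ?mulr0 ?addr0// => i; apply/negbTE/negP => /andP[iA /eqP cij].
by apply: noi; exists i.
Qed.

Lemma difference_monomial A c j z : injective c ->
  difference j (monomial A c) z = \sum_(i in A | c i == j) monomial (A :\ i) c z.
Proof.
move=> c_inj; rewrite /difference (monomial_upd A j z 1 c_inj).
by rewrite mul1r addrC addKr.
Qed.

(** Injective tuples never repeat a cell, so no variable occurs squared. *)
Lemma multiaffine_hop_poly : multiaffine hop_poly.
Proof.
rewrite hop_polyE; apply: multiaffine_sum => c /C_inj c_inj z j x.
by rewrite monomial_upd// difference_monomial.
Qed.

Lemma poly_growth_hop_poly : poly_growth hop_poly.
Proof.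
by rewrite hop_polyE; apply: poly_growth_sum => c _; exact: poly_growth_monomial.
Qed.

Lemma difference_hop_poly j z : difference j hop_poly z =
  \sum_(c : {ffun 'I_m -> J} | C c) \sum_(i | c i == j) monomial [set~ i] c z.
Proof.
rewrite hop_polyE difference_sum; apply: eq_bigr => c /C_inj c_inj.
rewrite difference_monomial//; apply: eq_big => i; first by rewrite inE.
by rewrite finset.setTD.
Qed.

Lemma difference2_hop_poly i j z : difference i (difference j hop_poly) z =
  \sum_(c : {ffun 'I_m -> J} | C c) \sum_(u | c u == j)
    \sum_(v | (v != u) && (c v == i)) monomial ([set~ u] :\ v) c z.
Proof.
have -> : difference j hop_poly = fun z =>
    \sum_(c : {ffun 'I_m -> J} | C c) \sum_(u | c u == j) monomial [set~ u] c z.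
  by apply/funext => z'; rewrite difference_hop_poly.
rewrite difference_sum; apply: eq_bigr => c /C_inj c_inj.
rewrite difference_sum; apply: eq_bigr => u _.
rewrite [LHS](difference_monomial _ _ _ c_inj).
by apply: eq_bigl => v; rewrite !inE.
Qed.

(** Euler's identity for a homogeneous polynomial of degree [m]; at [z = p] it evaluates the sum of
    the [p j * difference j g p], which bounds the variance from below. *)
Lemma hop_poly_euler z : \sum_j z j * difference j hop_poly z = m%:R * hop_poly z.
Proof.
under eq_bigr do rewrite difference_hop_poly mulr_sumr.
rewrite exchange_big/= mulr_sumr; apply: eq_bigr => c _.
under eq_bigr do rewrite mulr_sumr.
rewrite (exchange_big_dep xpredT)//=.
transitivity (\sum_(i < m) \prod_i z (c i)); last first.
  by rewrite sumr_const card_ord mulr_natl.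
apply: eq_bigr => i _; rewrite (big_pred1 (c i)) => [|j]; last by rewrite /= eq_sym.
by rewrite (bigD1 i)//=; congr (_ * _); apply: eq_bigl => i'; rewrite !inE.
Qed.

Lemma hop_poly_cst (x : R) : hop_poly (fun=> x) = #|C|%:R * x ^+ m.
Proof.
transitivity (\sum_(c : {ffun 'I_m -> J} | C c) x ^+ m).
  by apply: eq_bigr => c _; rewrite prodr_const card_ord.
by rewrite sumr_const mulr_natl.
Qed.

Section nonneg.
Variable z : J -> R.
Hypothesis z_ge0 : forall j, 0 <= z j.

Lemma monomial_ge0 A c : 0 <= monomial A c z.
Proof. exact: prodr_ge0. Qed.

Lemma hop_poly_ge0 : 0 <= hop_poly z.
Proof. by apply: sumr_ge0 => c _; exact: prodr_ge0. Qed.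

(** Positions in [A] range freely and the others are pinned to [w], so the sum factors. Tuples are
    thus weighed by the total mass, whatever the number of cells. *)
Lemma sum_monomial_le A (w : {ffun 'I_m -> J}) :
  \sum_(c : {ffun 'I_m -> J} | [forall i, (i \notin A) ==> (c i == w i)]) monomial A c z =
  (\sum_j z j) ^+ #|A|.
Proof.
transitivity (\sum_(c : {ffun 'I_m -> J})
    \prod_i (if i \in A then z (c i) else (c i == w i)%:R)).
  rewrite big_mkcond/=; apply: eq_bigr => c _; case: ifPn => [/forallP h|].
    rewrite /monomial big_mkcond; apply: eq_bigr => i _.
    by case: ifPn => // iA; have := h i; rewrite iA /= => ->.
  rewrite negb_forall => /existsP[i]; rewrite negb_imply => /andP[iA ci].
  by rewrite (bigD1 i)//= (negbTE iA) (negbTE ci) mul0r.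
rewrite -(bigA_distr_bigA (fun i j => if i \in A then z j else (j == w i)%:R)).
rewrite -prodr_const [RHS]big_mkcond/=; apply: eq_bigr => i _.
case: ifPn => // _; rewrite (bigD1 (w i))//= eqxx big1 ?addr0// => j /negbTE->.
by [].
Qed.

Lemma difference_hop_poly_ge0 j : 0 <= difference j hop_poly z.
Proof.
rewrite difference_hop_poly; apply: sumr_ge0 => c _; apply: sumr_ge0 => i _.
exact: monomial_ge0.
Qed.

(** The factor [m] counts the position that the cell [j] occupies; with it pinned, dropping the
    condition [C] lets the other positions range freely. *)
Lemma difference_hop_poly_le j :
  difference j hop_poly z <= m%:R * (\sum_j z j) ^+ m.-1.
Proof.
rewrite difference_hop_poly (exchange_big_dep xpredT)//=.
rewrite -[X in X%:R](card_ord m) -sumr_const mulr_suml /=.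
under [leRHS]eq_bigr do rewrite mul1r.
apply: ler_sum => i _.
have -> : m.-1 = #|[set~ i]%SET| by rewrite cardsC1 card_ord.
rewrite -(sum_monomial_le _ [ffun=> j]) big_mkcond [leRHS]big_mkcond/=.
apply: ler_sum => c _; case: andP => [[_ ci]|_].
  case: forallP => // -[] i'; rewrite !inE negbK ffunE.
  by apply/implyP => /eqP->.
by case: ifP => // _; exact: monomial_ge0.
Qed.

Lemma difference2_hop_poly_ge0 i j : 0 <= difference i (difference j hop_poly) z.
Proof.
rewrite difference2_hop_poly; apply: sumr_ge0 => c _; apply: sumr_ge0 => u _.
by apply: sumr_ge0 => v _; exact: monomial_ge0.
Qed.

Lemma difference2_hop_poly_le i j : difference i (difference j hop_poly) z <=
  (m * m.-1)%:R * (\sum_j z j) ^+ m.-2.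
Proof.
rewrite difference2_hop_poly (exchange_big_dep xpredT)//=.
rewrite natrM -[X in X%:R * _ * _](card_ord m) -sumr_const !mulr_suml /=.
under [leRHS]eq_bigr do rewrite mul1r.
apply: ler_sum => u _; rewrite (exchange_big_dep (fun v => v != u))/=; last first.
  by move=> c v _ /andP[].
have cu : m.-1 = #|[pred v | v != u]| by have := cardC1 u; rewrite card_ord => <-.
rewrite [X in _ <= X%:R * _]cu -sumr_const mulr_suml; under [leRHS]eq_bigr do rewrite mul1r.
apply: ler_sum => v vu.
have -> : m.-2 = #|([set~ u] :\ v)%SET|.
  have := cardsD1 v [set~ u]%SET; rewrite cardsC1 card_ord !inE vu add1n => ->.
  by [].
rewrite -(sum_monomial_le _ [ffun l => if l == u then j else i]).
rewrite big_mkcond [leRHS]big_mkcond/=.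
apply: ler_sum => c _; case: ifP => [/and3P[/andP[_ cuj] _ cvi]|_].
  case: forallP => // -[] l; rewrite !inE negb_and !negbK ffunE.
  case: (l =P u) => [->|_]; first by apply/implyP.
  by rewrite orbF; apply/implyP => /eqP->.
by case: ifP => // _; exact: monomial_ge0.
Qed.

End nonneg.

End hop_polynomial.

(** * Normal approximation of hop polynomials *)

Section hop_poly_clt.
Variables (R : realType) (J : finType) (m : nat).
Variable C : pred {ffun 'I_m -> J}.
Hypothesis C_inj : forall c, C c -> injective c.
Variables (p : J -> R) (Ex : ((J -> R) -> R) -> R).
Hypothesis hEx : poisson_expectation p Ex.
Hypothesis p_ge0 : forall j, 0 <= p j.
Variables (t kappa lam : R).
Hypothesis m_gt0 : (0 < m)%N.
Hypothesis t_gt0 : 0 < t.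
Hypothesis kappa_gt0 : 0 < kappa.
Hypothesis lam_ge1 : 1 <= lam.
Hypothesis p_sum : \sum_j p j <= t * lam.
Local Notation g := (@hop_poly R J m C).
Hypothesis g_mean : kappa * lam ^+ m <= g p.

(** The order of magnitude of an add-one cost: one of the [m] nodes is prescribed, and each other
    node contributes a factor [lam]. *)
Let x := lam ^+ m.-1.

Let lam_gt0 : 0 < lam. Proof. exact: lt_le_trans lam_ge1. Qed.
Let x_gt0 : 0 < x. Proof. exact: exprn_gt0. Qed.

(** A single constant for the first and the second differences; the summand 1 gives
    [K <= K ^+ 2]. *)
Definition hop_moment_cst (m : nat) (t : R) : R :=
  1 + m%:R ^+ 2 * moment_cst t (2 * m.-1) +
  (m * m.-1)%:R ^+ 2 * moment_cst t (2 * m.-2).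

Local Notation K := (hop_moment_cst m t).

Lemma hop_moment_cst_ge1 : 1 <= K.
Proof.
rewrite /hop_moment_cst -addrA lerDl addr_ge0// mulr_ge0 ?sqr_ge0//;
  by rewrite ltW// moment_cst_gt0// ltW.
Qed.

Lemma Ex_le_pow (phi : (J -> R) -> R) (b : R) q : poly_growth phi -> 0 <= b ->
  (forall n : J -> nat, 0 <= phi (fun i => (n i)%:R) <= b * (\sum_j (n j)%:R) ^+ q) ->
  Ex (fun z => phi z ^+ 2) <= b ^+ 2 * (moment_cst t (2 * q) * lam ^+ (2 * q)).
Proof.
move=> pphi b0 h.
apply: (@le_trans _ _ (Ex (fun z => b ^+ 2 * (1 + \sum_j z j) ^+ (2 * q)))).
  apply: (Ex_le hEx); [by pg|by pg|move=> n].
  have /andP[h0 h1] := h n.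
  rewrite mulnC exprM -exprMn lerXn2r ?nnegrE ?mulr_ge0 ?exprn_ge0 ?addr_ge0 ?sumr_ge0//.
  apply: le_trans h1 _; rewrite ler_wpM2l// lerXn2r ?nnegrE ?addr_ge0 ?sumr_ge0//.
  by rewrite lerDr.
rewrite (ExZ hEx); last by pg.
rewrite ler_wpM2l ?sqr_ge0//; apply: (Ex_moment_le hEx) => //; exact: ltW.
Qed.

Let D_ge0 j (n : J -> nat) : 0 <= difference j g (fun i => (n i)%:R).
Proof. exact: difference_hop_poly_ge0. Qed.

Let hb1 j : Ex (fun z => difference j g z ^+ 2) <= K * x ^+ 2.
Proof.
have h : Ex (fun z => difference j g z ^+ 2) <=
    m%:R ^+ 2 * (moment_cst t (2 * m.-1) * lam ^+ (2 * m.-1)).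
  apply: Ex_le_pow => //; first exact: poly_growth_difference (poly_growth_hop_poly _ _).
  move=> n; rewrite D_ge0/=; exact: difference_hop_poly_le.
apply: le_trans h _; rewrite mulrA [in lam ^+ _]mulnC exprM ler_wpM2r ?sqr_ge0//.
rewrite /hop_moment_cst.
have : 0 <= (m * m.-1)%:R ^+ 2 * moment_cst t (2 * m.-2).
  by rewrite mulr_ge0 ?sqr_ge0// ltW// moment_cst_gt0// ltW.
lra.
Qed.

Let hb2 i j : Ex (fun z => difference i (difference j g) z ^+ 2) <= K * x ^+ 2 / lam ^+ 2.
Proof.
have h : Ex (fun z => difference i (difference j g) z ^+ 2) <=
    (m * m.-1)%:R ^+ 2 * (moment_cst t (2 * m.-2) * lam ^+ (2 * m.-2)).
  apply: Ex_le_pow => //.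
    by apply: poly_growth_difference; apply: poly_growth_difference;
      exact: poly_growth_hop_poly.
  move=> n; rewrite difference2_hop_poly_ge0//=; exact: difference2_hop_poly_le.
apply: le_trans h _.
have M0 := moment_cst_gt0 (2 * m.-2) (ltW t_gt0).
have M1 := moment_cst_gt0 (2 * m.-1) (ltW t_gt0).
have s1 := sqr_ge0 (m%:R : R).
(* For [m = 1] the exponent [m.-2] is truncated at 0 and the powers of [lam] do not match, but then
   the factor [m * m.-1] is zero. *)
case: m m_gt0 @x x_gt0 M0 M1 s1 => [//|[|q]] _ x' x'0 M0 M1 s1.
  rewrite muln0 expr0n/= mul0r divr_ge0 ?sqr_ge0// mulr_ge0 ?sqr_ge0//.
  by rewrite /hop_moment_cst muln0 expr0n/= mul0r addr0 addr_ge0// mulr_ge0// ltW.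
have -> : x' ^+ 2 = lam ^+ (2 * q) * lam ^+ 2 :> R.
  by rewrite /x'/= -exprM -exprD; congr (_ ^+ _); rewrite mulSn addnC mulnC.
rewrite [leRHS](_ : _ = hop_moment_cst q.+2 t * lam ^+ (2 * q)); last first.
  by field; rewrite gt_eqF.
rewrite mulrA ler_wpM2r ?exprn_ge0 ?(ltW lam_gt0)//.
by rewrite [in leRHS]/hop_moment_cst lerDr addr_ge0// mulr_ge0// ltW.
Qed.

Let V := Ex (fun z => (g z - g p) ^+ 2).

(** Only the first chaos is kept: by Cauchy-Schwarz with weights [p], its variance is at least
    [s ^+ 2 / Lam], and [s = m * g p] by Euler's identity. *)
Lemma hop_poly_variance_ge : kappa ^+ 2 / t * (lam * x ^+ 2) <= V.
Proof.
have := variance_split hEx (poly_growth_hop_poly _ _) (multiaffine_hop_poly C_inj) (g := g).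
rewrite -/V => VE.
pose Lam := \sum_j p j; pose s := \sum_j p j * difference j g p.
have sE : s = m%:R * g p by rewrite /s hop_poly_euler.
have r0 : 0 <= Ex (fun z => (g z - g p - \sum_j difference j g p * (z j - p j)) ^+ 2).
  apply: (Ex_ge0 hEx) => [|n]; last exact: sqr_ge0.
  by have ? := poly_growth_hop_poly R C; pg.
have g0 : 0 < g p.
  by apply: lt_le_trans g_mean; rewrite mulr_gt0// exprn_gt0.
have Lam0 : 0 < Lam.
  rewrite lt0r sumr_ge0// andbT; apply/eqP => L0.
  have : s = 0.
    by apply: big1 => j _; have /psumr_eq0P := L0 => -> //; rewrite mul0r.
  by rewrite sE => /eqP; rewrite mulf_eq0 pnatr_eq0 gt_eqF//= gt_eqF.
have cs : s ^+ 2 / Lam <= \sum_j p j * difference j g p ^+ 2.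
  have : 0 <= \sum_j p j * (difference j g p - s / Lam) ^+ 2.
    by apply: sumr_ge0 => j _; rewrite mulr_ge0 ?sqr_ge0.
  have e r : \sum_j p j * (difference j g p - r) ^+ 2 =
     \sum_j p j * difference j g p ^+ 2 + (- 2 * r) * s + r ^+ 2 * Lam.
    by rewrite !mulr_sumr -!big_split/=; apply: eq_bigr => j _; ring.
  rewrite e.
  rewrite (_ : _ + _ + _ = \sum_j p j * difference j g p ^+ 2 - s ^+ 2 / Lam); first by lra.
  by field; rewrite gt_eqF.
apply: le_trans (_ : s ^+ 2 / Lam <= _); last first.
  by rewrite VE; apply: le_trans cs _; rewrite lerDl.
have xE : lam ^+ m = lam * x by rewrite /x -exprS prednK.
have s1 : kappa * (lam * x) <= s.
  rewrite sE -xE; apply: le_trans g_mean _; rewrite ler_peMl ?(ltW g0)//.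
  by rewrite ler1n.
apply: (@le_trans _ _ ((kappa * (lam * x)) ^+ 2 / (t * lam))).
  by rewrite le_eqVlt; apply/orP; left; apply/eqP; field; rewrite !gt_eqF.
have klx : 0 <= kappa * (lam * x) by rewrite !mulr_ge0// ltW.
apply: ler_pM; first exact: sqr_ge0.
- by rewrite invr_ge0 mulr_ge0// ltW.
- by rewrite lerXn2r ?nnegrE// (le_trans klx).
- by rewrite lef_pV2 ?posrE ?mulr_gt0.
Qed.

Lemma hop_poly_variance_gt0 : 0 < V.
Proof.
apply: lt_le_trans hop_poly_variance_ge.
by rewrite mulr_gt0 ?divr_gt0 ?exprn_gt0 ?mulr_gt0.
Qed.

(** Its summands come from [B1 / S], [B1 ^+ 2 / V], [B2 / V] and [4 * B3 / V] in the bound of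
    [multiaffine_stein_bound], once [V] is replaced by its lower bound [v * (lam * x ^+ 2)] and a
    factor [1 / Num.sqrt lam] is taken out. *)
Definition hop_cst (m : nat) (t kappa : R) : R :=
  let K := hop_moment_cst m t in let v := kappa ^+ 2 / t in
  (t + 1) * K / Num.sqrt v +
  ((t + 1) ^+ 2 * K ^+ 2 + (t + 1) ^+ 2 * K + 4 * ((t + 1) * K)) / v.

Variables (h f : R -> R) (m0 c : R).
Let H w := h w - m0 - w * f w.
Hypothesis c_gt0 : 0 < c.
Hypothesis hf : forall w, `|f w| <= c.
Hypothesis hf1 : forall w, `|w * f w + h w - m0| <= c.
Hypothesis hD : forall w E, 0 <= E ->
  `|f (w + E) - f w - E * (w * f w + h w - m0)| <= E * (H (w + E) - H w).
Hypothesis hH : forall w, `|H w| <= 2 * c * (1 + `|w|).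

Lemma hop_poly_stein :
  `|Ex (fun z => h ((g z - g p) / Num.sqrt V)) - m0| <=
  c * hop_cst m t kappa / Num.sqrt lam.
Proof.
have K1 := hop_moment_cst_ge1; have K0 : 0 < K by exact: lt_le_trans K1.
pose s := Num.sqrt lam; have s0 : 0 < s by rewrite sqrtr_gt0.
have sE : s ^+ 2 = lam by rewrite sqr_sqrtr// ltW.
have s1 : 1 <= s.
  by rewrite -[leLHS]sqrtr1 ler_wsqrtr.
have t1 : 0 < t + 1 by rewrite addr_gt0.
(* Sizes to be divided by [S], at least of order [s * x], and by [V], at least of order
   [s ^+ 2 * x ^+ 2]. Taking [t + 1 >= 1] instead of [t] lets its powers be raised freely. *)
pose B1 := (t + 1) * K * x; pose B2 := (t + 1) ^+ 2 * K * (s * x ^+ 2).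
pose B3 := (t + 1) * K * (s * x ^+ 2).
have B10 : 0 < B1 by rewrite !mulr_gt0.
have B20 : 0 < B2 by rewrite !mulr_gt0// exprn_gt0.
have B30 : 0 < B3 by rewrite !mulr_gt0// exprn_gt0.
pose Lam := \sum_j p j; have Lam0 : 0 <= Lam by exact: sumr_ge0.
have LamE : Lam <= t * s ^+ 2 by rewrite sE.
have KK : K <= K ^+ 2 by rewrite expr2 ler_peMl// ltW.
have x2 : 0 < x ^+ 2 by rewrite exprn_gt0.
have l1 : Lam / s ^+ 2 <= t by rewrite ler_pdivrMr// exprn_gt0.
have l0 : 0 <= Lam / s ^+ 2 by rewrite divr_ge0// exprn_ge0// ltW.
have s2 : 1 <= s ^+ 2 by rewrite sE.
set l := Lam / s ^+ 2 in l0 l1.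
have LE : Lam = l * s ^+ 2 by rewrite /l divfK// expf_neq0// gt_eqF.
have hB1 : Lam ^+ 2 * (K * x ^+ 2 / lam ^+ 2) <= B1 ^+ 2.
  have -> : Lam ^+ 2 * (K * x ^+ 2 / lam ^+ 2) = l ^+ 2 * K * x ^+ 2.
    by rewrite LE -sE; field; rewrite gt_eqF.
  have -> : B1 ^+ 2 = (t + 1) ^+ 2 * K ^+ 2 * x ^+ 2 by rewrite /B1; ring.
  rewrite ler_wpM2r ?(ltW x2)// ler_pM ?sqr_ge0 ?(ltW K0)//.
  by rewrite lerXn2r ?nnegrE ?(ltW t1)//; lra.
have hB2 : Lam ^+ 3 * (K * x ^+ 2) * (K * x ^+ 2 / lam ^+ 2) <= B2 ^+ 2.
  have -> : Lam ^+ 3 * (K * x ^+ 2) * (K * x ^+ 2 / lam ^+ 2) =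
      l ^+ 3 * (K ^+ 2 * s ^+ 2 * (x ^+ 2) ^+ 2).
    by rewrite LE -sE; field; rewrite gt_eqF.
  have -> : B2 ^+ 2 = (t + 1) ^+ 4 * (K ^+ 2 * s ^+ 2 * (x ^+ 2) ^+ 2) by rewrite /B2; ring.
  apply: ler_wpM2r; first by rewrite !mulr_ge0// ltW.
  apply: (@le_trans _ _ ((t + 1) ^+ 3)).
    by rewrite lerXn2r ?nnegrE ?(ltW t1)//; lra.
  by rewrite ler_weXn2l//; lra.
have hB3 : Lam * (K * x ^+ 2) ^+ 2 + Lam ^+ 2 * (K * x ^+ 2) * (K * x ^+ 2 / lam ^+ 2)
    <= B3 ^+ 2.
  have -> : Lam * (K * x ^+ 2) ^+ 2 + Lam ^+ 2 * (K * x ^+ 2) * (K * x ^+ 2 / lam ^+ 2) =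
      (l * s ^+ 2 + l ^+ 2) * (K ^+ 2 * (x ^+ 2) ^+ 2).
    by rewrite LE -sE; field; rewrite gt_eqF.
  have -> : B3 ^+ 2 = (t + 1) ^+ 2 * s ^+ 2 * (K ^+ 2 * (x ^+ 2) ^+ 2) by rewrite /B3; ring.
  apply: ler_wpM2r; first by rewrite !mulr_ge0// ltW.
  have lt2 : l ^+ 2 <= t ^+ 2 by rewrite lerXn2r ?nnegrE// ltW.
  have : l * s ^+ 2 <= t * s ^+ 2 by rewrite ler_wpM2r ?sqr_ge0.
  have : t ^+ 2 * 1 <= t ^+ 2 * s ^+ 2 by rewrite ler_wpM2l ?sqr_ge0.
  nra.
have V0 := hop_poly_variance_gt0.
have := multiaffine_stein_bound hEx p_ge0 (poly_growth_hop_poly R C)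
  (multiaffine_hop_poly C_inj) D_ge0 hb1 hb2 V0 c_gt0 hf hf1 hD hH B10 B20 B30 hB1 hB2 hB3.
move=> /le_trans; apply; rewrite -/V -/s -[leRHS]mulrA ler_wpM2l ?(ltW c_gt0)//.
pose v := kappa ^+ 2 / t; have v0 : 0 < v by rewrite divr_gt0// exprn_gt0.
pose w := Num.sqrt v; have w0 : 0 < w by rewrite sqrtr_gt0.
have wE : w ^+ 2 = v by rewrite sqr_sqrtr// ltW.
have vV : v * (s ^+ 2 * x ^+ 2) <= V by rewrite sE; exact: hop_poly_variance_ge.
have wS : w * (s * x) <= Num.sqrt V.
  have ws0 : 0 <= w * (s * x) by rewrite !mulr_ge0// ltW.
  rewrite -(ler_pXn2r (ltn0Sn 1)) ?nnegrE ?sqrtr_ge0//.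
  by rewrite sqr_sqrtr ?(ltW V0)// !exprMn wE.
have v1 : V^-1 <= (v * (s ^+ 2 * x ^+ 2))^-1.
  have v2 : 0 < v * (s ^+ 2 * x ^+ 2) by rewrite mulr_gt0// mulr_gt0// exprn_gt0.
  by rewrite lef_pV2 ?posrE.
have w1 : (Num.sqrt V)^-1 <= (w * (s * x))^-1.
  have w2 : 0 < w * (s * x) by rewrite mulr_gt0// mulr_gt0.
  by rewrite lef_pV2 ?posrE ?sqrtr_gt0.
have si : s^-1 <= 1 by rewrite invf_le1.
have t1' : B1 / Num.sqrt V <= (t + 1) * K / w / s.
  apply: le_trans (ler_wpM2l (ltW B10) w1) _.
  by rewrite le_eqVlt; apply/orP; left; apply/eqP; rewrite /B1; field; rewrite !gt_eqF.
(* This term is even of order [1 / lam]; the surplus factor [s^-1 <= 1] is dropped. *)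
have t2' : B1 ^+ 2 / V <= (t + 1) ^+ 2 * K ^+ 2 / v / s.
  apply: le_trans (ler_wpM2l (sqr_ge0 B1) v1) _.
  have -> : B1 ^+ 2 / (v * (s ^+ 2 * x ^+ 2)) = (t + 1) ^+ 2 * K ^+ 2 / v / s * s^-1.
    by rewrite /B1; field; rewrite !gt_eqF.
  by rewrite ler_piMr// !mulr_ge0 ?sqr_ge0 ?invr_ge0// ltW.
have t3' : B2 / V <= (t + 1) ^+ 2 * K / v / s.
  apply: le_trans (ler_wpM2l (ltW B20) v1) _.
  by rewrite le_eqVlt; apply/orP; left; apply/eqP; rewrite /B2; field; rewrite !gt_eqF.
have t4' : 4 * B3 / V <= 4 * ((t + 1) * K) / v / s.
  rewrite -mulrA; apply: le_trans (ler_wpM2l _ (ler_wpM2l (ltW B30) v1)) _ => //.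
  by rewrite le_eqVlt; apply/orP; left; apply/eqP; rewrite /B3; field; rewrite !gt_eqF.
rewrite /hop_cst -/v -/w mulrDl !mulrDl -!mulrA in t1' t2' t3' t4' *.
lra.
Qed.

End hop_poly_clt.

(** * Discretization of the hop count *)

Section gap_paths.
Variable R : realType.
Implicit Types (x y r eta delta : R) (p : seq R).

Definition gap_between (lo hi : R) : rel R := fun a b => (lo <= b - a) && (b - a <= hi).
Definition hop_gap r : rel R := fun a b => (a < b) && (b - a <= r).

(* [y] is meant to be the left endpoint of the cell of [x]. *)
Definition cell_near delta : rel R := fun y x => (y <= x) && (x < y + delta).

Lemma path_all2 (T U : Type) (near : T -> U -> bool) (e' : rel T) (e : rel U) :
  (forall a' a b' b, near a' a -> near b' b -> e' a' b' -> e a b) ->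
  forall (p' : seq T) (p : seq U) (x' : T) (x : U), near x' x -> all2 near p' p -> path e' x' p' -> path e x p.
Proof.
move=> H; elim=> [|b' p' IH] [|b p] x' x //= nx /andP[nb np] /andP[eb ep].
by rewrite (H _ _ _ _ nx nb eb) /=; exact: IH nb np ep.
Qed.

(** A fixed sequence has finitely many gaps, so a small [delta] fits into every positive gap and
    into every excess over [r]; strict and closed conditions can then be exchanged for ones with a
    margin. *)
Lemma hop_gap_stable r p x : exists2 eta : R, 0 < eta & forall delta, 0 < delta < eta ->
  (path (hop_gap r) x p -> path (gap_between (2 * delta) r) x p) /\
  (path (fun a b => (a < b) && (b - a < r + 2 * delta)) x p -> path (hop_gap r) x p).
Proof.
elim: p x => [|y p IH] x; first by exists 1.
have [eta eta0 H] := IH y.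
(* Half of the gap and half of its excess over [r]; 1 is a placeholder where the gap is not positive
   or does not exceed [r]. *)
exists (Num.min eta (Num.min (if x < y then (y - x) / 2 else 1)
                             (if r < y - x then (y - x - r) / 2 else 1))).
  rewrite !lt_min eta0 /=; apply/andP; split; case: ifP => //.
  - by move=> xy; rewrite divr_gt0// subr_gt0.
  - by move=> xy; rewrite divr_gt0// subr_gt0.
move=> delta /andP[d0]; rewrite !lt_min => /and3P[d1 d2 d3].
have [|H1 H2] := H delta; first by rewrite d0.
split=> /= /andP[/andP[g1 g2] gp].
- rewrite H1// andbT /gap_between g2 andbT; move: d2; rewrite g1; lra.
- rewrite H2// andbT /hop_gap g1 /= leNgt; apply/negP => g3.
  by move: d3; rewrite g3; lra.
Qed.

Variables (L : R) (n : nat).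
Hypothesis L_gt0 : 0 < L.

Definition mesh : R := L / n.+1%:R.

(** Half-open, so that the cells partition [[0, L)]; the nodes of a hop lie below [t < L], hence in
    some cell. *)
Definition cell (j : 'I_n.+1) : set R := `[j%:R * mesh, j.+1%:R * mesh[.

Lemma mesh_gt0 : 0 < mesh.
Proof. by rewrite divr_gt0. Qed.

Lemma in_cellE j x : (x \in cell j) = cell_near mesh (j%:R * mesh) x.
Proof.
rewrite /cell /cell_near -[j.+1%:R]natr1 mulrDl mul1r.
by apply/idP/idP; rewrite inE /= in_itv.
Qed.

Lemma cell_exists x : 0 <= x < L -> exists j, x \in cell j.
Proof.
move=> /andP[x0 xL]; have d0 := mesh_gt0.
have q0 : 0 <= x / mesh by rewrite divr_ge0// ltW.
have /andP[f1 f2] := Num.Theory.truncn_itv q0.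
have jn : (Num.truncn (x / mesh) < n.+1)%N.
  rewrite -(ltr_nat R); apply: le_lt_trans f1 _.
  by rewrite ltr_pdivrMr// /mesh mulrCA divff ?mulr1.
exists (Ordinal jn); rewrite in_cellE /cell_near /=.
move: f1 f2; rewrite ler_pdivlMr// ltr_pdivrMr// => -> /=.
by rewrite -natr1 mulrDl mul1r.
Qed.

Lemma cell_inj x i j : x \in cell i -> x \in cell j -> i = j.
Proof.
have d0 := mesh_gt0.
rewrite !in_cellE /cell_near => /andP[i1 i2] /andP[j1 j2].
have aux (a b : 'I_n.+1) : a%:R * mesh <= x -> x < b%:R * mesh + mesh -> (a <= b)%N.
  move=> h1 h2; rewrite -ltnS -(ltr_nat R) -(ltr_pM2r d0).
  by rewrite -[b.+1%:R]natr1 mulrDl mul1r; exact: le_lt_trans h1 h2.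
by apply/val_inj/eqP; rewrite eqn_leq !aux.
Qed.

Lemma trivIset_cell : trivIset [set: 'I_n.+1] cell.
Proof.
apply/trivIsetP => i j _ _ ij; apply/seteqP; split => x //= [xi xj].
by move: ij; rewrite (@cell_inj x i j) ?eqxx// inE.
Qed.

(** A test on left endpoints, with [0] and [t] kept exact. The lower bound [mesh] on the gaps forces
    distinct cells; the slack in [r + mesh] allows for the displacement of a node inside its
    cell. *)
Definition accepted (m : nat) (r t : R) : pred {ffun 'I_m -> 'I_n.+1} :=
  fun c => path (gap_between mesh (r + mesh)) 0
    (rcons [seq (c i)%:R * mesh | i <- enum 'I_m] t).

Lemma accepted_inj m r t c : @accepted m r t c -> injective c.
Proof.
move=> cC; have d0 := mesh_gt0.
pose s := [seq (c i)%:R * mesh | i <- enum 'I_m].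
have /path_sorted : path <%R 0 (rcons s t).
  apply: sub_path cC => a b /andP[+ _]; lra.
rewrite -cats1 => /cat_sorted2[ss _].
have us : uniq s by exact: lt_sorted_uniq.
have sE i : nth 0 s (nat_of_ord i) = (c i)%:R * mesh.
  by rewrite (nth_map i) ?size_enum_ord// nth_ord_enum.
have sz : size s = m by rewrite size_map size_enum_ord.
move=> i i' e; apply/val_inj/eqP.
have il : (nat_of_ord i < size s)%N by rewrite sz.
have i'l : (nat_of_ord i' < size s)%N by rewrite sz.
by have := nth_uniq 0 il i'l us; rewrite !sE e eqxx => <-.
Qed.

Section counting.
Variables (m : nat) (r t : R) (V : {fset R}).
Hypothesis tL : t < L.

Local Notation nodes x := [seq val (x i) | i <- enum 'I_m].

Lemma hop_count_ffun : hop_count m.+1 r t V =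
  #|[pred x : {ffun 'I_m -> V} | path (hop_gap r) 0 (rcons (nodes x) t)]|.
Proof.
rewrite /hop_count /= -!sum1_card.
rewrite (reindex (fun x : {ffun 'I_m -> V} => [tuple x i | i < m])) /=; last first.
  exists (fun s : m.-tuple V => [ffun i => tnth s i]) => [x|s] _.
    by apply/ffunP => i; rewrite ffunE tnth_mktuple.
  by apply: eq_from_tnth => i; rewrite tnth_mktuple ffunE.
by apply: eq_bigl => x; rewrite !inE -map_comp.
Qed.

Definition cell_count (j : 'I_n.+1) : nat := #|` [fset x in V | x \in cell j]%fset|.

Lemma cell_countE j : (cell_count j)%:R = \sum_(v : V) (val v \in cell j)%:R :> R.
Proof.
rewrite /cell_count card_fset_sum1 -big_fset_condE big_seq_fsetE/= natr_sum.
by rewrite big_mkcond; apply: eq_bigr => v _; case: ifP.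
Qed.

Lemma hop_poly_cells_sum :
  hop_poly (@accepted m r t) (fun j => (cell_count j)%:R) =
  \sum_(x : {ffun 'I_m -> V})
    \sum_(c : {ffun 'I_m -> 'I_n.+1} | accepted r t c) \prod_i (val (x i) \in cell (c i))%:R :> R.
Proof.
rewrite exchange_big/=; apply: eq_bigr => c _.
under eq_bigr do rewrite cell_countE.
by rewrite (bigA_distr_bigA (fun i v => (val v \in cell (c i))%:R)).
Qed.

Let all2_near (c : {ffun 'I_m -> 'I_n.+1}) (x : {ffun 'I_m -> V}) :
  (forall i, val (x i) \in cell (c i)) ->
  all2 (cell_near mesh) (rcons [seq (c i)%:R * mesh | i <- enum 'I_m] t)
    (rcons (nodes x) t).
Proof.
move=> h; have tt : cell_near mesh t t by rewrite /cell_near lexx ltrDl mesh_gt0.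
elim: (enum 'I_m) => [|i s IH] /=; first by rewrite tt.
by rewrite -in_cellE h.
Qed.

(** A tuple of nodes in [[0, L)] lies in exactly one tuple of cells, so the sum is the indicator
    that this one is accepted. The two margin hypotheses absorb the displacement in each
    direction. *)
Lemma sum_accepted (x : {ffun 'I_m -> V}) :
  (path (hop_gap r) 0 (rcons (nodes x) t) ->
   path (gap_between (2 * mesh) r) 0 (rcons (nodes x) t)) ->
  (path (fun a b => (a < b) && (b - a < r + 2 * mesh)) 0 (rcons (nodes x) t) ->
   path (hop_gap r) 0 (rcons (nodes x) t)) ->
  \sum_(c : {ffun 'I_m -> 'I_n.+1} | accepted r t c)
     \prod_i (val (x i) \in cell (c i))%:R =
  (path (hop_gap r) 0 (rcons (nodes x) t))%:R :> R.
Proof.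
move=> H1 H2; have d0 := mesh_gt0.
have n0 : cell_near mesh 0 0 by rewrite /cell_near lexx add0r.
have prod1 (c : {ffun 'I_m -> 'I_n.+1}) : (forall i, val (x i) \in cell (c i)) ->
    \prod_i (val (x i) \in cell (c i))%:R = 1 :> R.
  by move=> h; rewrite big1// => i _; rewrite h.
have prod0 (c : {ffun 'I_m -> 'I_n.+1}) : ~ (forall i, val (x i) \in cell (c i)) ->
    \prod_i (val (x i) \in cell (c i))%:R = 0 :> R.
  move=> /forallP; rewrite negb_forall => /existsP[i xi].
  by rewrite (bigD1 i)//= (negbTE xi) mul0r.
have [px|px] := boolP (path (hop_gap r) 0 (rcons (nodes x) t)); last first.
  apply: big1 => c cC; apply: prod0 => h; move/negP: px; apply; apply: H2.
  apply: path_all2 n0 (all2_near h) cC => a' a b' b.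
  by rewrite /cell_near /gap_between => /andP[? ?] /andP[? ?] /andP[? ?];
    apply/andP; split; lra.
have xrange i : 0 <= val (x i) < L.
  have := px => /(sub_path (_ : subrel _ <%R)) /= sp.
  have {}sp : path <%R 0 (rcons (nodes x) t) by apply: sp => a b /andP[].
  have /= E := lt_sorted_pairwise (0 :: rcons (nodes x) t).
  have {sp} := etrans (esym E) sp => /andP[/allP h0].
  rewrite pairwise_rcons => /andP[/allP h1 _].
  have xi : val (x i) \in nodes x by apply/mapP; exists i => //; rewrite mem_enum.
  rewrite ltW ?h0 ?mem_rcons ?in_cons ?xi ?orbT//=.
  by apply: lt_trans tL; exact: h1.
have /fin_all_exists[c hc] := fun i => cell_exists (xrange i).
pose c0 : {ffun 'I_m -> 'I_n.+1} := [ffun i => c i].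
have hc0 i : val (x i) \in cell (c0 i) by rewrite ffunE hc.
have c0C : accepted r t c0.
  have near_sym : all2 (fun x y => cell_near mesh y x) (rcons (nodes x) t)
     (rcons [seq (c0 i)%:R * mesh | i <- enum 'I_m] t).
    move: (all2_near hc0); move: (rcons _ _) (rcons _ _) => s1 s2.
    by elim: s1 s2 => [|a s1 IH] [|b s2]//= /andP[-> /IH].
  apply: (@path_all2 R R (fun x y => cell_near mesh y x) (gap_between (2 * mesh) r)
    _ _ _ _ 0 0 n0 near_sym (H1 px)) => a' a b' b.
  by rewrite /cell_near /gap_between => /andP[? ?] /andP[? ?] /andP[? ?];
    apply/andP; split; lra.
rewrite (bigD1 c0)//= prod1// big1 ?addr0// => c1 /andP[_ c1c0].
apply: prod0 => h; move/eqP: c1c0; apply; apply/ffunP => i.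
exact: cell_inj (h i) (hc0 i).
Qed.

End counting.

End gap_paths.

(** There are finitely many tuples of nodes, so one mesh is small enough for all of them; the
    equality is deterministic, valid for every configuration. *)
Lemma hop_poly_cells_near (R : realType) (L r t : R) (m : nat) (V : {fset R}) :
  0 < L -> t < L ->
  \forall n \near \oo, hop_poly (@accepted R L n m r t) (fun j => (cell_count L V j)%:R) =
    (hop_count m.+1 r t V)%:R :> R.
Proof.
move=> L0 tL.
have meshP eta : 0 < eta -> \forall n \near \oo, 0 < mesh L n < eta.
  move=> eta0; near=> n; rewrite mesh_gt0//=.
  rewrite /mesh ltr_pdivrMr// mulrC -ltr_pdivrMr//.
  apply: (@lt_trans _ _ n%:R); last by rewrite ltr_nat.
  by near: n; exact: nbhs_infty_gtr.
have H (x : {ffun 'I_m -> V}) : \forall n \near \oo,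
  \sum_(c : {ffun 'I_m -> 'I_n.+1} | accepted L r t c)
     \prod_i (val (x i) \in cell L (c i))%:R =
  (path (hop_gap r) 0 (rcons [seq val (x i) | i <- enum 'I_m] t))%:R :> R.
  have [eta eta0 he] := hop_gap_stable r (rcons [seq val (x i) | i <- enum 'I_m] t) 0.
  apply: filterS (meshP _ eta0) => n /he[h1 h2].
  exact: sum_accepted.
have : \forall n \near \oo, forall x : {ffun 'I_m -> V},
  \sum_(c : {ffun 'I_m -> 'I_n.+1} | accepted L r t c)
     \prod_i (val (x i) \in cell L (c i))%:R =
  (path (hop_gap r) 0 (rcons [seq val (x i) | i <- enum 'I_m] t))%:R :> R.
  exact: filter_forall.
apply: filterS => n hn.
rewrite hop_poly_cells_sum hop_count_ffun (eq_bigr _ (fun x _ => hn x)).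
rewrite -sum1_card natr_sum [RHS]big_mkcond/=; apply: eq_bigr => x _.
by rewrite inE; case: ifP.
Unshelve. all: by end_near. Qed.

(** * Lower bound for the mean hop count *)

Lemma path_arith (R : realType) (tau : R) a n :
  path (fun x y => y == x + tau) (a%:R * tau)
    (rcons [seq j.+1%:R * tau | j <- iota a n] ((a + n).+1%:R * tau)).
Proof.
have S b : b.+1%:R * tau = b%:R * tau + tau by rewrite -natr1 mulrDl mul1r.
elim: n a => [|n IH] a /=; first by rewrite addn0 S eqxx.
by rewrite S eqxx /= -S -addSnnS; exact: IH.
Qed.

Section accepted_count.
Variables (R : realType) (L r t : R) (m n : nat).
Hypothesis L_gt0 : 0 < L.
Hypothesis t_gt0 : 0 < t.
Hypothesis tL : t < L.
Let tau := t / m.+1%:R.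
Hypothesis tau_lt : tau < r.

(** Nodes moved to the right by at most [rho] from the multiples of [tau] keep gaps between
    [tau - rho >= rho] and [tau + rho <= r]. *)
Definition box_radius : R := Num.min tau (r - tau) / 2.
Local Notation rho := box_radius.

Lemma box_radius_gt0 : 0 < rho.
Proof. by rewrite divr_gt0// lt_min subr_gt0 tau_lt divr_gt0. Qed.

Local Notation delta := (mesh L n).
Hypothesis delta_le : delta <= rho.

Let d0 : 0 < delta := mesh_gt0 n L_gt0.

(** The first cell starting beyond [i.+1 * tau], whence the successor, followed by an offset [f];
    offsets below [q] stay within distance [rho]. *)
Let pos (i : nat) (f : nat) : nat := ((Num.truncn (i.+1%:R * tau / delta)).+1 + f)%N.

Let q := Num.truncn (rho / delta).

Let pos_near (i : nat) (f : 'I_q) :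
  i.+1%:R * tau <= (pos i f)%:R * delta <= i.+1%:R * tau + rho.
Proof.
have tau0 : 0 < tau by rewrite divr_gt0.
have x0 : 0 <= i.+1%:R * tau / delta by rewrite divr_ge0 ?mulr_ge0// ltW.
have r0 : 0 <= rho / delta by rewrite divr_ge0 ?ltW ?box_radius_gt0.
have /andP[h1 h2] := Num.Theory.truncn_itv x0.
have /andP[h3 _] := Num.Theory.truncn_itv r0.
rewrite /pos natrD; set b := Num.truncn _ in h1 h2 *.
move: h1 h2; rewrite ler_pdivlMr// ltr_pdivrMr// => h1 h2.
move: h3; rewrite ler_pdivlMr// -/q => h3.
have fq : f.+1%:R <= q%:R :> R by rewrite ler_nat.
have f0 : 0 <= (f : nat)%:R * delta by rewrite mulr_ge0// ltW.
have fd : f.+1%:R * delta <= q%:R * delta by rewrite ler_wpM2r// ltW.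
move: h2 fd; rewrite -!natr1 !mulrDl !mul1r => h2 fd.
by apply/andP; split; lra.
Qed.

Let pos_lt (i : 'I_m) (f : 'I_q) : (pos i f < n.+1)%N.
Proof.
have tau0 : 0 < tau by rewrite divr_gt0.
rewrite -(ltr_nat R) -(ltr_pM2r d0) [ltRHS](_ : _ = L); last first.
  by rewrite /mesh mulrC divfK.
have /andP[_ h] := pos_near i f; apply: le_lt_trans h _; apply: le_lt_trans tL.
have -> : t = m%:R * tau + tau.
  by rewrite /tau -[X in _ + X]mul1r -mulrDl natr1 mulrC divfK.
rewrite lerD//.
  by rewrite ler_wpM2r ?(ltW tau0)// ler_nat.
by rewrite /box_radius ler_pdivrMr// ge_min; apply/orP; left; lra.
Qed.

Lemma accepted_card_ge : (q ^ m <= #|@accepted R L n m r t|)%N.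
Proof.
have tau0 : 0 < tau by rewrite divr_gt0.
have rho0 := box_radius_gt0.
pose c (f : {ffun 'I_m -> 'I_q}) : {ffun 'I_m -> 'I_n.+1} :=
  [ffun i => Ordinal (pos_lt i (f i))].
have c_inj : injective c.
  move=> f f' /ffunP e; apply/ffunP => i; have := e i; rewrite !ffunE => /(congr1 val) /=.
  by rewrite /pos => /addnI /val_inj.
have -> : (q ^ m)%N = #|{ffun 'I_m -> 'I_q}| by rewrite card_ffun !card_ord.
rewrite -(card_codom c_inj); apply: subset_leq_card; apply/fintype.subsetP => _ /codomP[f ->].
rewrite unfold_in /accepted.
have e' := path_arith tau 0 m; rewrite mul0r add0n in e'.
have te : m.+1%:R * tau = t by rewrite /tau mulrC divfK.
rewrite te in e'.
pose near (x y : R) := (x <= y) && (y <= x + rho).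
have n0 : near 0 0 by rewrite /near lexx add0r ltW.
have nn : all2 near (rcons [seq j.+1%:R * tau | j <- iota 0 m] t)
    (rcons [seq (c f i)%:R * delta | i <- enum 'I_m] t).
  have tt : near t t by rewrite /near lexx lerDl ltW.
  rewrite -val_enum_ord -map_comp.
  elim: (enum 'I_m) => [|i s IH] /=; first by rewrite tt.
  by rewrite ffunE /near pos_near.
have rho1 : 2 * rho <= tau.
  by rewrite /box_radius mulrC divfK// ge_min lexx.
have rho2 : 2 * rho <= r - tau.
  by rewrite /box_radius mulrC divfK// ge_min lexx orbT.
apply: (@path_all2 R R near (fun x y => y == x + tau) _ _ _ _ 0 0 n0 nn e') => a' a b' b.
rewrite /near /gap_between => /andP[a1 a2] /andP[b1 b2] /eqP b'E.
have h3 : b' <= a' + tau by rewrite b'E.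
have h4 : a' + tau <= b' by rewrite b'E.
move: d0 delta_le rho0 rho1 rho2 h3 h4 a1 a2 b1 b2.
move: (mesh L n) box_radius tau => de rh ta; clear.
move=> *; apply/andP; split; lra.
Qed.

(** There are at least [q ^ m] accepted tuples of weight [(lam * delta) ^+ m], and
    [q * delta >= rho - delta >= rho / 2]. *)
Lemma hop_poly_accepted_ge (lam : R) : 0 < lam -> 2 * delta <= rho ->
  (rho / 2) ^+ m * lam ^+ m <=
  hop_poly (@accepted R L n m r t) (fun=> lam * delta).
Proof.
move=> lam0 d2; have rho0 := box_radius_gt0.
rewrite hop_poly_cst; apply: (@le_trans _ _ ((q ^ m)%:R * (lam * delta) ^+ m)).
  have n1 : 0 <= rho / 2 * lam by rewrite mulr_ge0 ?(ltW lam0)// divr_ge0// ltW.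
  have n2 : 0 <= q%:R * (lam * delta) by rewrite mulr_ge0// mulr_ge0// ltW.
  rewrite natrX -!exprMn lerXn2r ?nnegrE//.
  have r0 : 0 <= rho / delta by rewrite divr_ge0 ?ltW.
  have /andP[_] := Num.Theory.truncn_itv r0; rewrite -/q ltr_pdivrMr// => h.
  move: h; rewrite -natr1 mulrDl mul1r => h.
  rewrite mulrCA [leLHS]mulrC ler_wpM2l ?(ltW lam0)//; lra.
apply: ler_wpM2r; last by rewrite ler_nat accepted_card_ge.
by rewrite exprn_ge0// mulr_ge0// ltW.
Qed.

End accepted_count.

(** * Cell counts and total count of the Poisson process *)

Lemma hop_poly_le (R : realType) (J : finType) (m : nat) (C : pred {ffun 'I_m -> J})
    (z : J -> R) : (forall j, 0 <= z j) -> hop_poly C z <= (\sum_j z j) ^+ m.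
Proof.
move=> z0; rewrite -[X in _ ^+ X]card_ord -prodr_const.
rewrite (bigA_distr_bigA (fun _ j => z j)) /hop_poly [leRHS](bigID C)/= lerDl.
by apply: sumr_ge0 => c _; exact: prodr_ge0.
Qed.

Section process.
Context (R : realType) (d : measure_display) (T : measurableType d).
Variables (P : probability T R) (L lam : R) (X : T -> {fset R}).
Hypothesis L_gt0 : 0 < L.
Hypothesis lam_gt0 : 0 < lam.
Hypothesis hP : poisson_process P `[0, L] lam X.

Section counts.
Variables (n : nat) (B : 'I_n -> set R) (b : 'I_n -> R).
Hypothesis mB : forall i, measurable (B i).
Hypothesis BD : forall i, B i `<=` `[0, L].
Hypothesis tB : trivIset [set: 'I_n] B.
Hypothesis b_gt0 : forall i, 0 < b i.
Hypothesis lebB : forall i, lebesgue_measure (B i) = (b i)%:E.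

Lemma measurable_count i a : measurable (npoints X (B i) @^-1` [set a]).
Proof.
have [_ + _ _] := hP; move=> /(_ _ (mB i) (@BD i)) h.
by rewrite -[_ @^-1` _]setTI; exact: h.
Qed.

Lemma joint_counts (a : 'I_n -> nat) :
  P (\bigcap_(i in [set: 'I_n]) npoints X (B i) @^-1` [set a i]) =
  (\prod_i poisson_pmf (lam * b i) (a i))%:E.
Proof.
have [_ _ cnt ind] := hP.
have := ind n B mB BD tB (fun i => [set a i]) (fun i => I).
move=> ->; rewrite -prodEFin; apply: eq_bigr => i _.
rewrite cnt// lebB /= /poisson_prob mulr_gt0// esum_set1// lee_fin.
exact: poisson_pmf_ge0.
Qed.

Lemma counts_gt0 i : 0 < lam * b i. Proof. exact: mulr_gt0. Qed.

Lemma counts_expectation : poisson_expectation (fun i => lam * b i)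
  (fun phi => \int[P]_w phi (fun i => (npoints X (B i) w)%:R)).
Proof.
exact: (poisson_expectation_Rintegral counts_gt0 measurable_count joint_counts).
Qed.

Lemma counts_integrable (phi : ('I_n -> R) -> R) : poly_growth phi ->
  P.-integrable [set: T] (fun w => (phi (fun i => (npoints X (B i) w)%:R))%:E).
Proof.
exact: (integrable_poly_growth counts_gt0 measurable_count joint_counts).
Qed.

End counts.

Lemma cell_subset n (j : 'I_n.+1) : cell L j `<=` `[0, L].
Proof.
move=> x; rewrite /cell /= !in_itv/= => /andP[x0 x1]; have d0 := mesh_gt0 n L_gt0.
apply/andP; split; first by apply: le_trans x0; rewrite mulr_ge0// ltW.
apply: ltW; apply: lt_le_trans x1 _; apply: (@le_trans _ _ (n.+1%:R * mesh L n)).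
  by rewrite ler_wpM2r ?(ltW d0)// ler_nat.
by rewrite /mesh mulrC divfK.
Qed.

Lemma cell_measure n (j : 'I_n.+1) : lebesgue_measure (cell L j) = (mesh L n)%:E.
Proof.
have d0 := mesh_gt0 n L_gt0.
rewrite lebesgue_measure_itv/= lte_fin -[j.+1%:R]natr1 mulrDl mul1r ltrDl d0.
by rewrite -EFinB addrAC subrr add0r.
Qed.

Definition total_count (w : T) : R := (npoints X `[0, L] w)%:R.

Lemma total_integrable (f : R -> R) : (exists C (q : nat), forall x, `|f x| <= C * (1 + `|x|) ^+ q) ->
  P.-integrable [set: T] (fun w => (f (total_count w))%:E).
Proof.
move=> [C [q fC]].
(* The whole interval is treated as a partition into a single cell, so that the integrability result
   for count vectors applies. *)
have tB : trivIset [set: 'I_1] (fun _ : 'I_1 => `[0, L]%classic : set R).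
  by move=> i j _ _ _; rewrite !ord1.
have lebB (i : 'I_1) : lebesgue_measure (`[0, L]%classic : set R) = L%:E.
  by rewrite lebesgue_measure_itv/= lte_fin L_gt0 -EFinB subr0.
have pf : poly_growth (fun z : 'I_1 -> R => f (z ord0)).
  by exists C, q => z; rewrite big_ord1.
pose B (_ : 'I_1) : set R := `[0, L]%classic.
have mB i : measurable (B i) by exact: measurable_itv.
have BD i : B i `<=` `[0, L] by [].
exact: (counts_integrable mB BD tB (fun=> L_gt0) lebB pf).
Qed.

Lemma cell_counts_le n w : \sum_(j < n.+1) (npoints X (cell L j) w)%:R <= total_count w.
Proof.
have [inD _ _ _] := hP.
rewrite (eq_bigr (fun j => (cell_count L (X w) j)%:R))//.
under eq_bigr do rewrite cell_countE.
rewrite exchange_big/= /total_count /npoints card_fset_sum1 -big_fset_condE.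
rewrite big_seq_fsetE/= natr_sum [leRHS]big_mkcond/=; apply: ler_sum => v _.
have -> : val v \in `[0, L]%classic by rewrite inE; apply: inD (fsvalP v).
have [[j vj]|noj] := pselect (exists j : 'I_n.+1, val v \in cell L j).
  rewrite (bigD1 j)//= vj big1 ?addr0// => i ij.
  case: (boolP (val v \in cell L i)) => // vi; move/eqP: ij; case.
  exact: (cell_inj L_gt0 vi vj).
rewrite big1// => j _; case: (boolP (val v \in cell L j)) => // vj.
by case: noj; exists j.
Qed.

End process.

Lemma cvg_le_cst (R : realType) (u : R^nat) (l b : R) :
  u n @[n --> \oo] --> l -> (forall n, u n <= b) -> l <= b.
Proof.
move=> ul ub; rewrite -(cvg_lim _ ul)//; apply: limr_le; first by apply/cvg_ex; exists l.
exact: nearW.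
Qed.

(** * Refining the cells *)

Section hop_limit.
Variables (R : realType) (r t : R) (m : nat).
Hypothesis r_gt0 : 0 < r.
Hypothesis m_gt0 : (0 < m)%N.
Let L := m.+1%:R * r.
Hypothesis t_gt0 : 0 < t.
Hypothesis tL : t < L.

Let tau_lt : t / m.+1%:R < r.
Proof. by rewrite ltr_pdivrMr// mulrC. Qed.

Definition hop_kappa : R := (box_radius r t m / 2) ^+ m.

Let L_gt0 : 0 < L. Proof. exact: lt_trans tL. Qed.

Let rho_gt0 : 0 < box_radius r t m. Proof. exact: box_radius_gt0. Qed.

Let kappa_gt0 : 0 < hop_kappa. Proof. by rewrite exprn_gt0// divr_gt0. Qed.

(** Shifting the index by [N0] makes the lower bound on the mean, and so on the variance, hold for
    every [n] and not only eventually. *)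
Let mesh_small : exists N0, forall n, 2 * mesh L (n + N0) <= box_radius r t m.
Proof.
have : \forall n \near \oo, 2 * L / box_radius r t m < n%:R.
  exact: nbhs_infty_gtr.
case=> N0 _ H; exists N0 => n; have /ltW := H (n + N0).+1 (leq_trans (leq_addl n N0) (leqnSn _)).
by rewrite ler_pdivrMr// => h; rewrite /mesh mulrA ler_pdivrMr// [leRHS]mulrC.
Qed.

Context (d : measure_display) (T : measurableType d).
Variables (P : probability T R) (lam : R) (X : T -> {fset R}).
Hypothesis lam_gt1 : 1 < lam.
Hypothesis hP : poisson_process P `[0, L] lam X.

Let lam_gt0 : 0 < lam. Proof. exact: lt_trans lam_gt1. Qed.

Let sigma w : R := (hop_count m.+1 r t (X w))%:R.
Let mu := \int[P]_w sigma w.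
Let V := \int[P]_w (sigma w - mu) ^+ 2.

Let N0 := sval (cid mesh_small).
Let mesh_N0 n : 2 * mesh L (n + N0) <= box_radius r t m := svalP (cid mesh_small) n.

Let C n := @accepted R L (n + N0) m r t.
Let Z n w (j : 'I_(n + N0).+1) : R := (npoints X (cell L j) w)%:R.
Let g n w := hop_poly (@C n) (@Z n w).
Let p n (_ : 'I_(n + N0).+1) := lam * mesh L (n + N0).
Let Ex n (phi : ('I_(n + N0).+1 -> R) -> R) := \int[P]_w phi (@Z n w).

Let hEx n : poisson_expectation (@p n) (@Ex n).
Proof.
apply: (@counts_expectation _ _ _ _ L lam X lam_gt0 hP _ (fun j => cell L j)
  (fun=> mesh L (n + N0))).
- by move=> i; exact: measurable_itv.
- by move=> i; exact: cell_subset.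
- exact: trivIset_cell.
- by move=> i; exact: mesh_gt0.
- by move=> i; exact: cell_measure.
Qed.

Let Z_integrable n (phi : ('I_(n + N0).+1 -> R) -> R) : poly_growth phi ->
  P.-integrable [set: T] (fun w => (phi (@Z n w))%:E).
Proof.
apply: (@counts_integrable _ _ _ _ L lam X lam_gt0 hP _ (fun j => cell L j)
  (fun=> mesh L (n + N0))).
- by move=> i; exact: measurable_itv.
- by move=> i; exact: cell_subset.
- exact: trivIset_cell.
- by move=> i; exact: mesh_gt0.
- by move=> i; exact: cell_measure.
Qed.

Let p_ge0 n j : 0 <= @p n j.
Proof. by rewrite mulr_ge0// ltW// mesh_gt0. Qed.

Let p_sum n : \sum_j @p n j <= L * lam.
Proof.
rewrite /p sumr_const card_ord -[_ *+ _]mulr_natl mulrCA mulrC ler_wpM2r ?(ltW lam_gt0)//.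
by rewrite /mesh mulrC divfK.
Qed.

Let g_mean n : hop_kappa * lam ^+ m <= hop_poly (@C n) (@p n).
Proof.
apply: hop_poly_accepted_ge => //.
apply: le_trans (mesh_N0 n); rewrite ler_peMl ?ler1n// ltW// mesh_gt0//.
Qed.

Let C_inj n c : @C n c -> injective c.
Proof. exact: accepted_inj. Qed.

Let total w := total_count L X w.

Let total_ge0 w : 0 <= total w. Proof. by rewrite /total /total_count. Qed.

Let g_ge0 n w : 0 <= g n w. Proof. exact: hop_poly_ge0. Qed.

Let g_le n w : g n w <= total w ^+ m.
Proof.
apply: le_trans (hop_poly_le _ _) _ => //.
rewrite lerXn2r ?nnegrE ?sumr_ge0//; exact: cell_counts_le hP _ _.
Qed.

Let g_near w : \forall n \near \oo, g n w = sigma w.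
Proof.
have [N _ HN] := hop_poly_cells_near r m (X w) L_gt0 tL.
exists N => // n /= Nn; apply: (HN (n + N0)%N).
by rewrite /= (leq_trans Nn) ?leq_addr.
Qed.

Let g_cvg w : g n w @[n --> \oo] --> sigma w.
Proof. exact: cvg_near_cst (g_near w). Qed.

Let sigma_le w : sigma w <= total w ^+ m.
Proof. by apply: (@cvg_le_cst _ (fun n => g n w)) => [|n]; [exact: g_cvg|exact: g_le]. Qed.

Let measurable_g n : measurable_fun [set: T] (g n).
Proof.
apply/measurable_EFinP; apply: measurable_int.
exact: (Z_integrable (poly_growth_hop_poly R (@C n))).
Qed.

(** Only counts are measurable by assumption; the hop count inherits measurability as a pointwise
    limit of polynomials in counts. *)
Lemma measurable_hop_count : measurable_fun [set: T] sigma.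
Proof.
apply/measurable_EFinP.
apply: (@emeasurable_fun_cvg _ _ _ _ (fun n => EFin \o g n)) => [n|w _].
  by apply/measurable_EFinP.
by apply: cvg_EFin; [exact: nearW|exact: g_cvg].
Qed.

Let pow_integrable (a b : R) q : P.-integrable [set: T]
  (fun w => (a * (total w ^+ m + b) ^+ q)%:E).
Proof.
apply: (@total_integrable _ _ _ P L lam X L_gt0 lam_gt0 hP (fun x => a * (x ^+ m + b) ^+ q)).
exists (`|a| * (1 + `|b|) ^+ q), (m * q)%N => x.
rewrite normrM -mulrA ler_wpM2l// normrX exprM -exprMn lerXn2r ?nnegrE ?mulr_ge0 ?exprn_ge0 ?addr_ge0//.
apply: le_trans (ler_normD _ _) _; rewrite normrX mulrDl mul1r lerD//.
  by rewrite lerXn2r ?nnegrE ?addr_ge0// lerDr.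
by rewrite ler_peMr// exprn_ege1// lerDl.
Qed.

Let mean n := hop_poly (@C n) (@p n).

Let meanE n : \int[P]_w g n w = mean n.
Proof.
exact: (Ex_multiaffine (hEx n) (poly_growth_hop_poly R (@C n)) (multiaffine_hop_poly (@C_inj n))).
Qed.

Let mean_cvg : mean n @[n --> \oo] --> mu.
Proof.
under eq_fun do rewrite -meanE.
apply: (@Rintegral_dominated_cvg _ _ _ P g sigma (fun w => 1 * (total w ^+ m + 0) ^+ 1)) => //.
- by have := pow_integrable 1 0 1.
- by move=> n w; rewrite mul1r expr1 addr0 ger0_norm.
Qed.

Let M := \int[P]_w (1 * (total w ^+ m + 0) ^+ 1).

Let mean_le n : 0 <= mean n <= M.
Proof.
rewrite -meanE Rintegral_ge0//=; apply: le_Rintegral => //.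
- exact: (Z_integrable (poly_growth_hop_poly R (@C n))).
- by have := pow_integrable 1 0 1.
- by move=> w _; rewrite mul1r expr1 addr0.
Qed.

Let M_ge0 : 0 <= M. Proof. by have /andP[h /(le_trans h)] := mean_le 0. Qed.

Let dev_le n w : `|g n w - mean n| <= total w ^+ m + M.
Proof.
have /andP[m0 m1] := mean_le n; rewrite ler_norml.
have := g_le n w; have := g_ge0 n w; have : 0 <= total w ^+ m by rewrite exprn_ge0.
by move=> *; apply/andP; split; lra.
Qed.

Let Var n := \int[P]_w (g n w - mean n) ^+ 2.

Let dev_cvg w : g n w - mean n @[n --> \oo] --> sigma w - mu.
Proof. by apply: cvgB; [exact: g_cvg|exact: mean_cvg]. Qed.

Let Var_cvg : Var n @[n --> \oo] --> V.
Proof.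
apply: (@Rintegral_dominated_cvg _ _ _ P (fun n w => (g n w - mean n) ^+ 2)
  (fun w => (sigma w - mu) ^+ 2) (fun w => 1 * (total w ^+ m + M) ^+ 2)) => //.
- move=> n; apply: measurable_funX; apply: measurable_funB => //.
- by move=> w; under eq_fun do rewrite expr2; rewrite expr2; apply: cvgM; exact: dev_cvg.
- exact: pow_integrable.
- move=> n w; rewrite mul1r normrX lerXn2r ?nnegrE//.
  by rewrite addr_ge0// exprn_ge0.
Qed.

Let v0 := hop_kappa ^+ 2 / L * (lam * (lam ^+ m.-1) ^+ 2).

Let v0_gt0 : 0 < v0.
Proof.
apply: mulr_gt0; first by apply: divr_gt0 => //; exact: exprn_gt0.
by apply: mulr_gt0 => //; do 2 apply: exprn_gt0.
Qed.

Let Var_ge n : v0 <= Var n.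
Proof.
exact: (hop_poly_variance_ge (@C_inj n) (hEx n) (@p_ge0 n) m_gt0 L_gt0 kappa_gt0
  (ltW lam_gt1) (p_sum n) (g_mean n)).
Qed.

(** The lower bound [v0] does not depend on [n], so it passes to the limit of the variances. *)
Lemma hop_count_variance_gt0 : 0 < V.
Proof.
apply: lt_le_trans v0_gt0 _; rewrite -lerN2.
apply: (@cvg_le_cst _ (fun n => - Var n)) => [|n]; last by rewrite lerN2.
by apply: cvgN; exact: Var_cvg.
Qed.

Let F w := (sigma w - mu) / Num.sqrt V.

Lemma measurable_normalized_hop_count : measurable_fun [set: T] F.
Proof.
apply: measurable_funM => //; apply: measurable_funB => //.
exact: measurable_hop_count.
Qed.

Variable h : R -> R.
Hypothesis h_cont : continuous h.
Hypothesis h_homo : {homo h : x y / x <= y}.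
Hypothesis h_growth : forall x y, x <= y -> h y - h x <= 1 + (y - x).

Let Fn n w := (g n w - mean n) / Num.sqrt (Var n).

Let Fn_cvg w : Fn n w @[n --> \oo] --> F w.
Proof.
apply: cvgM; first exact: dev_cvg.
apply: cvgV; first by rewrite gt_eqF// sqrtr_gt0 hop_count_variance_gt0.
by apply: continuous_cvg Var_cvg; exact: sqrt_continuous.
Qed.

(** The common lower bound on the variances makes a single integrable function dominate all
    normalizations. *)
Let Fn_le n w : `|Fn n w| <= (total w ^+ m + M) / Num.sqrt v0.
Proof.
rewrite normrM ler_pM ?dev_le// normfV ger0_norm ?sqrtr_ge0//.
by rewrite lef_pV2 ?posrE ?sqrtr_gt0 ?ler_wsqrtr// (lt_le_trans v0_gt0).
Qed.

Let hFn_cvg : \int[P]_w h (Fn n w) @[n --> \oo] --> \int[P]_w h (F w).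
Proof.
pose c := `|h 0| + 1.
apply: (@Rintegral_dominated_cvg _ _ _ P (fun n w => h (Fn n w)) (fun w => h (F w))
  (fun w => (c / Num.sqrt v0) * (total w ^+ m + (M + Num.sqrt v0)) ^+ 1)).
- move=> n; apply: (@measurableT_comp _ _ _ _ _ _ h).
    exact: continuous_measurable_fun.
  by apply: measurable_funM => //; exact: measurable_funB.
- by move=> w; apply: continuous_cvg; [exact: h_cont|exact: Fn_cvg].
- exact: pow_integrable.
- move=> n w; apply: le_trans (stein_class_growth h_homo h_growth _) _.
  have s0 : 0 < Num.sqrt v0 by rewrite sqrtr_gt0.
  have -> : c / Num.sqrt v0 * (total w ^+ m + (M + Num.sqrt v0)) ^+ 1 =
      c * (1 + (total w ^+ m + M) / Num.sqrt v0) by field; rewrite gt_eqF.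
  by rewrite ler_wpM2l ?addr_ge0// lerD2l.
Qed.

Lemma hop_count_stein :
  `|\int[P]_w h (F w) - normal_mean h| <=
  stein_cst R * hop_cst m L hop_kappa / Num.sqrt lam.
Proof.
have [f [f1 f2 f3 f4]] := stein_solution h_cont h_homo h_growth.
apply: (@cvg_le_cst _ (fun n => `|\int[P]_w h (Fn n w) - normal_mean h|)).
  by apply: cvg_norm; apply: cvgB; [exact: hFn_cvg|exact: cvg_cst].
move=> n.
exact: (hop_poly_stein (@C_inj n) (hEx n) (@p_ge0 n) m_gt0 L_gt0 kappa_gt0
  (ltW lam_gt1) (p_sum n) (g_mean n) (stein_cst_gt0 R) f1 f2 f3 f4).
Qed.

Lemma integrable_stein_class : P.-integrable [set: T] (fun w => (h (F w))%:E).
Proof.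
pose c := `|h 0| + 1; have V0 := hop_count_variance_gt0.
have s0 : 0 < Num.sqrt V by rewrite sqrtr_gt0.
apply: (@le_integrable _ _ _ P _ measurableT _
  (fun w => ((c / Num.sqrt V) * (total w ^+ m + (`|mu| + Num.sqrt V)) ^+ 1)%:E)) => //.
- apply/measurable_EFinP; apply: (@measurableT_comp _ _ _ _ _ _ h).
    exact: continuous_measurable_fun.
  exact: measurable_normalized_hop_count.
- move=> w _; rewrite lee_fin; apply: le_trans (stein_class_growth h_homo h_growth _) _.
  have tm : 0 <= total w ^+ m by rewrite exprn_ge0.
  rewrite [leRHS]ger0_norm; last first.
    by rewrite mulr_ge0 ?divr_ge0 ?addr_ge0 ?exprn_ge0 ?addr_ge0// ltW.
  have -> : c / Num.sqrt V * (total w ^+ m + (`|mu| + Num.sqrt V)) ^+ 1 =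
      c * (1 + (total w ^+ m + `|mu|) / Num.sqrt V) by field; rewrite gt_eqF.
  rewrite ler_wpM2l ?addr_ge0// lerD2l.
  rewrite normrM normfV (gtr0_norm s0) ler_wpM2r ?invr_ge0 ?(ltW s0)//.
  apply: le_trans (ler_normB _ _) _; rewrite lerD2r ger0_norm//.
Qed.

End hop_limit.

(** * The standard normal law *)

(** The Radon-Nikodym derivative of the normal law and the Gaussian density have the same integral
    over every measurable set, so they agree almost everywhere. *)
Lemma integral_normal_prob_ge0 (R : realType) (f : R -> \bar R) :
  (forall x, 0 <= f x)%E -> measurable_fun [set: R] f ->
  (\int[normal_prob 0 1]_x f x =
   \int[lebesgue_measure]_x (f x * (normal_pdf 0 1 x)%:E))%E.
Proof.
move=> f0 mf; pose leb := @lebesgue_measure R.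
have dom := @normal_prob_dominates R 0 1.
rewrite -(Radon_Nikodym_SigmaFinite.change_of_variables dom f0 measurableT mf).
have mp : measurable_fun [set: R] (EFin \o (@normal_pdf R 0 1)).
  by apply/measurable_EFinP; exact: measurable_normal_pdf.
have ri := Radon_Nikodym_SigmaFinite.f_integrable dom.
apply: ae_eq_integral => //.
- by apply: emeasurable_funM => //; exact: measurable_int ri.
- exact: emeasurable_funM.
- apply: ae_eqe_mul2l; apply: integral_ae_eq => //.
  by move=> E _ mE; rewrite -Radon_Nikodym_SigmaFinite.f_integral.
Qed.

Section standard_normal_law.
Context (R : realType) (d : measure_display) (U : measurableType d).
Variables (Q : probability U R) (Z : {RV Q >-> R}).
Hypothesis hZ : standard_normal Z.

Lemma integral_standard_normal_ge0 (f : R -> R) : (forall x, 0 <= f x) ->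
  measurable_fun [set: R] f ->
  (\int[Q]_w (f (Z w))%:E = \int[lebesgue_measure]_x (f x * normal_pdf 0 1 x)%:E)%E.
Proof.
move=> f0 mf.
have mf' : measurable_fun [set: measurableTypeR R] (EFin \o f).
  by apply/measurable_EFinP.
have mZ : measurable_fun [set: U] (Z : U -> measurableTypeR R).
  exact: (measurable_funP Z).
have f0' : {in [set: measurableTypeR R], forall y, (0 <= (EFin \o f) y)%E}.
  by move=> y _; rewrite lee_fin.
have := ge0_integral_pushforward mZ Q measurableT mf' f0'.
rewrite preimage_setT /= => <-.
transitivity (\int[normal_prob 0 1]_x (f x)%:E)%E.
  by apply: eq_measure_integral => A mA _; exact: hZ.
by rewrite integral_normal_prob_ge0.
Qed.

Lemma standard_normal_mean (h : R -> R) : measurable_fun [set: R] h ->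
  lebesgue_measure.-integrable [set: R] (fun x => (h x * normal_pdf 0 1 x)%:E) ->
  Q.-integrable [set: U] (fun w => (h (Z w))%:E) /\ \int[Q]_w h (Z w) = normal_mean h.
Proof.
move=> mh ih; pose a x := `|h x|; pose b x := `|h x| + h x.
have a0 x : 0 <= a x by exact: normr_ge0.
have b0 x : 0 <= b x by rewrite -lerBlDr sub0r -normrN ler_norm.
have ma : measurable_fun [set: R] a by exact: measurableT_comp.
have mb : measurable_fun [set: R] b by exact: measurable_funD.
have ia : lebesgue_measure.-integrable [set: R] (fun x => (a x * normal_pdf 0 1 x)%:E).
  apply: eq_integrable (integrable_abse ih) => // x _ /=.
  by rewrite normrM (ger0_norm (normal_pdf_ge0 _ _ _)).
have ib : lebesgue_measure.-integrable [set: R] (fun x => (b x * normal_pdf 0 1 x)%:E).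
  apply: eq_integrable (integrableD measurableT ia ih) => // x _ /=.
  by rewrite -EFinD -mulrDl.
have mZ : measurable_fun [set: U] Z by [].
have tr (f : R -> R) : (forall x, 0 <= f x) -> measurable_fun [set: R] f ->
    lebesgue_measure.-integrable [set: R] (fun x => (f x * normal_pdf 0 1 x)%:E) ->
    Q.-integrable [set: U] (fun w => (f (Z w))%:E).
  move=> f0 mf ifp; apply/integrableP; split.
    by apply/measurable_EFinP; exact: measurableT_comp mf mZ.
  under eq_integral do rewrite gee0_abs ?lee_fin//.
  rewrite integral_standard_normal_ge0// -ge0_fin_numE; last first.
    by apply: integral_ge0 => x _; rewrite lee_fin mulr_ge0 ?normal_pdf_ge0.
  exact: integrable_fin_num.
have qa := tr a a0 ma ia; have qb := tr b b0 mb ib.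
have hE : h = fun x => b x - a x by apply/funext => x; rewrite /b /a addrAC subrr add0r.
split.
  apply: eq_integrable (integrableB measurableT qb qa) => // w _ /=.
  by rewrite -EFinB hE.
rewrite /normal_mean {1}hE RintegralB//.
have -> : \int[lebesgue_measure]_x (h x * normal_pdf 0 1 x) =
  \int[lebesgue_measure]_x (b x * normal_pdf 0 1 x - a x * normal_pdf 0 1 x).
  by congr Rintegral; apply/funext => x; rewrite -mulrBl {1}hE.
rewrite RintegralB//; congr (_ - _); rewrite /Rintegral;
  by rewrite integral_standard_normal_ge0.
Qed.

Lemma standard_normal_interval_le (x e : R) : 0 <= e ->
  (Q [set w | x < Z w <= x + e]%R <= e%:E)%E.
Proof.
move=> e0.
have -> : [set w | x < Z w <= x + e]%R = Z @^-1` `]x, x + e].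
  by apply/seteqP; split => w /=; rewrite in_itv.
have := hZ (measurable_itv `]x, x + e]); rewrite /distribution /pushforward /= => ->.
rewrite /normal_prob.
apply: (@le_trans _ _ (\int[lebesgue_measure]_(y in `]x, (x + e)%R]) (cst 1 y))%E).
  apply: ge0_le_integral => //.
  - by move=> y _; rewrite lee_fin normal_pdf_ge0.
  - by apply/measurable_EFinP; apply: measurable_funTS; exact: measurable_normal_pdf.
  - move=> y _; rewrite lee_fin; apply: le_trans (normal_pdf_ub _ _ (oner_neq0 R)) _.
    (* The density is at most its peak [1 / sqrt (2 pi)], which is below 1 because [pi >= 2]. *)
    rewrite /normal_peak invf_le1 ?sqrtr_gt0 ?pmulrn_lgt0 ?mulr_gt0 ?pi_gt0 ?exprn_gt0//.
    rewrite -[leLHS]sqrtr1 ler_wsqrtr// expr1n mul1r -mulr_natr.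
    by have := pi_ge2 R; lra.
rewrite integral_cst// mul1e.
suff : (lebesgue_measure (`]x, (x + e)%R]%classic : set R) <= e%:E)%E by [].
rewrite lebesgue_measure_itv/= lte_fin; case: ifPn => [_|_]; last by rewrite lee_fin.
by rewrite -EFinB addrAC subrr add0r.
Qed.

End standard_normal_law.

(** * Ramp functions as continuous substitutes for indicators *)

Section ramp.
Variable R : realType.

Definition ramp (x e y : R) : R := Num.min (Num.max ((y - x) / e) 0) 1.

Lemma ramp_continuous x e : continuous (ramp x e).
Proof.
have c1 : continuous (fun y => (y - x) / e).
  by move=> z; apply: cvgMr_tmp; apply: cvgB; [exact: cvg_id|exact: cvg_cst].
have c0 (a : R) : continuous (fun _ : R => a) by move=> z; exact: cvg_cst.
have c2 : continuous ((fun y => (y - x) / e) \max (fun=> 0)).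
  by move=> z; apply: continuous_max; [exact: c1|exact: c0].
have c3 : continuous (((fun y => (y - x) / e) \max (fun=> 0)) \min (fun=> 1)).
  by move=> z; apply: continuous_min; [exact: c2|exact: c0].
exact: c3.
Qed.

Lemma ramp_ge0 x e y : 0 <= ramp x e y.
Proof. by rewrite /ramp le_min le_max lexx orbT ler01. Qed.

Lemma ramp_le1 x e y : ramp x e y <= 1.
Proof. by rewrite /ramp ge_min lexx orbT. Qed.

Lemma ramp_homo x e : 0 < e -> {homo ramp x e : y z / y <= z}.
Proof.
move=> e0 y z yz; rewrite /ramp; apply: le_min2 => //; apply: le_max2 => //.
by rewrite ler_pM2r ?invr_gt0// lerD2r.
Qed.

(** The total increase of a ramp is at most 1 whatever its slope; this is why the class allows the
    constant 1 in addition to Lipschitz growth. *)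
Lemma ramp_growth x e y z : y <= z -> ramp x e z - ramp x e y <= 1 + (z - y).
Proof.
move=> yz; have := ramp_ge0 x e y; have := ramp_le1 x e z; lra.
Qed.

Lemma ramp_left x e y : 0 < e -> y <= x -> ramp x e y = 0.
Proof.
move=> e0 yx; rewrite /ramp max_r ?min_l//.
by rewrite ler_pdivrMr// mul0r subr_le0.
Qed.

Lemma ramp_right x e y : 0 < e -> x + e <= y -> ramp x e y = 1.
Proof.
move=> e0 xy; rewrite /ramp min_r// le_max; apply/orP; left.
by rewrite ler_pdivlMr// mul1r lerBrDl.
Qed.

Context (d : measure_display) (T : measurableType d) (P : probability T R).
Variable Y : T -> R.
Hypothesis mY : measurable_fun [set: T] Y.

Let mle x : measurable [set w | Y w <= x].
Proof.
rewrite (_ : [set w | Y w <= x] = Y @^-1` `]-oo, x]).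
  by rewrite -[_ @^-1` _]setTI; exact: mY.
by apply/seteqP; split => w /=; rewrite in_itv.
Qed.

Let indE x : P [set w | Y w <= x] = (\int[P]_w (\1_[set w | Y w <= x] w)%:E)%E.
Proof. by rewrite integral_indic// setIT. Qed.

Let iramp x e : P.-integrable [set: T] (fun w => (1 - ramp x e (Y w))%:E).
Proof.
apply: (@le_integrable _ _ _ P _ measurableT _ (fun=> 1%:E)) => //.
- apply/measurable_EFinP; apply: measurable_funB => //.
  apply: (@measurableT_comp _ _ _ _ _ _ (ramp x e)) => //.
  by apply: continuous_measurable_fun; exact: ramp_continuous.
- move=> w _; rewrite lee_fin normr1 ger0_norm; have := ramp_ge0 x e (Y w);
    have := ramp_le1 x e (Y w); lra.
- exact: finite_measure_integrable_cst.
Qed.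

Lemma integrable_ramp x e : P.-integrable [set: T] (fun w => (ramp x e (Y w))%:E).
Proof.
have i1 : P.-integrable [set: T] (fun=> 1%:E).
  exact: finite_measure_integrable_cst.
apply: eq_integrable (integrableB measurableT i1 (iramp x e)) => // w _ /=.
by rewrite -EFinB opprB addrCA subrr addr0.
Qed.

Let one_minus x e : \int[P]_w (1 - ramp x e (Y w)) = 1 - \int[P]_w ramp x e (Y w).
Proof.
rewrite RintegralB//; last exact: integrable_ramp.
  by rewrite Rintegral_cst// mul1r; congr (_ - _); exact: (congr1 fine (probability_setT P)).
exact: finite_measure_integrable_cst.
Qed.

Lemma cdf_le_ramp x e : 0 < e ->
  fine (P [set w | Y w <= x]) <= 1 - \int[P]_w ramp x e (Y w).
Proof.
move=> e0; rewrite -one_minus indE; apply: le_Rintegral => //.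
- exact: integrable_indic.
- exact: iramp.
move=> w _; rewrite indicE; case: (boolP (w \in _)) => [|_].
  by rewrite inE /= => /(ramp_left e0) ->; rewrite subr0.
by rewrite subr_ge0 ramp_le1.
Qed.

Lemma ramp_le_cdf x e : 0 < e ->
  1 - \int[P]_w ramp x e (Y w) <= fine (P [set w | Y w <= x + e]).
Proof.
move=> e0; rewrite -one_minus indE; apply: le_Rintegral => //.
- exact: iramp.
- exact: integrable_indic.
move=> w _; rewrite indicE; case: (boolP (w \in _)) => [_|].
  by rewrite lerBlDr lerDl ramp_ge0.
by rewrite notin_setE /= => /negP; rewrite -ltNge => /ltW/(ramp_right e0) ->; rewrite subrr.
Qed.

End ramp.

(** * Wasserstein and Kolmogorov distances *)

Section distance_bounds.
Context (R : realType) (d d' : measure_display).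
Context (T : measurableType d) (U : measurableType d').
Variables (P : probability T R) (Q : probability U R).
Variables (F : T -> R) (Z : {RV Q >-> R}) (B : R).
Hypothesis mF : measurable_fun [set: T] F.
Hypothesis hZ : standard_normal Z.
Hypothesis B_ge0 : 0 <= B.

Hypothesis hB : forall h : R -> R, continuous h -> {homo h : x y / x <= y} ->
  (forall x y, x <= y -> h y - h x <= 1 + (y - x)) ->
  P.-integrable [set: T] (fun w => (h (F w))%:E) /\
  `|\int[P]_w h (F w) - normal_mean h| <= B.

Let hBZ (h : R -> R) : continuous h -> {homo h : x y / x <= y} ->
  (forall x y, x <= y -> h y - h x <= 1 + (y - x)) ->
  [/\ P.-integrable [set: T] (fun w => (h (F w))%:E),
      Q.-integrable [set: U] (fun w => (h (Z w))%:E)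
    & `|\int[P]_w h (F w) - \int[Q]_w h (Z w)| <= B].
Proof.
move=> ch mh gh; have [iF bF] := hB ch mh gh.
have := standard_normal_mean hZ (continuous_measurable_fun ch)
  (integrable_normal_growth ch (stein_class_growth mh gh)).
by case=> iZ ->.
Qed.

(** [h = 2 * hp - id] with [hp] and [id] both in the class, so the errors add up to [2 * B + B]. *)
Lemma wasserstein_le : (wasserstein_dist P Q F Z <= (3 * B)%:E)%E.
Proof.
apply: ge_ereal_sup => _ [h hl <-].
have lip x y : `|h x - h y| <= `|x - y|.
  by have := hl (x, y) (conj I I); rewrite /= mul1r.
have ch : continuous h.
  move=> x; apply/cvgrPdist_le => e e0; near=> y; apply: le_trans (lip _ _) _.
  by near: y; apply: (@cvgr_dist_le _ _ _ _ _ id x _ e e0); exact: cvg_id.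
pose hp x := 2^-1 * (h x + x).
have chp : continuous hp.
  by move=> x; apply: cvgMl_tmp; apply: cvgD; [exact: ch|exact: cvg_id].
have mhp : {homo hp : x y / x <= y}.
  move=> x y xy; rewrite /hp ler_pM2l ?invr_gt0//.
  have := lip y x; rewrite ler_norml (ger0_norm (_ : 0 <= y - x)) ?subr_ge0//.
  by move=> /andP[? ?]; lra.
have ghp x y : x <= y -> hp y - hp x <= 1 + (y - x).
  move=> xy; have := lip y x; rewrite ler_norml (ger0_norm (_ : 0 <= y - x)) ?subr_ge0//.
  by move=> /andP[? ?]; rewrite /hp; lra.
have [iFp iZp bp] := hBZ chp mhp ghp.
have cid : continuous (@id R) by move=> x; exact: cvg_id.
have gid (x y : R) : x <= y -> id y - id x <= 1 + (y - x) by move=> _ /=; lra.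
have [iF1 iZ1 b1] := hBZ cid (fun _ _ xy => xy) gid.
have hE : h = fun x => 2 * hp x - x by apply/funext => x; rewrite /hp; field.
have decomp (d0 : measure_display) (T0 : measurableType d0) (P0 : probability T0 R)
   (Y : T0 -> R) : P0.-integrable [set: T0] (fun w => (hp (Y w))%:E) ->
   P0.-integrable [set: T0] (fun w => (Y w)%:E) ->
   'E_P0[h \o Y]%E = (2 * \int[P0]_w hp (Y w) - \int[P0]_w Y w)%:E.
  move=> i1 i2; have i3 : P0.-integrable [set: T0] (fun w => (2 * hp (Y w))%:E).
    by under eq_fun do rewrite EFinM; exact: integrableZl.
  rewrite expectation.unlock -RintegralZl// -RintegralB//.
  have -> : (fun w => (2 * hp (Y w) - Y w)) = h \o Y.
    by apply/funext => w; rewrite /= hE.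
  rewrite /Rintegral fineK//; apply: integrable_fin_num => //.
  apply: eq_integrable (integrableB measurableT i3 i2) => // w _ /=.
  by rewrite -EFinB hE.
rewrite (decomp _ _ P F)// (decomp _ _ Q Z)// -EFinB lee_fin.
move: bp b1; rewrite !ler_norml => /andP[? ?] /andP[? ?]; apply/andP; split; lra.
Unshelve. all: by end_near. Qed.

Lemma kolmogorov_le : (kolmogorov_dist P Q F Z <= B%:E)%E.
Proof.
apply: ge_ereal_sup => _ [x _ <-].
have mZ : measurable_fun [set: U] Z by [].
have bR y e : 0 < e ->
    `|\int[P]_w ramp y e (F w) - \int[Q]_w ramp y e (Z w)| <= B.
  move=> e0; have [|||//] := @hBZ (ramp y e).
  - exact: ramp_continuous.
  - exact: ramp_homo.
  - by move=> ? ? ?; exact: ramp_growth.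
have mle y : measurable [set w | Z w <= y].
  rewrite (_ : [set w | Z w <= y] = Z @^-1` `]-oo, y]).
    by rewrite -[_ @^-1` _]setTI; exact: mZ.
  by apply/seteqP; split => w /=; rewrite in_itv.
have incr y e : 0 < e ->
    fine (Q [set w | Z w <= y + e]) <= fine (Q [set w | Z w <= y]) + e.
  move=> e0; have mi : measurable [set w | y < Z w <= y + e].
    rewrite (_ : [set w | _] = Z @^-1` `]y, y + e]).
      by rewrite -[_ @^-1` _]setTI; exact: mZ.
    by apply/seteqP; split => w /=; rewrite in_itv.
  have sub : [set w | Z w <= y + e] `<=` [set w | Z w <= y] `|` [set w | y < Z w <= y + e].
    by move=> w /= wy; case: (lerP (Z w) y) => zy; [left|right; rewrite wy].
  have fin A : measurable A -> Q A \is a fin_num by move=> mA; exact: fin_num_measure.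
  rewrite -lee_fin EFinD !fineK ?fin//.
  apply: le_trans (le_measure Q _ _ sub) _; rewrite ?inE//; first exact: measurableU.
  apply: le_trans (measureU2 _ _ _) _ => //.
  by rewrite leeD2l// standard_normal_interval_le// ltW.
have finP : P [set w | F w <= x] \is a fin_num.
  apply: fin_num_measure; rewrite (_ : [set w | F w <= x] = F @^-1` `]-oo, x]).
    by rewrite -[_ @^-1` _]setTI; exact: mF.
  by apply/seteqP; split => w /=; rewrite in_itv.
have finQ : Q [set w | Z w <= x] \is a fin_num by exact: fin_num_measure.
rewrite -(fineK finP) -(fineK finQ) -EFinB lee_fin.
(* A ramp on [[x - e, x]] gives the lower bound and one on [[x, x + e]] the upper bound. The bound
   [B] does not see [e], and the normal law charges each interval by at most [e], which is
   arbitrary. *)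
apply/ler_addgt0Pr => e e0; rewrite ler_norml; apply/andP; split.
- have h1 := ramp_le_cdf P mF (x - e) e0; rewrite subrK in h1.
  have h2 := cdf_le_ramp Q mZ (x - e) e0.
  have h3 := incr (x - e) e e0; rewrite subrK in h3.
  have := bR (x - e) e e0; rewrite ler_norml => /andP[? ?]; lra.
- have h1 := cdf_le_ramp P mF x e0.
  have h2 := ramp_le_cdf Q mZ x e0.
  have h3 := incr x e e0.
  have := bR x e e0; rewrite ler_norml => /andP[? ?]; lra.
Qed.

End distance_bounds.

(** * Constants and conclusion *)

Lemma hop_cst_gt0 (R : realType) (m : nat) (t kappa : R) : 0 < t -> 0 < kappa ->
  0 < hop_cst m t kappa.
Proof.
move=> t0 k0; have K0 : 0 < hop_moment_cst m t.
  exact: lt_le_trans (hop_moment_cst_ge1 m t0).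
have v0 : 0 < kappa ^+ 2 / t by rewrite divr_gt0// exprn_gt0.
have t1 : 0 < t + 1 by rewrite addr_gt0.
apply: addr_gt0; first by rewrite divr_gt0 ?sqrtr_gt0// mulr_gt0.
by rewrite divr_gt0// !addr_gt0// !mulr_gt0 ?exprn_gt0.
Qed.

Theorem proposition8p1 (R : realType) (r : R) (k : nat) (t : R)
    (hr : 0 < r) (hk : (2 <= k)%N)
    (ht : k.-1%:R * r <= t < k%:R * r) :
  exists C : R, 0 < C /\
  exists lam0 : R, 0 < lam0 /\
  forall lam : R, lam0 < lam ->
  forall (d : measure_display) (T : measurableType d) (P : probability T R)
    (X : T -> {fset R}),
  poisson_process P `[0, k%:R * r] lam X ->
  forall (d' : measure_display) (U : measurableType d') (Q : probability U R)
    (Z : {RV Q >-> R}),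
  standard_normal Z ->
  let sigma := fun w : T => (hop_count k r t (X w))%:R in
  (wasserstein_dist P Q (renormalized P sigma) Z
     <= (C / Num.sqrt lam)%:E)%E /\
  (kolmogorov_dist P Q (renormalized P sigma) Z
     <= (C / Num.sqrt lam)%:E)%E.
Proof.
case: k hk ht => [//|m] m_gt0 /= /andP[mt tL].
have {}m_gt0 : (0 < m)%N by [].
have t_gt0 : 0 < t by apply: lt_le_trans mt; rewrite mulr_gt0// ltr0n.
have L_gt0 : 0 < m.+1%:R * r by rewrite mulr_gt0.
have kappa_gt0 : 0 < hop_kappa r t m.
  rewrite exprn_gt0// divr_gt0// (@box_radius_gt0 _ _ _ _ t_gt0)//.
  by rewrite ltr_pdivrMr// mulrC.
pose C0 := stein_cst R * hop_cst m (m.+1%:R * r) (hop_kappa r t m).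
have C0_gt0 : 0 < C0 by rewrite mulr_gt0 ?stein_cst_gt0 ?hop_cst_gt0.
(* The factor 3 is the price of the decomposition used for the Wasserstein distance; the Kolmogorov
   bound holds with [C0] itself. *)
exists (3 * C0); split; first by rewrite mulr_gt0.
(* Beyond 1 the powers of [lam] increase with the exponent, as the moment bounds require, and
   [1 / lam] is at most [1 / Num.sqrt lam]. *)
exists 1; split => // lam lam1 d T P X hP d' U Q Z hZ.
pose sigma (w : T) : R := (hop_count m.+1 r t (X w))%:R; rewrite -/sigma.
have lam_gt0 : 0 < lam by exact: lt_trans lam1.
have sl : 0 < Num.sqrt lam by rewrite sqrtr_gt0.
have B_ge0 : 0 <= C0 / Num.sqrt lam by rewrite divr_ge0// ltW.
pose mu := \int[P]_w sigma w; pose V := \int[P]_w (sigma w - mu) ^+ 2.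
have FE : renormalized P sigma = fun w => (sigma w - mu) / Num.sqrt V.
  have EE : fine 'E_P[sigma]%E = mu by rewrite expectation.unlock.
  apply/funext => w; rewrite /renormalized /variance covariance.unlock EE.
  congr (_ / Num.sqrt _); rewrite expectation.unlock; congr fine.
have mF : measurable_fun [set: T] (renormalized P sigma).
  rewrite FE; exact: (measurable_normalized_hop_count t_gt0 tL lam1 hP).
have hB (h : R -> R) : continuous h -> {homo h : x y / x <= y} ->
    (forall x y, x <= y -> h y - h x <= 1 + (y - x)) ->
    P.-integrable [set: T] (fun w => (h (renormalized P sigma w))%:E) /\
    `|\int[P]_w h (renormalized P sigma w) - normal_mean h| <= C0 / Num.sqrt lam.
  move=> ch mh gh; rewrite FE; split.
    exact: (integrable_stein_class m_gt0 t_gt0 tL lam1 hP ch mh gh).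
  exact: (hop_count_stein m_gt0 t_gt0 tL lam1 hP ch mh gh).
split; first by rewrite -mulrA; exact: wasserstein_le.
apply: le_trans (kolmogorov_le mF hZ hB) _.
by rewrite lee_fin -mulrA ler_peMl//; lra.
Qed.
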